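(* Let $G=\mathbb{Z}_4=\{0,1,2,3\}$, so $d=2+\sqrt5$. There exist exactly two solutions, up to gauge equivalence and group automorphism, of the polynomial equations (P1)–(P9), and they satisfy $\eta_g=1$ for all $g$ and $\epsilon_2(1)=-1$. They are mutually accompanying solutions, and only one of them satisfies $A_0(h,0)=\delta_{h,0}-\frac1{d-1}$ for all $h\in G$. With the normalization $\epsilon_1(3)=\epsilon_3(1)=\epsilon_2(1)=\epsilon_2(3)=-1$ and all other $\epsilon_h(g)=1$, this one is given by the matrices $A_g=(A_g(h,k))_{h,k=0,1,2,3}$: $$A_0=\frac1{d-1}\begin{pmatrix}d-2&-1&-1&-1\\-1&-1&z&-z\\-1&\overline z&-1&z\\-1&-\overline z&\overline z&-1\end{pmatrix},\quad A_1=\frac1{d-1}\begin{pmatrix}d-2&-1&-1&-1\\-1&-1&z&z\\-1&\overline z&1&-z\\-1&\overline z&-\overline z&1\end{pmatrix},$$ $$A_2=\frac1{d-1}\begin{pmatrix}d-2&-1&-1&-1\\-1&-1&-z&z\\-1&-\overline z&-1&-z\\-1&\overline z&-\overline z&-1\end{pmatrix},\quad A_3=\frac1{d-1}\begin{pmatrix}d-2&-1&-1&-1\\-1&1&-z&z\\-1&-\overline z&1&z\\-1&\overline z&\overline z&-1\end{pmatrix},$$ $$z=-\frac{d-1}2\pm i\sqrt{\frac{d-1}2}=-\frac{1+\sqrt5}2\pm i\sqrt{\frac{1+\sqrt5}2}.$$ This solution gives a subfactor of index $3+\sqrt5$ whose canonical endomorphism is $\mathrm{id}\oplus\rho$, where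 $\rho$ is the distinguished simple object of the associated generalized Haagerup category.
   Context: Let $G$ be a finite abelian group, written additively, $n=|G|$, $d=\frac{n+\sqrt{n^2+4}}2$, $\mathbb T=\{z\in\mathbb C:|z|=1\}$. Polynomial equations. $\epsilon_h(g)\in\{1,-1\}$, $\eta_g\in\mathbb T$, $A_g(h,k)\in\mathbb C$ satisfy, for all elements of $G$: (P1) $\epsilon_{h+k}(g)=\epsilon_h(g)\epsilon_k(g+2h)$, $\epsilon_h(0)=1$; (P2) $\eta_{g+2h}=\eta_g$, $\eta_g^3=1$; (P3) $\sum_{h}A_g(h,0)=-\overline{\eta_g}/d$; (P4) $\sum_{h}A_g(h-g,k)\overline{A_{g'}(h-g',k)}=\delta_{g,g'}-\frac{\overline{\eta_g}\eta_{g'}}{d}\delta_{k,0}$; (P5) $A_{g+2h}(p,q)=\epsilon_h(g)\epsilon_h(g+p)\epsilon_h(g+q)\epsilon_h(g+p+q)A_g(p,q)$; (P6) $A_g(k,h)=\overline{A_g(h,k)}$; (P7) $A_g(h,k)=A_g(-k,h-k)\,\eta_g\,\epsilon_{-k}(g+h)\epsilon_{-k}(g+k)\epsilon_{-k}(g+h+k)=A_g(k-h,-h)\,\overline{\eta_g}\,\epsilon_{-h}(g+h)\epsilon_{-h}(g+k)\epsilon_{-h}(g+h+k)$; (P8) $A_g(h,k)=A_{g+h}(h,k)\eta_g\eta_{g+k}\overline{\eta_{g+h}\eta_{g+h+k}}\epsilon_h(g)\epsilon_h(g+k)=A_{g+k}(h,k)\overline{\eta_g\eta_{g+h}}\eta_{g+k}\eta_{g+h+k}\epsilon_k(g)\epsilon_k(g+h)$;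 (P9) $\sum_{l}A_g(x+y,l)A_{g-p+x}(-x,l+p)A_{g-q+x+y}(-y,l+q)=A_g(p+x,q+x+y)A_{g-p}(q+y,p+x+y)\,\eta_g\eta_{g+q+x}\eta_{g+p+q+y}\overline{\eta_{g+p}\eta_{g+x+y}\eta_{g+q+x+y}}\,\epsilon_p(g-p+x)\epsilon_{p+x}(g-p+q+y)\epsilon_q(g-q+x+y)\epsilon_{q+y}(g-q+x)-\frac{\delta_{x,0}\delta_{y,0}}{d}\eta_g\eta_{g+p}\eta_{g+q}$. Gauge equivalence: $(\epsilon,\eta,A)\sim(\epsilon',\eta,A')$ if for some $\delta_g\in\{1,-1\}$: $\epsilon'_h(g)=\delta_g\delta_{g+2h}\epsilon_h(g)$, $A'_g(h,k)=\delta_g\delta_{g+h}\delta_{g+k}\delta_{g+h+k}A_g(h,k)$. $\theta\in\operatorname{Aut}(G)$ acts by $\epsilon'_{\theta(h)}(\theta(g))=\epsilon_h(g)$, $\eta'_{\theta(g)}=\eta_g$, $A'_{\theta(g)}(\theta(h),\theta(k))=A_g(h,k)$. Associated category. A solution is realized on a type III factor $M$ by an outer action $\alpha$ of $G$, an irreducible $\rho\in\operatorname{End}(M)$ with $\alpha_g\rho=\rho\alpha_{-g}$, and isometries $S\in(\mathrm{id},\rho^2)$, $T_g\in(\alpha_g\rho,\rho^2)$ (where $(\sigma,\sigma')=\{T\in M:T\sigma(x)=\sigma'(x)T\ \forall x\}$) with $SS^*+\sum_gT_gT_g^*=1$, $\alpha_h(S)=S$, $\alpha_h(T_g)=\epsilon_h(g)T_{g+2h}$,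 $\rho(S)=\frac1dS+\frac1{\sqrt d}\sum_gT_gT_g$, $\alpha_g\rho(T_g)=\eta_gT_gSS^*+\frac{\overline{\eta_g}}{\sqrt d}ST_g^*+\sum_{h,k}A_g(h,k)T_{g+h}T_{g+h+k}T_{g+k}^*$; the simple objects $\alpha_g,\alpha_g\rho$ generate the associated C$^*$-generalized Haagerup category. The canonical endomorphism of a subfactor with inclusion $\iota:N\hookrightarrow M$ is $\iota\overline\iota$. Accompanying solution. Extend $\rho$ to the crossed product $M\rtimes_\alpha G$, with implementing unitaries $\lambda_g$, by $\tilde\rho(\lambda_g)=\lambda_{-g}$. When $\tilde\rho$ generates a generalized Haagerup category with group $\widehat G$ (acting by the dual action $\hat\alpha$, $\hat\alpha_\chi(\lambda_g)=\chi(g)\lambda_g$), as happens here with $\widehat G\cong\mathbb Z_4$, the solution obtained from $[\tilde\rho,\hat\alpha]$ (that is, from isometries in $(\mathrm{id},\tilde\rho^2)$ and $(\hat\alpha_\chi\tilde\rho,\tilde\rho^2)$ by the formulas above) is called the accompanying solution. *)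

(* Defs.v *)
From HB Require Import structures.
From mathcomp Require Import all_boot all_order all_algebra.
From mathcomp Require Import all_classical all_reals topology normedtype.
From mathcomp Require Import complex.

Set Implicit Arguments.
Unset Strict Implicit.
Unset Printing Implicit Defensive.

Import Order.TTheory GRing.Theory Num.Theory.

Local Open Scope classical_set_scope.
Local Open Scope complex_scope.
Local Open Scope ring_scope.

(* The subscripts come first: eps h g, eta g and coef g h k are
   epsilon_h(g), eta_g and A_g(h, k). *)
Record datum (R : realType) (G : finZmodType) := Datum {
  eps : G -> G -> R[i];
  eta : G -> R[i];
  coef : G -> G -> G -> R[i]
}.

Definition gdim (R : realType) (G : finZmodType) : R :=
  (#|G|%:R + Num.sqrt (#|G|%:R ^+ 2 + 4)) / 2.

Definition kron (R : realType) (G : finZmodType) (x y : G) : R[i] :=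
  (x == y)%:R.

Record is_solution (R : realType) (G : finZmodType) (s : datum R G) : Prop :=
 IsSolution {
  sol_sign : forall h g, eps s h g = 1 \/ eps s h g = -1;
  sol_circle : forall g, `|eta s g| = 1;
  sol_P1 : (forall h k g,
    eps s (h + k) g = eps s h g * eps s k (g + h *+ 2)) /\
    (forall h, eps s h 0 = 1);
  sol_P2 : forall g h, eta s (g + h *+ 2) = eta s g /\ eta s g ^+ 3 = 1;
  sol_P3 : forall g,
    \sum_h coef s g h 0 = - (eta s g)^* / (gdim R G)%:C;
  sol_P4 : forall g g' k,
    \sum_h coef s g (h - g) k * (coef s g' (h - g') k)^* =
    kron R g g' - (eta s g)^* * eta s g' / (gdim R G)%:C * kron R k 0;
  sol_P5 : forall g h p q,
    coef s (g + h *+ 2) p q =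
    eps s h g * eps s h (g + p) * eps s h (g + q) * eps s h (g + p + q) *
    coef s g p q;
  sol_P6 : forall g h k, coef s g k h = (coef s g h k)^*;
  sol_P7 : forall g h k,
    coef s g h k = coef s g (- k) (h - k) * eta s g *
      eps s (- k) (g + h) * eps s (- k) (g + k) * eps s (- k) (g + h + k) /\
    coef s g h k = coef s g (k - h) (- h) * (eta s g)^* *
      eps s (- h) (g + h) * eps s (- h) (g + k) * eps s (- h) (g + h + k);
  sol_P8 : forall g h k,
    coef s g h k = coef s (g + h) h k * eta s g * eta s (g + k) *
      (eta s (g + h) * eta s (g + h + k))^* * eps s h g * eps s h (g + k) /\
    coef s g h k = coef s (g + k) h k * (eta s g * eta s (g + h))^* *
      eta s (g + k) * eta s (g + h + k) * eps s k g * eps s k (g + h);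
  sol_P9 : forall g p q x y,
    \sum_l coef s g (x + y) l * coef s (g - p + x) (- x) (l + p) *
           coef s (g - q + x + y) (- y) (l + q) =
    coef s g (p + x) (q + x + y) * coef s (g - p) (q + y) (p + x + y) *
      eta s g * eta s (g + q + x) * eta s (g + p + q + y) *
      (eta s (g + p) * eta s (g + x + y) * eta s (g + q + x + y))^* *
      eps s p (g - p + x) * eps s (p + x) (g - p + q + y) *
      eps s q (g - q + x + y) * eps s (q + y) (g - q + x)
    - kron R x 0 * kron R y 0 / (gdim R G)%:C *
      eta s g * eta s (g + p) * eta s (g + q)
}.

Definition gauge_equiv (R : realType) (G : finZmodType) (s s' : datum R G) :
    Prop :=
  exists delta : G -> R[i],
    [/\ forall g, delta g = 1 \/ delta g = -1,
        forall h g, eps s' h g = delta g * delta (g + h *+ 2) * eps s h g,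
        forall g, eta s' g = eta s g &
        forall g h k, coef s' g h k =
          delta g * delta (g + h) * delta (g + k) * delta (g + h + k) *
          coef s g h k].

Definition aut_image (R : realType) (G : finZmodType) (theta : G -> G)
    (s s' : datum R G) : Prop :=
  [/\ forall h g, eps s' (theta h) (theta g) = eps s h g,
      forall g, eta s' (theta g) = eta s g &
      forall g h k, coef s' (theta g) (theta h) (theta k) = coef s g h k].

(* The automorphism group normalizes the gauge group, so composing one
   automorphism with one gauge transformation already gives the equivalence
   relation generated by both. *)
Definition equivalent (R : realType) (G : finZmodType) (s s' : datum R G) :
    Prop :=
  exists (theta : G -> G) (t : datum R G),
    [/\ bijective theta, {morph theta : x y / x + y},
        aut_image theta s t & gauge_equiv t s'].

HB.mixin Record Algebra_isStar (R : rcfType) A of GRing.Algebra R[i] A := {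
  star : A -> A;
  starK : involutive star;
  starD : {morph star : x y / x + y};
  starM : forall x y : A, star (x * y) = star y * star x;
  starZ : forall (c : R[i]) (x : A), star (c *: x) = c^* *: star x
}.

#[short(type="starAlgType")]
HB.structure Definition StarAlgebra (R : rcfType) :=
  {A of GRing.Algebra R[i] A & Algebra_isStar R A}.

Record star_hom (R : realType) (A B : starAlgType R) (f : A -> B) : Prop :=
 StarHom {
  shom_lin : forall (c : R[i]) x y, f (c *: x + y) = c *: f x + f y;
  shom1 : f 1 = 1;
  shomM : {morph f : x y / x * y};
  shomS : {morph f : x / star x}
}.

Definition isometry (R : realType) (A : starAlgType R) (v : A) : Prop :=
  star v * v = 1.

Definition unitary (R : realType) (A : starAlgType R) (u : A) : Prop :=
  star u * u = 1 /\ u * star u = 1.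

(* The intertwiner space (f, g). *)
Definition intertwiner (R : realType) (A : starAlgType R) (f g : A -> A)
    (t : A) : Prop :=
  forall x, t * f x = g x * t.

Definition irreducible_endo (R : realType) (A : starAlgType R) (f : A -> A) :
    Prop :=
  forall t, intertwiner f f t -> exists c : R[i], t = c%:A.

Record is_action (R : realType) (G : finZmodType) (A : starAlgType R)
    (al : G -> A -> A) : Prop := IsAction {
  action_hom : forall g, star_hom (al g);
  action0 : forall x, al 0 x = x;
  actionD : forall g h x, al (g + h) x = al g (al h x)
}.

Record action (R : realType) (G : finZmodType) (A : starAlgType R) := Action {
  act :> G -> A -> A;
  actP : is_action act
}.

Definition outer_action (R : realType) (G : finZmodType) (A : starAlgType R)
    (al : G -> A -> A) : Prop :=
  is_action al /\
  forall g, g != 0 ->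
    ~ exists2 u, unitary u & forall x, al g x = u * x * star u.

Record realizes (R : realType) (G : finZmodType) (A : starAlgType R)
    (al : G -> A -> A) (rho : A -> A) (S : A) (T : G -> A) (s : datum R G) :
    Prop := Realizes {
  real_outer : outer_action al;
  real_hom : star_hom rho;
  real_irr : irreducible_endo rho;
  real_comm : forall g x, al g (rho x) = rho (al (- g) x);
  real_S : isometry S /\ intertwiner id (rho \o rho) S;
  real_T : forall g,
    isometry (T g) /\ intertwiner (al g \o rho) (rho \o rho) (T g);
  real_sum : S * star S + \sum_g T g * star (T g) = 1;
  real_alS : forall h, al h S = S;
  real_alT : forall h g, al h (T g) = eps s h g *: T (g + h *+ 2);
  real_rhoS : rho S =
    ((gdim R G)^-1)%:C *: S +
    ((Num.sqrt (gdim R G))^-1)%:C *: \sum_g T g * T g;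
  real_rhoT : forall g, al g (rho (T g)) =
    eta s g *: (T g * S * star S) +
    ((eta s g)^* / (Num.sqrt (gdim R G))%:C) *: (S * star (T g)) +
    \sum_h \sum_k
      coef s g h k *: (T (g + h) * T (g + h + k) * star (T (g + k)))
}.

(* For finite G the crossed product consists of the sums
   \sum_g x_g lambda_g with unique coefficients x_g in A; such a sum is stored
   as the family (x_g)_g, and lambda_g x = al_g(x) lambda_g dictates the
   multiplication and the adjoint. *)
Definition crossed (R : realType) (G : finZmodType) (A : starAlgType R)
  (al : action G A) : Type := {ffun G -> A}.

Section Crossed.
Variables (R : realType) (G : finZmodType) (A : starAlgType R).
Variable al : action G A.
Implicit Types (x y z : crossed al).

HB.instance Definition _ := GRing.Lmodule.copy (crossed al) {ffun G -> A}.

Definition cfam (x : crossed al) : {ffun G -> A} := x.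

Definition crossed_one : crossed al := [ffun g : G => (g == 0)%:R : A].
Definition crossed_mul x y : crossed al :=
  [ffun g => \sum_h cfam x h * al h (cfam y (g - h))].
Definition crossed_star x : crossed al :=
  [ffun g => al g (star (cfam x (- g)))].

Lemma shom_additive (B : starAlgType R) (f : A -> B) (hf : star_hom f) :
  [/\ f 0 = 0, {morph f : a b / a + b} &
      forall (c : R[i]) (a : A), f (c *: a) = c *: f a].
Proof.
have h0 : f 0 = 0.
  have := shom_lin hf (-1) 0 0.
  by rewrite scaler0 addr0 scaleN1r addNr.
split=> // [x y|c x]; first by have := shom_lin hf 1 x y; rewrite !scale1r.
by have := shom_lin hf c x 0; rewrite h0 !addr0.
Qed.

Lemma act_sum g (F : G -> A) : al g (\sum_h F h) = \sum_h al g (F h).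
Proof.
have [h0 hD _] := shom_additive (action_hom (actP al) g).
exact: (big_morph (al g) hD h0).
Qed.

Lemma star_sum (F : G -> A) : star (\sum_h F h) = \sum_h star (F h).
Proof.
have h0 : star (0 : A) = 0.
  by apply: (addrI (star (0 : A))); rewrite -starD !addr0.
exact: (big_morph star (@starD R A) h0).
Qed.

Lemma crossed_mulA : associative crossed_mul.
Proof.
move=> x y z; apply/ffunP=> g; rewrite !ffunE.
transitivity (\sum_h \sum_l
    cfam x h * (al h (cfam y l) * al (h + l) (cfam z (g - h - l)))).
  apply: eq_bigr => h _; rewrite ffunE act_sum big_distrr /=.
  apply: eq_bigr => l _; rewrite (shomM (action_hom (actP al) h)).
  by rewrite (actionD (actP al)).
under [RHS]eq_bigr => k _ do rewrite ffunE big_distrl /=.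
rewrite [RHS]exchange_big /=; apply: eq_bigr => h _.
rewrite [RHS](reindex (fun l => h + l)) /=; last first.
  by exists (fun k => k - h) => k _; rewrite ?subrKC // addrC addKr.
apply: eq_bigr => l _; rewrite mulrA opprD addrA.
by rewrite [h + l]addrC addrK [l + h]addrC.
Qed.

Lemma crossed_mul1x : left_id crossed_one crossed_mul.
Proof.
move=> x; apply/ffunP=> g; rewrite ffunE (bigD1 0) //= big1 => [|h /negPf h0].
  by rewrite ffunE eqxx mul1r subr0 (action0 (actP al)) addr0.
by rewrite ffunE h0 mul0r.
Qed.

Lemma crossed_mulx1 : right_id crossed_one crossed_mul.
Proof.
move=> x; apply/ffunP=> g; rewrite ffunE (bigD1 g) //= big1 => [|h].
  by rewrite ffunE subrr eqxx (shom1 (action_hom (actP al) g)) mulr1 addr0.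
have [h0 _ _] := shom_additive (action_hom (actP al) h).
by rewrite ffunE subr_eq0 eq_sym => /negPf ->; rewrite h0 mulr0.
Qed.

Lemma crossed_mulDl : left_distributive crossed_mul +%R.
Proof.
move=> x y z; apply/ffunP=> g; rewrite !ffunE -big_split /=.
by apply: eq_bigr => h _; rewrite /cfam ffunE mulrDl.
Qed.

Lemma crossed_mulDr : right_distributive crossed_mul +%R.
Proof.
move=> x y z; apply/ffunP=> g; rewrite !ffunE -big_split /=.
apply: eq_bigr => h _.
have [_ hD _] := shom_additive (action_hom (actP al) h).
by rewrite /cfam ffunE hD mulrDr.
Qed.

Lemma crossed_one_neq0 : crossed_one != 0.
Proof.
by apply/eqP=> /ffunP/(_ 0); rewrite !ffunE eqxx => /eqP; rewrite oner_eq0.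
Qed.

HB.instance Definition _ := GRing.Zmodule_isNzRing.Build (crossed al)
  crossed_mulA crossed_mul1x crossed_mulx1 crossed_mulDl crossed_mulDr
  crossed_one_neq0.

Lemma crossed_scaleAl (c : R[i]) x y : c *: (x * y) = (c *: x) * y.
Proof.
apply/ffunP=> g; rewrite !ffunE scaler_sumr; apply: eq_bigr => h _.
by rewrite /cfam ffunE scalerAl.
Qed.

Lemma crossed_scaleAr (c : R[i]) x y : c *: (x * y) = x * (c *: y).
Proof.
apply/ffunP=> g; rewrite !ffunE scaler_sumr; apply: eq_bigr => h _.
have [_ _ hZ] := shom_additive (action_hom (actP al) h).
by rewrite /cfam ffunE hZ scalerAr.
Qed.

HB.instance Definition _ :=
  GRing.Lmodule_isLalgebra.Build R[i] (crossed al) crossed_scaleAl.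
HB.instance Definition _ :=
  GRing.Lalgebra_isAlgebra.Build R[i] (crossed al) crossed_scaleAr.

Lemma crossed_starK : involutive crossed_star.
Proof.
move=> x; apply/ffunP=> g; rewrite !ffunE opprK.
rewrite (shomS (action_hom (actP al) (- g))) starK -(actionD (actP al)).
by rewrite subrr (action0 (actP al)).
Qed.

Lemma crossed_starD : {morph crossed_star : x y / x + y}.
Proof.
move=> x y; apply/ffunP=> g; rewrite !ffunE starD.
by have [_ -> _] := shom_additive (action_hom (actP al) g).
Qed.

Lemma crossed_starM x y :
  crossed_star (x * y) = crossed_star y * crossed_star x.
Proof.
apply/ffunP=> g; rewrite !ffunE star_sum act_sum.
rewrite [RHS](reindex (fun h => g + h)) /=; last first.
  by exists (fun k => k - g) => k _; rewrite ?subrKC // addrC addKr.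
apply: eq_bigr => h _; rewrite !ffunE starM.
rewrite (shomM (action_hom (actP al) g)).
rewrite -(shomS (action_hom (actP al) h)) -!(actionD (actP al)).
have -> : g - (g + h) = - h by rewrite opprD addrA subrr add0r.
by rewrite addrK opprK opprD.
Qed.

Lemma crossed_starZ (c : R[i]) x :
  crossed_star (c *: x) = c^* *: crossed_star x.
Proof.
apply/ffunP=> g; rewrite !ffunE starZ.
by have [_ _ ->] := shom_additive (action_hom (actP al) g).
Qed.

HB.instance Definition _ := Algebra_isStar.Build R (crossed al)
  crossed_starK crossed_starD crossed_starM crossed_starZ.

(* \sum_g x_g lambda_g |-> \sum_g rho(x_g) lambda_(-g); this is multiplicative
   when al_g \o rho = rho \o al_(-g). *)
Definition crossed_extend (rho : A -> A) (x : crossed al) : crossed al :=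
  [ffun g => rho (cfam x (- g))].

(* \sum_g x_g lambda_g |-> \sum_g chi(g) x_g lambda_g. *)
Definition crossed_dual (chi : G -> R[i]) (x : crossed al) : crossed al :=
  [ffun g => chi g *: cfam x g].

End Crossed.

Section VonNeumann.
Variables (R : realType) (M : starAlgType R).
Implicit Types N D : set M.

Definition bounded_op (H : normedModType R[i]) (t : H -> H) : Prop :=
  linear t /\ continuous t.

Definition commutant (H : normedModType R[i]) (X : set (H -> H)) :
    set (H -> H) :=
  [set t | bounded_op t /\ forall x, X x -> forall u, t (x u) = x (t u)].

(* Identifies M with a von Neumann algebra on the Hilbert space vnH; the norm
   of vnH, in which it is complete, is the one given by the inner product. *)
Record von_neumann := VonNeumann {
  vnH : completeNormedModType R[i];
  vnip : vnH -> vnH -> R[i];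
  vnpi : M -> vnH -> vnH;
  vnip_lin : forall (c : R[i]) (u v w : vnH),
    vnip (c *: u + v) w = c * vnip u w + vnip v w;
  vnip_conj : forall u v : vnH, vnip v u = (vnip u v)^*;
  vnip_norm : forall u : vnH, vnip u u = `|u| ^+ 2;
  vnpi_bounded : forall x, bounded_op (vnpi x);
  vnpi_lin : forall (c : R[i]) x y (u : vnH),
    vnpi (c *: x + y) u = c *: vnpi x u + vnpi y u;
  vnpi_one : forall u, vnpi 1 u = u;
  vnpi_mul : forall x y u, vnpi (x * y) u = vnpi x (vnpi y u);
  vnpi_star : forall x u v, vnip (vnpi x u) v = vnip u (vnpi (star x) v);
  vnpi_inj : forall x, (forall u, vnpi x u = 0) -> x = 0;
  vnpi_bicommutant :
    commutant (commutant (range vnpi)) `<=` range vnpi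
}.

Definition factor N : Prop :=
  forall x, N x -> (forall y, N y -> x * y = y * x) ->
  exists c : R[i], x = c%:A.

Definition projection (p : M) : Prop := star p = p /\ p * p = p.

Definition equiv_proj (p q : M) : Prop :=
  exists v, star v * v = p /\ v * star v = q.

Definition finite_proj (p : M) : Prop :=
  projection p /\
  forall q, projection q -> q * p = q -> equiv_proj p q -> q = p.

Definition type_III_factor : Prop :=
  factor setT /\ forall p, finite_proj p -> p = 0.

Record subfactor (W : von_neumann) (N : set M) : Prop := Subfactor {
  subfactor1 : N 1;
  subfactor_lin : forall (c : R[i]) x y, N x -> N y -> N (c *: x + y);
  subfactorM : forall x y, N x -> N y -> N (x * y);
  subfactorS : forall x, N x -> N (star x);
  subfactor_bicommutant :
    commutant (commutant (@vnpi W @` N)) `<=` @vnpi W @` N;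
  subfactor_factor : factor N
}.

Definition selfadjoint (a : M) : Prop := star a = a.

Definition positive_elt (a : M) : Prop := exists b, a = star b * b.

Definition is_sup D (a : M) : Prop :=
  [/\ selfadjoint a, forall b, D b -> positive_elt (a - b) &
      forall c, selfadjoint c -> (forall b, D b -> positive_elt (c - b)) ->
        positive_elt (c - a)].

Definition increasing_net D : Prop :=
  [/\ D !=set0, forall b, D b -> selfadjoint b &
      forall b c, D b -> D c ->
        exists e, [/\ D e, positive_elt (e - b) & positive_elt (e - c)]].

Definition normal_map (f : M -> M) : Prop :=
  forall D a, increasing_net D -> is_sup D a -> is_sup (f @` D) (f a).

Definition endomorphism (f : M -> M) : Prop := star_hom f /\ normal_map f.

(* A pair of isometries r in (id, ib i) and rb in (id, i ib) satisfying the
   conjugate equations with constant 1/c, where i is the inclusion of N in M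
   and ib, written as a map from M to M, is its conjugate. *)
Record conjugate_eqns N (ib : M -> M) (r rb : M) (c : R) : Prop :=
 ConjugateEqns {
  conj_endo : endomorphism ib;
  conj_range : forall x, N (ib x);
  conj_r : [/\ N r, isometry r & forall x, N x -> r * x = ib x * r];
  conj_rb : isometry rb /\ intertwiner id ib rb;
  conj_pos : 0 < c;
  conj_eq1 : star rb * r = (c^-1)%:C%:A;
  conj_eq2 : star r * ib rb = (c^-1)%:C%:A
}.

Definition conjugate_inclusion N (ib : M -> M) : Prop :=
  exists r rb c, conjugate_eqns N ib r rb c.

(* The minimal index, that is, the square of the statistical dimension of the
   inclusion. *)
Definition has_index N (v : R) : Prop :=
  (exists ib r rb c, conjugate_eqns N ib r rb c /\ c ^+ 2 = v) /\
  (forall ib r rb c, conjugate_eqns N ib r rb c -> v <= c ^+ 2).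

(* f is the direct sum of f0 and f1; as sectors are only defined up to inner
   automorphisms, so is this sum. *)
Definition direct_sum_endo (f f0 f1 : M -> M) : Prop :=
  exists v0 v1, [/\ isometry v0, isometry v1,
    v0 * star v0 + v1 * star v1 = 1 &
    forall x, f x = v0 * f0 x * star v0 + v1 * f1 x * star v1].

End VonNeumann.

Definition type_III_realization (R : realType) (G : finZmodType)
    (M : starAlgType R) (al : G -> M -> M) (rho : M -> M) (S : M) (T : G -> M)
    (s : datum R G) : Prop :=
  [/\ type_III_factor M, endomorphism rho & realizes al rho S T s].

(* chi identifies G with its dual group: since #|G| is also the order of the
   dual group, the injective homomorphism k |-> chi k is an isomorphism. *)
Definition dual_pairing (R : realType) (G : finZmodType)
    (chi : G -> G -> R[i]) : Prop :=
  [/\ forall k, chi k 0 = 1,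
      forall k g h, chi k (g + h) = chi k g * chi k h,
      forall k l g, chi (k + l) g = chi k g * chi l g &
      forall k, (forall g, chi k g = 1) -> k = 0].

(* The choices of chi, S' and T' are unique up to an automorphism of G, phases
   and signs, so s' is determined by al and rho up to equivalence. *)
Definition accompanying (R : realType) (G : finZmodType) (s s' : datum R G) :
    Prop :=
  forall (M : starAlgType R) (W : von_neumann M) (al : action G M)
    (rho : M -> M) (S : M) (T : G -> M),
  type_III_realization al rho S T s ->
  exists (chi : G -> G -> R[i]) (S' : crossed al) (T' : G -> crossed al),
    dual_pairing chi /\
    realizes (fun k => @crossed_dual R G M al (chi k))
      (@crossed_extend R G M al rho) S' T' s'.

Section Z4.
Variable R : realType.
Local Notation d := (gdim R 'Z_4).

Definition z4 (b : bool) : R[i] :=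
  (- ((d - 1) / 2)) +i* ((-1) ^+ b * Num.sqrt ((d - 1) / 2)).

Definition eps4 (h g : 'Z_4) : R[i] :=
  if (h, g) \in [:: (1, 3); (3, 1); (2, 1); (2, 3)] then -1 else 1.

Definition table4 (z : R[i]) : seq (seq (seq R[i])) :=
  let a := (d - 2)%:C in
  let w := z^* in
  [:: [:: [:: a; -1; -1; -1];
          [:: -1; -1; z; -z];
          [:: -1; w; -1; z];
          [:: -1; -w; w; -1]];
      [:: [:: a; -1; -1; -1];
          [:: -1; -1; z; z];
          [:: -1; w; 1; -z];
          [:: -1; w; -w; 1]];
      [:: [:: a; -1; -1; -1];
          [:: -1; -1; -z; z];
          [:: -1; -w; -1; -z];
          [:: -1; w; -w; -1]];
      [:: [:: a; -1; -1; -1];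
          [:: -1; 1; -z; z];
          [:: -1; -w; 1; z];
          [:: -1; w; w; -1]]].

Definition coef4 (b : bool) (g h k : 'Z_4) : R[i] :=
  ((d - 1)^-1)%:C * nth 0 (nth [::] (nth [::] (table4 (z4 b)) g) h) k.

Definition datum4 (b : bool) : datum R 'Z_4 :=
  Datum eps4 (fun=> 1) (coef4 b).

Definition special4 (s : datum R 'Z_4) : Prop :=
  forall h, coef s 0 h 0 = kron R h 0 - ((d - 1)^-1)%:C.

End Z4.

(* Main.v *)
(** By (P2), (P6) and (P7) the rows [eta_g A_g(., 0)] are real, and the remaining
    entries of [A] are governed by one complex number [Y = A_0(1, 2)] and the signs
    [epsilon_1(1)], [epsilon_2(1)].  Instances of (P4) then give a small real
    quadratic system over Q(phi), phi the golden ratio, with two solutions up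
    to gauge and [g |-> - g].  Conversely all entries lie in
    Z[1/2][phi, sqrt(phi - 1), i], where the equations are checked by
    evaluation.

    In the crossed product the elements [T_g lambda_g] are isometries, and the
    accompanying [T'_k] are unitary combinations of them; the relations for
    [T'_k] become finitely many identities between the mixing coefficients
    and the two solutions, again checked by evaluation after adjoining
    sqrt 2.

    The condition [A_0(h, 0) = delta - 1 / (d - 1)] says exactly that [S] and
    [T_0] make id + rho a Q-system.  Its multiplication gives, after
    normalization, an isometry [r] intertwining [ib] and [ib \o ib], where
    [ib] is the direct sum of id and rho, and the subfactor is the set of all [x]
    such that [x] and its adjoint satisfy [r x = ib(x) r].  That this algebra is weakly closed
    rests on the strong continuity of normal endomorphisms on the unit ball,
    and the minimality of its index on its relative commutant being trivial. *)

From Stdlib Require Import BinInt.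
Require Import Defs.
From mathcomp Require Import all_boot all_order all_algebra.
From mathcomp Require Import all_classical all_reals topology normedtype.
From mathcomp Require Import complex.
From mathcomp Require Import ssrZ ring lra.
Import Order.TTheory GRing.Theory Num.Theory.
Local Open Scope classical_set_scope.
Local Open Scope complex_scope.
Local Open Scope ring_scope.
Set Implicit Arguments.
Unset Strict Implicit.
Unset Printing Implicit Defensive.

(** * Hilbert spaces *)

(** The definitions express positivity as [star b * b], normality as preservation of suprema and
    closedness by bicommutants. The analytic half therefore rests on two ways to produce operators,
    monotone limits and orthogonal projections; both return to [M] because they commute with its
    commutant. Square roots, inverses and support projections all arise like this, and once positive
    elements are squares, star homomorphisms visibly preserve the order. The delicate point is that
    weak approximants of an element need not be bounded, whereas a normal endomorphism is controlled
    only on bounded sets. Comparing [(h + i)^-1] instead of [h] removes the obstacle. For the index,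
    every conjugate of the inclusion yields a conditional expectation onto [N]. Since [M = N v0],
    the trivial relative commutant leaves just one such expectation, and its value at [v0 * star v0]
    bounds the constant of every conjugate. In the classification, the final dichotomy is the
    equation [(q - p) * y = 0], where [p], [q] are [A_0(1, 0)], [A_0(3, 0)] and [y] is the imaginary
    part of [A_0(1, 2)]. Each factor gives one class. *)

Section RealAux.
Variable R : realType.
Implicit Types (a b c : R) (z : R[i]).

Lemma conjcE z : z^* = conjc z. Proof. by []. Qed.

Lemma conjC_real a : (a%:C : R[i])^* = a%:C.
Proof. by rewrite conjcE conjc_real. Qed.

Lemma ReD z1 z2 : complex.Re (z1 + z2) = complex.Re z1 + complex.Re z2.
Proof. by case: z1 z2 => [? ?] [? ?]. Qed.

Lemma ReN z : complex.Re (- z) = - complex.Re z.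
Proof. by case: z. Qed.

Lemma ReMr a z : complex.Re (a%:C * z) = a * complex.Re z.
Proof. by case: z => ? ? /=; rewrite mul0r subr0. Qed.

Lemma Re_conj z : complex.Re z^* = complex.Re z.
Proof. by case: z. Qed.

Lemma ge0_ReE z : 0 <= z -> z = (complex.Re z)%:C.
Proof. by case: z => x y; rewrite lecE /= => /andP[/eqP -> _]. Qed.

Lemma eq0_Re z : complex.Re z = 0 -> complex.Re ('i * z) = 0 -> z = 0.
Proof.
case: z => x y /= ->; rewrite !mul0r !mul1r sub0r => /eqP.
by rewrite oppr_eq0 => /eqP ->.
Qed.

(** The vertex [t = - b / c] decides when [c] is nonzero; for [c = 0] an affine function bounded
    below must be constant. It serves for Cauchy-Schwarz, for the form of a positive operator, and
    for nearly minimal distances. *)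
Lemma discriminant_le a b c : 0 <= a -> 0 <= c ->
  (forall t, 0 <= a + 2 * b * t + c * t ^+ 2) -> b ^+ 2 <= a * c.
Proof.
move=> a0 c0 h; have [c_0|c_n0] := eqVneq c 0.
  have [->|b_n0] := eqVneq b 0; first by rewrite expr0n /= mulr_ge0.
  have := h (- (a + 1) / (2 * b)); rewrite c_0 mul0r addr0.
  have -> : 2 * b * (- (a + 1) / (2 * b)) = - (a + 1).
    by field; rewrite b_n0.
  by move=> ?; exfalso; lra.
have cp : 0 < c by rewrite lt_def c_n0.
have := h (- b / c).
have -> : a + 2 * b * (- b / c) + c * (- b / c) ^+ 2 = (a * c - b ^+ 2) / c.
  by field.
by rewrite pmulr_lge0 ?invr_gt0 // subr_ge0.
Qed.

Lemma lt_eps_le a b : (forall e : R, 0 < e -> a < b + e) -> a <= b.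
Proof. by move=> h; apply/ler_addgt0Pl => e /h /ltW; rewrite addrC. Qed.

Lemma natSinv_lt (e : R) : 0 < e -> exists N : nat, forall n, (N <= n)%N ->
  (n.+1%:R)^-1 < e.
Proof.
move=> e0; have e1 : 0 <= e^-1 by rewrite invr_ge0 ltW.
exists (Num.bound e^-1) => n hn.
rewrite -[e]invrK ltf_pV2 ?posrE ?ltr0n ?invr_gt0 //.
by apply: lt_trans (archi_boundP e1) _; rewrite ltr_nat ltnS.
Qed.

End RealAux.

Section Hilbert.
Variables (R : realType) (V : lmodType R[i]) (ip : V -> V -> R[i]).
Implicit Types (u v w x y : V) (a b t : R) (S : set V).

Definition nsq u : R := complex.Re (ip u u).
Definition rip u v : R := complex.Re (ip u v).

(** Completeness is phrased with the real squared norm, so that the same lemmas apply to the Hilbert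
    space of the representation and to its finite powers without equipping the latter with a
    topology. *)
Record hilbert : Prop := IsHilbert {
  hilbert_lin : forall (c : R[i]) u v w,
    ip (c *: u + v) w = c * ip u w + ip v w;
  hilbert_conj : forall u v, ip v u = (ip u v)^*;
  hilbert_ge0 : forall u, 0 <= ip u u;
  hilbert_eq0 : forall u, nsq u = 0 -> u = 0;
  hilbert_complete : forall x : nat -> V,
    (forall e : R, 0 < e -> exists N, forall m n, (N <= m)%N -> (N <= n)%N ->
      nsq (x m - x n) < e) ->
    exists l, forall e : R, 0 < e -> exists N, forall n, (N <= n)%N ->
      nsq (x n - l) < e
}.

Hypothesis hV : hilbert.

Lemma ip0l v : ip 0 v = 0.
Proof.
have := hilbert_lin hV 1 0 0 v; rewrite scaler0 addr0 mul1r => /eqP.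
by rewrite eq_sym -subr_eq0 addrK => /eqP.
Qed.

Lemma ipDl u v w : ip (u + v) w = ip u w + ip v w.
Proof. by have := hilbert_lin hV 1 u v w; rewrite scale1r mul1r. Qed.

Lemma ipZl c u v : ip (c *: u) v = c * ip u v.
Proof. by have := hilbert_lin hV c u 0 v; rewrite !addr0 ip0l addr0. Qed.

Lemma ipNl u v : ip (- u) v = - ip u v.
Proof. by rewrite -scaleN1r ipZl mulN1r. Qed.

Lemma ip0r u : ip u 0 = 0.
Proof. by rewrite (hilbert_conj hV) ip0l rmorph0. Qed.

Lemma ipDr u v w : ip u (v + w) = ip u v + ip u w.
Proof. by rewrite (hilbert_conj hV) ipDl rmorphD /= -!(hilbert_conj hV). Qed.

Lemma ipZr c u v : ip u (c *: v) = c^* * ip u v.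
Proof. by rewrite (hilbert_conj hV) ipZl rmorphM /= -(hilbert_conj hV). Qed.

Lemma ipNr u v : ip u (- v) = - ip u v.
Proof. by rewrite (hilbert_conj hV) ipNl rmorphN /= -(hilbert_conj hV). Qed.

Lemma ip_nsq u : ip u u = (nsq u)%:C.
Proof. exact: ge0_ReE (hilbert_ge0 hV u). Qed.

Lemma nsq_ge0 u : 0 <= nsq u.
Proof. by have := hilbert_ge0 hV u; rewrite lecE => /andP[]. Qed.

Lemma nsq0 : nsq 0 = 0. Proof. by rewrite /nsq ip0l. Qed.

Lemma ripC u v : rip u v = rip v u.
Proof. by rewrite /rip (hilbert_conj hV) Re_conj. Qed.

Lemma ripDl u v w : rip (u + v) w = rip u w + rip v w.
Proof. by rewrite /rip ipDl ReD. Qed.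

Lemma ripNl u w : rip (- u) w = - rip u w.
Proof. by rewrite /rip ipNl ReN. Qed.

Lemma ripBl u v w : rip (u - v) w = rip u w - rip v w.
Proof. by rewrite ripDl ripNl. Qed.

Lemma ripZl a u w : rip (a%:C *: u) w = a * rip u w.
Proof. by rewrite /rip ipZl ReMr. Qed.

Lemma nsqN u : nsq (- u) = nsq u.
Proof. by rewrite /nsq ipNl ipNr opprK. Qed.

Lemma nsqBC u v : nsq (u - v) = nsq (v - u).
Proof. by rewrite -nsqN opprB. Qed.

Lemma nsqZ a u : nsq (a%:C *: u) = a ^+ 2 * nsq u.
Proof. by rewrite /nsq ipZl ipZr conjC_real !ReMr mulrA. Qed.

Lemma nsqD u v : nsq (u + v) = nsq u + 2 * rip u v + nsq v.
Proof.
have := ripC u v; rewrite /nsq /rip ipDl !ipDr !ReD => h; lra.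
Qed.

Lemma nsqB u v : nsq (u - v) = nsq u - 2 * rip u v + nsq v.
Proof.
rewrite nsqD nsqN ripC ripNl ripC; lra.
Qed.

Lemma cauchy_schwarz u v : rip u v ^+ 2 <= nsq u * nsq v.
Proof.
apply: discriminant_le; rewrite ?nsq_ge0 // => t.
have := nsq_ge0 (u + t%:C *: v); rewrite nsqD nsqZ ripC ripZl ripC; lra.
Qed.

Lemma nsqD_le u v : nsq (u + v) <= 2 * (nsq u + nsq v).
Proof. have := nsq_ge0 (u - v); rewrite nsqB => ?; rewrite nsqD; lra. Qed.

(** Only real scalars are required, because the vectors [n u] with [n] self-adjoint do not in
    general form a complex subspace. *)
Definition real_subspace S :=
  [/\ S 0, forall u v, S u -> S v -> S (u + v) &
      forall a u, S u -> S (a%:C *: u)].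

Definition adherent S w := forall e : R, 0 < e -> exists2 v, S v & nsq (w - v) < e.

(** A minimizing sequence is Cauchy by the parallelogram law. As [S] need not be closed, the
    minimizer is only adherent to it. *)
Lemma best_approximation S w : real_subspace S ->
  exists w0, adherent S w0 /\ forall v, S v -> rip v (w - w0) = 0.
Proof.
move=> [S0 SD SZ].
pose D := [set t | exists2 v, S v & t = nsq (w - v)].
have D0 : D !=set0 by exists (nsq (w - 0)), 0.
have Dlb : lbound D 0 by move=> _ [v _ ->]; exact: nsq_ge0.
have Dinf : has_inf D by split=> //; exists 0.
set dl := inf D.
have dl_le v : S v -> dl <= nsq (w - v).
  by move=> Sv; apply: ge_inf => //; [exists 0|exists v].
have /choice[x hx] (n : nat) : exists v, S v /\ nsq (w - v) < dl + n.+1%:R^-1.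
  have n0 : 0 < (n.+1%:R)^-1 :> R by rewrite invr_gt0 ltr0n.
  have [_ [v Sv ->] hv] := inf_adherent n0 Dinf.
  by exists v.
have xS n : S (x n) := (hx n).1.
have xd n : nsq (w - x n) < dl + n.+1%:R^-1 := (hx n).2.
have SN v : S v -> S (- v).
  by move=> /(SZ (-1)); rewrite rmorphN1 scaleN1r.
have xC (e : R) : 0 < e -> exists N, forall m n, (N <= m)%N -> (N <= n)%N ->
    nsq (x m - x n) < e.
  move=> e0; have e4 : 0 < e / 4 by rewrite divr_gt0 // ltr0n.
  have [N hN] := natSinv_lt e4; exists N => m n Nm Nn.
  (* The midpoint of [x m] and [x n] stays in [S], hence at squared distance at least [dl] from
     [w]. *)
  have := dl_le _ (SZ (2^-1) _ (SD _ _ (xS m) (xS n))).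
  have := hN _ Nm; have := hN _ Nn; have := xd m; have := xd n.
  have -> : x m - x n = (w - x n) - (w - x m) by rewrite opprB [RHS]addrC addrA subrK.
  have -> : w - (2^-1)%:C *: (x m + x n) =
            (2^-1)%:C *: ((w - x n) + (w - x m)).
    rewrite addrACA -opprD scalerBr [x n + _]addrC; congr (_ - _).
    rewrite -[w in w + w]scale1r -scalerDl scalerA.
    rewrite -(rmorph1 (real_complex R)) -rmorphD -rmorphM /=.
    have -> : 2^-1 * (1 + 1) = 1 :> R by lra.
    by rewrite rmorph1 scale1r.
  rewrite nsqZ (nsqB (w - x n)) (nsqD (w - x n)).
  move: (n.+1%:R^-1) (m.+1%:R^-1) => i j; lra.
have [w0 hw0] := hilbert_complete hV xC.
exists w0; split.
  move=> e e0; have [N hN] := hw0 _ e0; exists (x N) => //.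
  by rewrite nsqBC hN.
move=> v Sv; apply/eqP; rewrite -sqrf_eq0 eq_le sqr_ge0 andbT.
apply: lt_eps_le => e e0; rewrite add0r.
pose K := 4 * (nsq v + 1); have K0 : 0 < K by have := nsq_ge0 v; rewrite /K; lra.
have eK : 0 < e / K by rewrite divr_gt0.
have [N1 h1] := natSinv_lt eK; have [N2 h2] := hw0 _ eK.
pose n := maxn N1 N2.
have := h1 n (leq_maxl _ _); have := h2 n (leq_maxr _ _) => {h1 h2} h2 h1.
(* Near-minimality of [x n] gives [0 <= 1 / (n + 1) + 2 t rip (w - x n) v + t^2 nsq v] for all real
   [t]; the discriminant makes the inner product small already before the limit. *)
have hq : rip (w - x n) v ^+ 2 <= n.+1%:R^-1 * nsq v.
  apply: discriminant_le; rewrite ?nsq_ge0 ?invr_ge0 ?ler0n // => t.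
  have := dl_le _ (SD _ _ (xS n) (SN _ (SZ t _ Sv))).
  rewrite opprD opprK addrA nsqD nsqZ ripC ripZl ripC.
  by move: (xd n); move: (n.+1%:R^-1) => i; lra.
have := cauchy_schwarz (x n - w0) v.
have -> : rip v (w - w0) = rip (w - x n) v + rip (x n - w0) v.
  by rewrite ripC -ripDl addrA subrK.
have := nsq_ge0 v.
move: hq h1 h2; rewrite !ltr_pdivlMr // /K.
set p := rip (w - x n) v; set q := rip (x n - w0) v; set i := _^-1.
have : 0 <= i by rewrite invr_ge0 ler0n.
have := nsq_ge0 (x n - w0); have := sqr_ge0 (p - q); nra.
Qed.

Lemma best_approximation_complex S w :
  real_subspace S -> (forall c u, S u -> S (c *: u)) ->
  exists w0, adherent S w0 /\ forall v, S v -> ip v (w - w0) = 0.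
Proof.
move=> rS SZ; have [w0 [aw0 ow0]] := best_approximation w rS.
exists w0; split=> // v Sv; apply: eq0_Re; first exact: ow0.
by rewrite -ipZl; apply: ow0; exact: SZ.
Qed.

Lemma adherent_orth S w u : (forall v, S v -> ip v u = 0) -> adherent S w ->
  ip w u = 0.
Proof.
move=> Su aw.
have Sr z : (forall v, S v -> rip v z = 0) -> rip w z = 0.
  move=> Sz; apply/eqP; rewrite -sqrf_eq0 eq_le sqr_ge0 andbT.
  apply: lt_eps_le => e e0; rewrite add0r.
  have K0 : 0 < nsq z + 1 by have := nsq_ge0 z; lra.
  have [v Sv hv] := aw _ (divr_gt0 e0 K0).
  have := cauchy_schwarz (w - v) z; rewrite ripBl (Sz _ Sv) subr0.
  move: hv; rewrite ltr_pdivlMr //; have := nsq_ge0 (w - v).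
  have := nsq_ge0 z; nra.
apply: eq0_Re; first by apply: Sr => v Sv; rewrite /rip Su.
rewrite -ipZl.
have -> : complex.Re (ip ('i *: w) u) = rip w (- 'i *: u).
  rewrite /rip ipZl ipZr; congr (complex.Re (_ * _)).
  by rewrite rmorphN /= conjCi opprK.
by apply: Sr => v Sv; rewrite /rip ipZr Su // mulr0.
Qed.

End Hilbert.

(** * Order and strong limits in a von Neumann algebra *)

Section StarLemmas.
Variables (R : realType) (M : starAlgType R).
Implicit Types x y : M.

Lemma star0 : star (0 : M) = 0.
Proof. by apply: (addrI (star (0 : M))); rewrite -starD !addr0. Qed.

Lemma starN x : star (- x) = - star x.
Proof. by rewrite -scaleN1r starZ rmorphN1 scaleN1r. Qed.

Lemma starB x y : star (x - y) = star x - star y.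
Proof. by rewrite starD starN. Qed.

Lemma star1 : star (1 : M) = 1.
Proof. by rewrite -[LHS]mulr1 -{2}(starK 1) -starM mulr1 starK. Qed.

Lemma star_alg (c : R[i]) : star (c%:A : M) = c^*%:A.
Proof. by rewrite starZ star1. Qed.

Lemma starZr (a : R) x : star (a%:C *: x) = a%:C *: star x.
Proof. by rewrite starZ conjC_real. Qed.

End StarLemmas.

Section VN.
Variables (R : realType) (M : starAlgType R) (W : von_neumann M).
Local Notation H := (vnH W).
Local Notation ip := (@vnip _ _ W).
Local Notation pi := (@vnpi _ _ W).
Local Notation sqn := nsq.
Local Notation reip := rip.
Local Notation nsq := (nsq ip).
Local Notation rip := (rip ip).
Implicit Types (u v w : H) (x y a b c : M) (e K C : R).

Lemma nsq_norm u : (nsq u)%:C = `|u| ^+ 2.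
Proof.
rewrite -vnip_norm /nsq; symmetry; apply: ge0_ReE.
by rewrite vnip_norm exprn_ge0.
Qed.

Lemma normH_lt u e : 0 < e -> (`|u| < e%:C) = (nsq u < e ^+ 2).
Proof.
move=> e0; rewrite -ltcR nsq_norm rmorphXn /= ltr_pXn2r ?nnegrE ?normr_ge0 //.
by rewrite lecR ltW.
Qed.

Lemma hilbert_vn : hilbert ip.
Proof.
split.
- by move=> k u v w; exact: vnip_lin.
- by move=> u v; exact: vnip_conj.
- by move=> u; rewrite vnip_norm exprn_ge0.
- move=> u u0; have := nsq_norm u; rewrite u0 => /esym/eqP.
  by rewrite sqrf_eq0 normr_eq0 => /eqP.
- move=> x hx.
  have xC : cauchy (x @ \oo).
    apply/cauchy_ballP => k k0; have kR : k = (complex.Re k)%:C by apply: ge0_ReE; exact: ltW.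
    have k0R : 0 < complex.Re k by rewrite -ltcR -kR.
    have [N hN] := hx _ (exprn_gt0 2 k0R).
    exists (x @` [set n | (N <= n)%N] , x @` [set n | (N <= n)%N]) => /=.
      by split; exists N => // n /= Nn; exists n.
    move=> _ /= [[m Nm <-] [n Nn <-]]; rewrite -ball_normE /= kR normH_lt //.
    exact: hN.
  have xc : cvg (x @ \oo) by apply: cauchy_cvg.
  have hl : x @ \oo --> lim (x @ \oo) by [].
  move/cvgrPdist_lt in hl.
  exists (lim (x @ \oo)) => e e0.
  have se0 : 0 < Num.sqrt e by rewrite sqrtr_gt0.
  have se0c : 0 < (Num.sqrt e)%:C by rewrite ltcR.
  have [N _ hN] := hl _ se0c; exists N => n Nn.
  have := hN n Nn; rewrite /= distrC normH_lt // sqr_sqrtr ?ltW //.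
Qed.

Let hH := hilbert_vn.

Lemma pi_lin x k u v : pi x (k *: u + v) = k *: pi x u + pi x v.
Proof. by case: (vnpi_bounded W x) => + _; apply. Qed.

Lemma piDr x u v : pi x (u + v) = pi x u + pi x v.
Proof. by have := pi_lin x 1 u v; rewrite !scale1r. Qed.

Lemma pi0r x : pi x 0 = 0.
Proof. by have := pi_lin x (-1) 0 0; rewrite scaler0 addr0 scaleN1r addNr. Qed.

Lemma piZr x k u : pi x (k *: u) = k *: pi x u.
Proof. by have := pi_lin x k u 0; rewrite pi0r !addr0. Qed.

Lemma piNr x u : pi x (- u) = - pi x u.
Proof. by rewrite -scaleN1r piZr scaleN1r. Qed.

Lemma piBr x u v : pi x (u - v) = pi x u - pi x v.
Proof. by rewrite piDr piNr. Qed.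

Lemma piD x y u : pi (x + y) u = pi x u + pi y u.
Proof. by have := vnpi_lin 1 x y u; rewrite !scale1r. Qed.

Lemma pi0 u : pi 0 u = 0.
Proof. by have := vnpi_lin (-1) 0 0 u; rewrite scaler0 addr0 scaleN1r addNr. Qed.

Lemma piZ k x u : pi (k *: x) u = k *: pi x u.
Proof. by have := vnpi_lin k x 0 u; rewrite pi0 !addr0. Qed.

Lemma piN x u : pi (- x) u = - pi x u.
Proof. by rewrite -scaleN1r piZ scaleN1r. Qed.

Lemma piB x y u : pi (x - y) u = pi x u - pi y u.
Proof. by rewrite piD piN. Qed.

Lemma pi1 u : pi 1 u = u. Proof. exact: vnpi_one. Qed.

Lemma piM x y u : pi (x * y) u = pi x (pi y u). Proof. exact: vnpi_mul. Qed.

Lemma pi_sum (I : Type) (r : seq I) (P : pred I) (F : I -> M) u :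
  pi (\sum_(i <- r | P i) F i) u = \sum_(i <- r | P i) pi (F i) u.
Proof. exact: (big_morph (pi ^~ u) (fun x y => piD x y u) (pi0 u)). Qed.

Lemma ip_adj x u v : ip (pi x u) v = ip u (pi (star x) v).
Proof. exact: vnpi_star. Qed.

Lemma rip_adj x u v : rip (pi x u) v = rip u (pi (star x) v).
Proof. by rewrite /rip ip_adj. Qed.

Lemma pi_inj x y : (forall u, pi x u = pi y u) -> x = y.
Proof.
move=> h; apply/eqP; rewrite -subr_eq0; apply/eqP/(vnpi_inj (v0 := W)) => u.
by rewrite piB h subrr.
Qed.

Lemma rip_inj u v : (forall w, rip u w = rip v w) -> u = v.
Proof.
move=> h; apply/eqP; rewrite -subr_eq0; apply/eqP/(hilbert_eq0 hH).
by rewrite /nsq -/(rip _ _) (ripBl hH) h subrr.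
Qed.

Lemma nsq_small u : (forall e, 0 < e -> nsq u < e) -> u = 0.
Proof.
move=> h; apply: (hilbert_eq0 hH); apply/eqP; rewrite eq_le (nsq_ge0 hH) andbT.
by apply: lt_eps_le => e e0; rewrite add0r h.
Qed.

(** Continuity at 0 gives a ball of radius [r] mapped into the unit ball; rescaling [u] to norm
    [r / 2] yields the constant [4 / r^2]. *)
Lemma bounded_op_nsq (t : H -> H) :
  bounded_op t -> exists2 K, 0 < K & forall u, nsq (t u) <= K * nsq u.
Proof.
move=> [tl tc].
have t0 : t 0 = 0 by have := tl (-1) 0 0; rewrite scaler0 addr0 scaleN1r addNr.
have tZ k u : t (k *: u) = k *: t u by have := tl k u 0; rewrite t0 !addr0.
have /cvgrPdist_lt/(_ _ ltr01) := tc 0.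
rewrite t0 => /nbhs_ballP[k /= k0 hk].
have kR : k = (complex.Re k)%:C by apply: ge0_ReE; exact: ltW.
set r := complex.Re k in kR; have r0 : 0 < r by rewrite -ltcR -kR.
have hr u : nsq u < r ^+ 2 -> nsq (t u) < 1.
  move=> ur; have := hk u; rewrite -ball_normE /= kR !sub0r !normrN => h.
  by rewrite -[1](expr1n _ 2) -normH_lt //; apply: h; rewrite normH_lt.
exists (4 / r ^+ 2) => [|u]; first by rewrite divr_gt0 ?exprn_gt0.
have [u0|u_n0] := eqVneq u 0.
  by rewrite u0 t0 (nsq0 hH) mulr0.
have nu0 : 0 < nsq u.
  rewrite lt_def (nsq_ge0 hH) andbT; apply: contraNneq u_n0 => h.
  by apply/eqP/(hilbert_eq0 hH).
pose s := r / (2 * Num.sqrt (nsq u)).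
have sq0 : 0 < Num.sqrt (nsq u) by rewrite sqrtr_gt0.
have s2 : s ^+ 2 = r ^+ 2 / (4 * nsq u).
  by rewrite /s expr_div_n exprMn sqr_sqrtr ?ltW //; congr (_ / (_ * _)); ring.
have rp : 0 < r ^+ 2 by rewrite exprn_gt0.
have := hr (s%:C *: u); rewrite tZ !(nsqZ hH) s2.
have -> : r ^+ 2 / (4 * nsq u) * nsq u = r ^+ 2 / 4.
  by field; rewrite gt_eqF.
have -> : r ^+ 2 / (4 * nsq u) * nsq (t u) = nsq (t u) * (r ^+ 2 / (4 * nsq u)).
  by rewrite mulrC.
have h4 : r ^+ 2 / 4 < r ^+ 2 by lra.
move=> /(_ h4) /ltW; rewrite -ler_pdivlMr ?divr_gt0 ?mulr_gt0 // => h.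
apply: le_trans h _; rewrite le_eqVlt; apply/orP; left; apply/eqP.
by field; rewrite !gt_eqF.
Qed.

Lemma nsq_bounded_op (t : H -> H) K : linear t ->
  (forall u, nsq (t u) <= K * nsq u) -> bounded_op t.
Proof.
move=> tl hK; split=> // u.
pose L := Num.max K 1; have L0 : 0 < L by rewrite lt_max ltr01 orbT.
have hL v : nsq (t v) <= L * nsq v.
  by apply: le_trans (hK v) _; rewrite ler_wpM2r ?(nsq_ge0 hH) // le_max lexx.
apply/cvgrPdist_lt => k k0.
have kR : k = (complex.Re k)%:C by apply: ge0_ReE; exact: ltW.
set r := complex.Re k in kR; have r0 : 0 < r by rewrite -ltcR -kR.
have sL : 0 < Num.sqrt L by rewrite sqrtr_gt0.
have rL : 0 < r / Num.sqrt L by rewrite divr_gt0.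
apply/nbhs_ballP; exists (r / Num.sqrt L)%:C => /=; first by rewrite ltcR.
move=> v; rewrite -ball_normE /= normH_lt // kR normH_lt // => h.
have -> : t u - t v = t (u - v).
  have := tl (-1) v u; rewrite !scaleN1r [- v + u]addrC => ->; exact: addrC.
apply: le_lt_trans (hL _) _; move: h.
rewrite expr_div_n sqr_sqrtr ?ltW // ltr_pdivlMr // mulrC //.
Qed.

Lemma pi_bounded x : exists2 K, 0 < K & forall u, nsq (pi x u) <= K * nsq u.
Proof. exact: bounded_op_nsq (vnpi_bounded W x). Qed.

(** Limits and projections are constructed on the Hilbert space and return to [M] through this form
    of the bicommutant property. *)
Lemma pi_lift (t : H -> H) K : linear t ->
  (forall u, nsq (t u) <= K * nsq u) ->
  (forall s, commutant (range pi) s -> forall u, s (t u) = t (s u)) ->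
  exists x, forall u, pi x u = t u.
Proof.
move=> tl hK tc; have : commutant (commutant (range pi)) t.
  by split; [exact: nsq_bounded_op hK|move=> s hs u; rewrite tc].
by move=> /(vnpi_bicommutant (v0 := W))[x _ <-]; exists x.
Qed.

(* The quadratic form of x; the order it defines on the self-adjoint elements
   is compared with the algebraic one in [qpos_positive_elt]. *)
Definition qform x u : R := rip (pi x u) u.

Definition qpos x : Prop := star x = x /\ forall u, 0 <= qform x u.

Definition lev x y : Prop := qpos (y - x).

Lemma qformD x y u : qform (x + y) u = qform x u + qform y u.
Proof. by rewrite /qform piD (ripDl hH). Qed.

Lemma qformN x u : qform (- x) u = - qform x u.
Proof. by rewrite /qform piN (ripNl hH). Qed.

Lemma qformB x y u : qform (x - y) u = qform x u - qform y u.
Proof. by rewrite qformD qformN. Qed.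

Lemma qformZ (k : R) x u : qform (k%:C *: x) u = k * qform x u.
Proof. by rewrite /qform piZ (ripZl hH). Qed.

Lemma qform1 u : qform 1 u = nsq u.
Proof. by rewrite /qform pi1. Qed.

Lemma qform_conj x y u : qform (star y * x * y) u = qform x (pi y u).
Proof. by rewrite /qform !piM rip_adj starK. Qed.

Lemma qform_sq x u : qform (star x * x) u = nsq (pi x u).
Proof. by rewrite /qform !piM rip_adj starK. Qed.

Lemma qpos_sq x : qpos (star x * x).
Proof. by split=> [|u]; rewrite ?starM ?starK // qform_sq (nsq_ge0 hH). Qed.

Lemma qpos_conj x y : qpos x -> qpos (star y * x * y).
Proof.
move=> [xs xp]; split=> [|u]; first by rewrite !starM starK xs mulrA.
by rewrite qform_conj.
Qed.

Lemma qpos0 : qpos 0.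
Proof. by split=> [|u]; rewrite ?star0 // /qform pi0 /rip (ip0l hH). Qed.

Lemma qpos1 : qpos 1.
Proof. by split=> [|u]; rewrite ?star1 // qform1 (nsq_ge0 hH). Qed.

Lemma qposD x y : qpos x -> qpos y -> qpos (x + y).
Proof.
move=> [xs xp] [ys yp]; split=> [|u]; first by rewrite starD xs ys.
by rewrite qformD addr_ge0.
Qed.

Lemma qposZ (k : R) x : 0 <= k -> qpos x -> qpos (k%:C *: x).
Proof.
move=> k0 [xs xp]; split=> [|u]; first by rewrite starZr xs.
by rewrite qformZ mulr_ge0.
Qed.

Lemma qpos_sum (I : Type) (r : seq I) (P : pred I) (F : I -> M) :
  (forall i, P i -> qpos (F i)) -> qpos (\sum_(i <- r | P i) F i).
Proof. by move=> h; apply: (big_ind qpos) => //; [exact: qpos0|exact: qposD]. Qed.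

Lemma lev_refl x : lev x x.
Proof. by rewrite /lev subrr; exact: qpos0. Qed.

Lemma lev_trans y x z : lev x y -> lev y z -> lev x z.
Proof. by move=> h1 h2; rewrite /lev -(subrKA y) addrC; exact: qposD. Qed.

Lemma levP x y : star x = x -> star y = y ->
  (forall u, qform x u <= qform y u) -> lev x y.
Proof.
by move=> xs ys h; split=> [|u]; rewrite ?starB ?xs ?ys // qformB subr_ge0.
Qed.

Lemma lev_qform x y u : lev x y -> qform x u <= qform y u.
Proof. by move=> [_ /(_ u)]; rewrite qformB subr_ge0. Qed.

Lemma positive_elt_qpos x : positive_elt x -> qpos x.
Proof. by move=> [y ->]; exact: qpos_sq. Qed.

(** This is [x^2 <= K x]: Cauchy-Schwarz for the positive form of [x], applied to [u] and [x u]. It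
    upgrades convergence of quadratic forms to strong convergence. *)
Lemma qpos_bound x K : qpos x -> 0 <= K -> (forall u, qform x u <= K * nsq u) ->
  forall u, nsq (pi x u) <= K * qform x u.
Proof.
move=> [xs xp] K0 xK u.
have h v : rip (pi x u) v ^+ 2 <= qform x u * qform x v.
  apply: discriminant_le => // t.
  have := xp (u + t%:C *: v); rewrite /qform piDr piZr (ripDl hH).
  rewrite (ripZl hH) !(ripC hH _ (u + _)) !(ripDl hH) !(ripZl hH).
  rewrite (ripC hH u (pi x u)) (ripC hH v (pi x v)).
  by rewrite (ripC hH u (pi x v)) (rip_adj _ v u) xs (ripC hH v (pi x u)); lra.
have := h (pi x u); rewrite {1}/rip -/(nsq _) => h1.
have h2 := xK (pi x u); have n0 := nsq_ge0 hH (pi x u).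
have q0 := xp u.
have [n_0|n_n0] := eqVneq (nsq (pi x u)) 0; first by rewrite n_0 mulr_ge0.
have np : 0 < nsq (pi x u) by rewrite lt_def n_n0.
have : nsq (pi x u) ^+ 2 <= qform x u * (K * nsq (pi x u)).
  by apply: le_trans h1 _; rewrite ler_wpM2l.
by rewrite expr2 mulrA ler_pM2r // [_ * K]mulrC.
Qed.

Lemma qpos_sqr_le x K : qpos x -> 0 <= K -> (forall u, qform x u <= K * nsq u) ->
  forall u, nsq (pi x u) <= K ^+ 2 * nsq u.
Proof.
move=> xp K0 xK u; apply: le_trans (qpos_bound xp K0 xK u) _.
by rewrite expr2 -mulrA ler_wpM2l.
Qed.

Lemma qform_bounded x : exists2 K, 0 < K & forall u, `|qform x u| <= K * nsq u.
Proof.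
have [K K0 hK] := pi_bounded x; exists (K + 1) => [|u]; first by lra.
have n0 := nsq_ge0 hH u.
have : `|qform x u| ^+ 2 <= ((K + 1) * nsq u) ^+ 2.
  rewrite real_normK ?num_real //; apply: le_trans (cauchy_schwarz hH _ _) _.
  have h1 : nsq (pi x u) <= (K + 1) * nsq u by have := hK u; nra.
  have h2 : nsq u <= (K + 1) * nsq u by nra.
  rewrite expr2; apply: ler_pM => //; exact: nsq_ge0.
by rewrite ler_pXn2r // nnegrE ?mulr_ge0 //; lra.
Qed.

(** * Vigier's theorem: bounded increasing nets converge strongly *)

Definition bounded_directed (D : set M) : Prop :=
  [/\ D !=set0, forall b, D b -> star b = b,
      forall b c, D b -> D c -> exists d, [/\ D d, lev b d & lev c d] &
      exists C, forall b u, D b -> qform b u <= C * nsq u].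

Definition strong_limit (D : set M) (u l : H) : Prop :=
  forall e, 0 < e -> exists2 b, D b &
    forall c, D c -> lev b c -> nsq (pi c u - l) < e.

Section Vigier.
Variables (D : set M) (hD : bounded_directed D).

Lemma strong_limit_near u l u' l' e : strong_limit D u l ->
  strong_limit D u' l' -> 0 < e ->
  exists2 b, D b & forall c, D c -> lev b c ->
    nsq (pi c u - l) < e /\ nsq (pi c u' - l') < e.
Proof.
move=> h h' e0; have [b Db hb] := h _ e0; have [b' Db' hb'] := h' _ e0.
have [_ _ dD _] := hD; have [d [Dd bd b'd]] := dD _ _ Db Db'.
exists d => // c Dc dc; split; [apply: hb => //|apply: hb' => //].
- exact: lev_trans bd dc.
- exact: lev_trans b'd dc.
Qed.

Lemma strong_limit_unique u l l' :
  strong_limit D u l -> strong_limit D u l' -> l = l'.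
Proof.
move=> h h'; apply/eqP; rewrite -subr_eq0; apply/eqP/nsq_small => e e0.
have e4 : 0 < e / 4 by lra.
have [b Db hb] := strong_limit_near h h' e4.
have [h1 h2] := hb _ Db (lev_refl b).
have := nsqD_le hH (l - pi b u) (pi b u - l'); rewrite addrA subrK.
by rewrite (nsqBC hH l (pi b u)); lra.
Qed.

(** The numbers [qform b u] increase to a supremum. By [x^2 <= K x] for the differences, vectors
    [b u] whose forms are near the supremum are near each other. *)
Lemma strong_limit_ex u : exists l, strong_limit D u l.
Proof.
have [[b0 Db0] sD dD [C hC]] := hD.
have [C0 C00 hC0] := qform_bounded b0.
pose K := `|C| + C0; have K0 : 0 <= K by rewrite /K; have := normr_ge0 C; lra.
have hK b v : D b -> qform (b - b0) v <= K * nsq v.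
  move=> Db; rewrite qformB /K mulrDl.
  have := hC b v Db; have := hC0 v; rewrite ler_norml => /andP[? _].
  have : C * nsq v <= `|C| * nsq v by rewrite ler_wpM2r ?(nsq_ge0 hH) ?ler_norm.
  lra.
(* Above [b0] every difference [c - b] lies below [c - b0], so one constant [K] serves all of
   them. *)
have hKb b c v : D b -> D c -> lev b0 b -> lev b c ->
    nsq (pi (c - b) v) <= K * qform (c - b) v.
  move=> Db Dc b0b bc; apply: qpos_bound => // w.
  by have := hK c w Dc; rewrite !qformB; have := lev_qform w b0b; lra.
pose E := [set t | exists2 b, D b /\ lev b0 b & t = qform b u].
have E0 : E !=set0 by exists (qform b0 u), b0 => //; split=> //; exact: lev_refl.
have Eub : ubound E (C * nsq u) by move=> _ [b [Db _] ->]; exact: hC.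
have Esup : has_sup E by split=> //; exists (C * nsq u).
have hsup b : D b -> lev b0 b -> qform b u <= sup E.
  by move=> Db b0b; apply: ub_le_sup => //; [exists (C * nsq u)|exists b].
have /choice[x hx] (n : nat) :
    exists b, [/\ D b, lev b0 b & sup E < qform b u + n.+1%:R^-1].
  have n0 : 0 < (n.+1%:R)^-1 :> R by rewrite invr_gt0 ltr0n.
  have [_ [b [Db b0b] ->] hb] := sup_adherent n0 Esup.
  by exists b; split=> //; rewrite -ltrBlDr.
have xc n c : D c -> lev (x n) c ->
    nsq (pi c u - pi (x n) u) <= K * n.+1%:R^-1.
  move=> Dc xnc; have [Dx b0x hxn] := hx n.
  rewrite -piB; apply: le_trans (hKb _ _ _ Dx Dc b0x xnc) _.
  rewrite ler_wpM2l // qformB.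
  have := hsup c Dc (lev_trans b0x xnc); move: hxn; move: (n.+1%:R^-1) => i ? ?; lra.
have KS e : 0 < e -> exists N : nat, forall n, (N <= n)%N -> K * n.+1%:R^-1 < e.
  move=> e0; have K1 : 0 < K + 1 by lra.
  have [N hN] := natSinv_lt (divr_gt0 e0 K1); exists N => n /hN.
  have : 0 < n.+1%:R^-1 :> R by rewrite invr_gt0 ltr0n.
  rewrite ltr_pdivlMr //; move: (n.+1%:R^-1) => i; lra.
have xC e : 0 < e -> exists N, forall m n, (N <= m)%N -> (N <= n)%N ->
    nsq (pi (x m) u - pi (x n) u) < e.
  move=> e0; have e4 : 0 < e / 4 by lra.
  have [N hN] := KS _ e4; exists N => m n Nm Nn.
  have [Dm _ _] := hx m; have [Dn _ _] := hx n.
  have [d [Dd md nd]] := dD _ _ Dm Dn.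
  have := nsqD_le hH (pi (x m) u - pi d u) (pi d u - pi (x n) u).
  rewrite addrA subrK (nsqBC hH (pi (x m) u) (pi d u)).
  have := xc _ _ Dd md; have := xc _ _ Dd nd; have := hN _ Nm; have := hN _ Nn.
  by move: (K * _) (K * _) => i j; lra.
have [l hl] := hilbert_complete hH xC.
exists l => e e0; have e4 : 0 < e / 4 by lra.
have [N1 h1] := KS _ e4; have [N2 h2] := hl _ e4.
pose n := maxn N1 N2; have [Dn _ _] := hx n.
exists (x n) => // c Dc nc.
have := nsqD_le hH (pi c u - pi (x n) u) (pi (x n) u - l).
rewrite addrA subrK; have := xc _ _ Dc nc.
have := h1 n (leq_maxl _ _); have := h2 n (leq_maxr _ _).
by move: (K * _) => i; lra.
Qed.

(** The pointwise limits form a bounded linear operator; linearity, self-adjointness and commutation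
    with the commutant all survive strong limits, so the operator comes from a self-adjoint element
    of [M]. *)
Lemma vigier : exists x, star x = x /\ forall u, strong_limit D u (pi x u).
Proof.
have [[b0 Db0] sD dD [C hC]] := hD.
have /choice[t ht] := strong_limit_ex.
have tl : linear t.
  move=> k u v; apply: strong_limit_unique (ht _) _ => e e0.
  pose k2 := complex.Re (k * k^*); have k20 : 0 <= k2.
    by have : 0 <= k * k^* := mulcJ_ge0 k; rewrite lecE => /andP[].
  have kk w : nsq (k *: w) = k2 * nsq w.
    by rewrite /nsq (ipZl hH) (ipZr hH) mulrA {1}(ip_nsq hH) mulrC ReMr mulrC.
  have kp : 0 < 4 * (k2 + 1) by lra.
  have [b Db hb] := strong_limit_near (ht u) (ht v) (divr_gt0 e0 kp).
  exists b => // c Dc bc; have [h1 h2] := hb _ Dc bc.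
  rewrite pi_lin opprD addrACA -scalerBr.
  have := nsqD_le hH (k *: (pi c u - t u)) (pi c v - t v); rewrite kk.
  move: h1 h2; rewrite !ltr_pdivlMr // => h1 h2.
  have := nsq_ge0 hH (pi c u - t u); have := nsq_ge0 hH (pi c v - t v).
  by nra.
have [C0 C00 hC0] := qform_bounded b0.
have [B B0 hB] := pi_bounded b0.
pose K := `|C| + C0; have K0 : 0 <= K by rewrite /K; have := normr_ge0 C; lra.
have hK b v : D b -> qform (b - b0) v <= K * nsq v.
  move=> Db; rewrite qformB /K mulrDl.
  have := hC b v Db; have := hC0 v; rewrite ler_norml => /andP[? _].
  have : C * nsq v <= `|C| * nsq v by rewrite ler_wpM2r ?(nsq_ge0 hH) ?ler_norm.
  lra.
have tb u : nsq (t u) <= 4 * (K ^+ 2 + B) * nsq u.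
  apply: lt_eps_le => e e0; have e4 : 0 < e / 4 by lra.
  have [b Db hb] := ht u _ e4; have [d [Dd bd b0d]] := dD _ _ Db Db0.
  have := hb _ Dd bd.
  have := nsqD_le hH (t u - pi d u) (pi d u); rewrite subrK (nsqBC hH (t u)).
  have := nsqD_le hH (pi (d - b0) u) (pi b0 u); rewrite piB subrK -piB.
  have := hB u; have := qpos_sqr_le b0d K0 (fun v => hK d v Dd) u.
  by lra.
have tc s : commutant (range pi) s -> forall u, s (t u) = t (s u).
  move=> [bs hs] u; have [B' B'0 hB'] := bounded_op_nsq bs.
  have sB v w : s (v - w) = s v - s w.
    by have := bs.1 (-1) w v; rewrite !scaleN1r ![- _ + _]addrC.
  apply/eqP; rewrite -subr_eq0; apply/eqP/nsq_small => e e0.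
  have k0 : 0 < 4 * (B' + 1) by lra.
  have [b Db hb] := strong_limit_near (ht u) (ht (s u)) (divr_gt0 e0 k0).
  have [] := hb _ Db (lev_refl b); rewrite !ltr_pdivlMr // => h1 h2.
  have := nsqD_le hH (s (t u - pi b u)) (pi b (s u) - t (s u)).
  rewrite -hs; last by exists b.
  rewrite sB addrA subrK -sB.
  have := hB' (t u - pi b u); rewrite (nsqBC hH (t u) (pi b u)).
  rewrite (hs (pi b)); last by exists b.
  have := nsq_ge0 hH (pi b u - t u); have := nsq_ge0 hH (pi b (s u) - t (s u)).
  by nra.
have [x hx] := pi_lift tl tb tc.
exists x; split; last by move=> u; rewrite hx; exact: ht.
apply: pi_inj => u; apply: rip_inj => v.
rewrite rip_adj starK !hx; apply/eqP; rewrite -subr_eq0 -sqrf_eq0.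
rewrite eq_le sqr_ge0 andbT; apply: lt_eps_le => e e0; rewrite add0r.
pose k := 4 * (nsq u + nsq v + 1).
have k0 : 0 < k by have := nsq_ge0 hH u; have := nsq_ge0 hH v; rewrite /k; lra.
have [b Db hb] := strong_limit_near (ht u) (ht v) (divr_gt0 e0 k0).
have [] := hb _ Db (lev_refl b); rewrite !ltr_pdivlMr // /k => h1 h2.
have := cauchy_schwarz hH (pi b u - t u) v; rewrite (ripBl hH).
have := cauchy_schwarz hH (pi b v - t v) u; rewrite (ripBl hH).
rewrite (rip_adj b u v) (sD _ Db) (ripC hH u (pi b v)) (ripC hH u (t v)).
have := nsq_ge0 hH (pi b u - t u); have := nsq_ge0 hH (pi b v - t v).
have := nsq_ge0 hH u; have := nsq_ge0 hH v.
move: (rip _ _) (rip _ _) (rip _ _) => p q r.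
move=> nv0 nu0 B0' A0' hq hp.
have : 0 <= nsq (pi b u - t u) * nsq u by rewrite mulr_ge0.
have : 0 <= nsq (pi b v - t v) * nsq v by rewrite mulr_ge0.
move: hq hp h1 h2 A0' B0'; move: (nsq (_ - _)) (nsq (_ - _)) => A B'.
have := sqr_ge0 (r - p + (r - q)); lra.
Qed.

End Vigier.

(** * Strong limits of sequences, square roots and resolvents *)

Definition cvg_op (b : nat -> M) x : Prop := forall u e, 0 < e ->
  exists N, forall n, (N <= n)%N -> nsq (pi (b n) u - pi x u) < e.

Lemma cvg_op_unique (b : nat -> M) x y : cvg_op b x -> cvg_op b y -> x = y.
Proof.
move=> hx hy; apply: pi_inj => u; apply/eqP; rewrite -subr_eq0.
apply/eqP/nsq_small => e e0; have e4 : 0 < e / 4 by lra.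
have [N1 h1] := hx u _ e4; have [N2 h2] := hy u _ e4.
have := h1 _ (leq_maxl N1 N2); have := h2 _ (leq_maxr N1 N2).
set n := maxn _ _; have := nsqD_le hH (pi x u - pi (b n) u) (pi (b n) u - pi y u).
by rewrite addrA subrK (nsqBC hH (pi x u) (pi (b n) u)); lra.
Qed.

Lemma cvg_op_shift (b : nat -> M) x : cvg_op b x -> cvg_op (fun n => b n.+1) x.
Proof.
by move=> h u e /(h u)[N hN]; exists N => n Nn; apply: hN; exact: leqW.
Qed.

Lemma cvg_op_cst x : cvg_op (fun=> x) x.
Proof. by move=> u e e0; exists 0%N => n _; rewrite subrr (nsq0 hH). Qed.

Lemma cvg_opD (b c : nat -> M) x y : cvg_op b x -> cvg_op c y ->
  cvg_op (fun n => b n + c n) (x + y).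
Proof.
move=> hx hy u e e0; have e4 : 0 < e / 4 by lra.
have [N1 h1] := hx u _ e4; have [N2 h2] := hy u _ e4.
exists (maxn N1 N2) => n; rewrite geq_max => /andP[/h1 g1 /h2 g2].
rewrite !piD opprD addrACA.
by have := nsqD_le hH (pi (b n) u - pi x u) (pi (c n) u - pi y u); lra.
Qed.

Lemma cvg_opM (b c : nat -> M) x y K : cvg_op b x -> cvg_op c y ->
  (forall n u, nsq (pi (b n) u) <= K * nsq u) ->
  cvg_op (fun n => b n * c n) (x * y).
Proof.
move=> hx hy hK u e e0; have e4 : 0 < e / 4 by lra.
pose L := Num.max K 1; have L0 : 0 < L by rewrite lt_max ltr01 orbT.
have KL : K <= L by rewrite le_max lexx.
have [N1 h1] := hx (pi y u) _ e4; have [N2 h2] := hy u _ (divr_gt0 e4 L0).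
exists (maxn N1 N2) => n; rewrite geq_max => /andP[/h1 g1 /h2].
rewrite ltr_pdivlMr // => g2; rewrite !piM.
have := nsqD_le hH (pi (b n) (pi (c n) u) - pi (b n) (pi y u))
  (pi (b n) (pi y u) - pi x (pi y u)).
rewrite addrA subrK -piBr; have := hK n (pi (c n) u - pi y u).
have := nsq_ge0 hH (pi (c n) u - pi y u); nra.
Qed.

Lemma cvg_opMl (b : nat -> M) x y : cvg_op b x -> cvg_op (fun n => y * b n) (y * x).
Proof.
by have [K _ hK] := pi_bounded y; move/(cvg_opM (cvg_op_cst y)); apply.
Qed.

Lemma cvg_opMr (b : nat -> M) x y : cvg_op b x -> cvg_op (fun n => b n * y) (x * y).
Proof.
move=> h u e e0; have [N hN] := h (pi y u) _ e0; exists N => n /hN.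
by rewrite !piM.
Qed.

Lemma qform_near x y u e : 0 < e ->
  nsq (pi x u - pi y u) < e ^+ 2 / (nsq u + 1) -> `|qform x u - qform y u| < e.
Proof.
have n0 := nsq_ge0 hH u; have n1 : 0 < nsq u + 1 by lra.
move=> e0; rewrite ltr_pdivlMr // => h.
have : `|qform x u - qform y u| ^+ 2 < e ^+ 2.
  rewrite real_normK ?num_real // /qform -(ripBl hH).
  apply: le_lt_trans (cauchy_schwarz hH _ _) (le_lt_trans _ h).
  by rewrite ler_wpM2l ?(nsq_ge0 hH) //; lra.
by rewrite ltr_pXn2r ?nnegrE ?normr_ge0 ?(ltW e0).
Qed.

Lemma cvg_qform (b : nat -> M) x u e : cvg_op b x -> 0 < e ->
  exists N, forall n, (N <= n)%N -> `|qform (b n) u - qform x u| < e.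
Proof.
move=> h e0; have n1 : 0 < nsq u + 1 by have := nsq_ge0 hH u; lra.
have [N hN] := h u _ (divr_gt0 (exprn_gt0 2 e0) n1).
by exists N => n /hN; exact: qform_near.
Qed.

Lemma cvg_qform_le (b : nat -> M) x u C : cvg_op b x ->
  (forall n, qform (b n) u <= C) -> qform x u <= C.
Proof.
move=> h hC; apply: lt_eps_le => e e0; have [N hN] := cvg_qform u h e0.
by have := hN N (leqnn _); have := hC N; rewrite ltr_norml => ? /andP[]; lra.
Qed.

Lemma cvg_qform_ge (b : nat -> M) x u C : cvg_op b x ->
  (forall n, C <= qform (b n) u) -> C <= qform x u.
Proof.
move=> h hC; apply: lt_eps_le => e e0; have [N hN] := cvg_qform u h e0.
by have := hN N (leqnn _); have := hC N; rewrite ltr_norml => ? /andP[]; lra.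
Qed.

Lemma lev_seq (b : nat -> M) : (forall n, lev (b n) (b n.+1)) ->
  forall m n, (m <= n)%N -> lev (b m) (b n).
Proof.
move=> h m n /subnK <-; elim: (n - m)%N => [|k IH]; first exact: lev_refl.
exact: lev_trans IH (h _).
Qed.

Lemma vigier_seq (b : nat -> M) C : (forall n, star (b n) = b n) ->
  (forall n, lev (b n) (b n.+1)) -> (forall n u, qform (b n) u <= C * nsq u) ->
  exists x, [/\ star x = x, cvg_op b x & forall n, lev (b n) x].
Proof.
move=> bs bi bC; have bm := lev_seq bi.
have hD : bounded_directed (range b).
  split; first by exists (b 0%N), 0%N.
  - by move=> _ [n _ <-].
  - move=> _ _ [m _ <-] [n _ <-]; exists (b (maxn m n)); split.
    + by exists (maxn m n).
    + exact: bm (leq_maxl _ _).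
    + exact: bm (leq_maxr _ _).
  - by exists C => _ u [n _ <-].
have [x [xs hx]] := vigier hD; exists x.
have cx : cvg_op b x.
  move=> u e /(hx u)[_ [N _ <-] hN]; exists N => n Nn.
  by apply: hN; [exists n|exact: bm].
split=> // n; apply: levP => // u.
apply: (cvg_qform_ge (b := fun k => b (k + n)%N)).
- move=> v e /(cx v)[N hN]; exists N => k Nk; apply: hN.
  exact: leq_trans Nk (leq_addr _ _).
- by move=> k; apply: lev_qform; apply: bm; exact: leq_addl.
Qed.

Lemma qposX x n : qpos x -> qpos (x ^+ n).
Proof.
move=> xp; have [xs _] := xp.
elim: n {-2}n (leqnn n) => [|m IH] [|[|n]] // hn; rewrite ?expr0 ?expr1 //;
  try exact: qpos1.
rewrite exprSr exprS -{1}xs; apply: qpos_conj; apply: IH.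
by rewrite -ltnS; apply: leq_trans hn.
Qed.

Lemma qpos_horner x (p : {poly R[i]}) : qpos x -> p \is a polyOver Num.nneg ->
  qpos (horner_alg x p).
Proof.
move=> xp /polyOverP pp; rewrite /horner_alg /horner_morph horner_coef.
apply: qpos_sum => i _; rewrite coef_map /=.
have -> : p`_i = (complex.Re p`_i)%:C by apply: ge0_ReE; have := pp i; rewrite nnegrE.
rewrite -scalerAl mul1r; apply: qposZ; last exact: qposX.
by have := pp i; rewrite nnegrE lecE => /andP[].
Qed.

(** For [a = 1 - x / K], the iteration [y_(n+1) = (a + y_n^2) / 2] starting at 0 increases to some
    [z] with [a = 2 z - z^2], whence [x = K (1 - z)^2]. Thus positivity of the quadratic form and
    algebraic positivity agree. *)
Lemma qpos_positive_elt x : qpos x -> positive_elt x.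
Proof.
move=> xp; have [xs _] := xp; have [K K0 hK] := qform_bounded x.
pose a := 1 - (K^-1)%:C *: x.
have as_ : star a = a by rewrite starB star1 starZr xs.
have aq u : qform a u = nsq u - K^-1 * qform x u.
  by rewrite qformB qform1 qformZ.
have ap : qpos a.
  split=> // u; rewrite aq subr_ge0 ler_pdivrMl //.
  by apply: le_trans (hK u); exact: ler_norm.
have a1 u : qform a u <= 1 * nsq u.
  by rewrite aq mul1r gerBl mulr_ge0 ?invr_ge0 ?(ltW K0) //; case: xp.
(* The iterates are polynomials in [a]. Both they and their successive differences have nonnegative
   coefficients, so monotonicity reduces to positivity of the powers of [a]. *)
pose q := fix q n : {poly R[i]} :=
  if n is n.+1 then (2^-1 : R)%:C *: ('X + q n * q n) else 0.
have qn n : q n.+1 = (2^-1 : R)%:C *: ('X + q n * q n) by [].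
have h0 : (2^-1 : R)%:C \is Num.nneg by rewrite nnegrE lecR invr_ge0 ler0n.
have q0 n : q n \is a polyOver Num.nneg.
  elim: n => [|n IH]; first exact: polyOver0.
  rewrite qn polyOverZ // rpredD ?polyOverX ?rpredM //.
have qi n : q n.+1 - q n \is a polyOver Num.nneg.
  elim: n => [|n IH]; first by rewrite subr0.
  have -> : q n.+2 - q n.+1 =
      (2^-1 : R)%:C *: ((q n.+1 - q n) * (q n.+1 + q n)).
    rewrite (qn n.+1) (qn n) -scalerBr -qn; congr (_ *: _); ring.
  by rewrite polyOverZ // rpredM // rpredD.
pose y n := horner_alg a (q n).
have yn n : y n.+1 = (2^-1 : R)%:C *: (a + y n * y n).
  by rewrite /y qn linearZ /= rmorphD rmorphM /= horner_algX -scalerAl mul1r.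
have yp n : qpos (y n) by exact: qpos_horner.
have ys n : star (y n) = y n by case: (yp n).
have yi n : lev (y n) (y n.+1).
  by rewrite /lev /y -rmorphB; apply: qpos_horner.
have y1 n u : qform (y n) u <= 1 * nsq u.
  elim: n u => [|n IH] u; first by rewrite /y rmorph0 /qform pi0 /rip (ip0l hH) mul1r (nsq_ge0 hH).
  rewrite yn qformZ qformD -{1}(ys n) qform_sq.
  have := qpos_sqr_le (yp n) ler01 IH u; have := a1 u; rewrite expr1n; lra.
have [z [zs zc _]] := vigier_seq ys yi y1.
have zE : z = (2^-1 : R)%:C *: (a + z * z).
  apply: cvg_op_unique (cvg_op_shift zc) _.
  have c : cvg_op (fun n => a + y n * y n) (a + z * z).
    apply: cvg_opD; first exact: cvg_op_cst.
    by apply: (cvg_opM (K := 1 ^+ 2) zc zc) => n u; exact: qpos_sqr_le (yp n) ler01 (y1 n) u.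
  move=> u e e0; have [N hN] := cvg_opMl ((2^-1 : R)%:C)%:A c u e0.
  exists N => n /hN; rewrite yn -!scalerAl !mul1r //.
have zz : a = 2 *: z - z * z.
  rewrite {1}zE scalerA; have -> : 2 * (2^-1 : R)%:C = 1 :> R[i].
    by rewrite -[2]/((1 + 1)%:R) -(rmorph_nat (real_complex R)) -rmorphM /= mulfV // pnatr_eq0.
  by rewrite scale1r addrK.
exists ((Num.sqrt K)%:C *: (1 - z)).
rewrite starZr starB star1 zs -scalerAl -scalerAr scalerA -rmorphM /=.
rewrite -expr2 sqr_sqrtr ?ltW // mulrBr mulr1 mulrBl mul1r opprB addrA.
have -> : 1 - z + z * z - z = 1 - a.
  by rewrite zz scaler_nat mulr2n opprB opprD !addrA [1 - z + _]addrAC.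
rewrite /a opprB addrC subrK scalerA -rmorphM /= mulfV ?gt_eqF //.
by rewrite rmorph1 scale1r.
Qed.

Lemma lev_positive_elt x y : lev x y <-> positive_elt (y - x).
Proof. by split; [exact: qpos_positive_elt|exact: positive_elt_qpos]. Qed.

(** The net has a strong limit [y] by Vigier. It is an upper bound, so [x <= y], and elements of [D]
    close to [y] at [u] are at least as close to [x]. *)
Lemma sup_strong (D : set M) x u e : increasing_net D -> is_sup D x -> 0 < e ->
  exists2 b, D b & qform x u - qform b u < e.
Proof.
move=> [D0 sD dD] [xs xD xl] e0; have [K K0 hK] := qform_bounded x.
have hD : bounded_directed D.
  split=> //.
  - move=> b c Db Dc; have [d [Dd bd cd]] := dD _ _ Db Dc.
    by exists d; split=> //; exact/lev_positive_elt.
  - exists K => b v Db; apply: le_trans (lev_qform v _) _.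
      by apply/lev_positive_elt; exact: xD.
    exact: le_trans (ler_norm _) (hK v).
have [y [ys hy]] := vigier hD.
have n1 v : 0 < nsq v + 1 by have := nsq_ge0 hH v; lra.
have Dy b : D b -> lev b y.
  move=> Db; apply: levP => // [|v]; first exact: sD.
  apply: lt_eps_le => r r0.
  have [c Dc hc] := hy v _ (divr_gt0 (exprn_gt0 2 r0) (n1 v)).
  have [d [Dd bd cd]] := dD _ _ Db Dc.
  have := qform_near r0 (hc _ Dd (proj2 (lev_positive_elt _ _) cd)).
  have := lev_qform v (proj2 (lev_positive_elt _ _) bd).
  by rewrite ltr_norml => ? /andP[]; lra.
have xy : lev x y.
  by apply/lev_positive_elt/xl => // b Db; exact/lev_positive_elt/Dy.
have [b Db hb] := hy u _ (divr_gt0 (exprn_gt0 2 e0) (n1 u)).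
exists b => //; have := qform_near e0 (hb _ Db (lev_refl _)).
by have := lev_qform u xy; rewrite ltr_norml => ? /andP[]; lra.
Qed.

Lemma is_sup_strong (D : set M) x : star x = x -> (forall b, D b -> lev b x) ->
  (forall b, D b -> star b = b) ->
  (forall u e, 0 < e -> exists2 b, D b & qform x u - qform b u < e) ->
  is_sup D x.
Proof.
move=> xs xD sD h; split=> // [b Db|c cs hc]; first exact/lev_positive_elt/xD.
apply/lev_positive_elt; apply: levP => // u; apply: lt_eps_le => e e0.
have [b Db] := h u _ e0.
by have := lev_qform u (proj2 (lev_positive_elt _ _) (hc _ Db)); lra.
Qed.

(** Neumann series: [a = 1 - dl (1 + x)] satisfies [0 <= a <= 1 - dl], and the partial sums of its
    powers increase to the inverse of [dl (1 + x)]. *)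
Lemma resolvent x : qpos x ->
  exists g, [/\ qpos g, g * (1 + x) = 1 & (1 + x) * g = 1].
Proof.
move=> xp; have [xs xq] := xp; have [K K0 hK] := qform_bounded x.
pose dl := (K + 1)^-1; have dl0 : 0 < dl by rewrite invr_gt0; lra.
have dl1 : dl < 1 by rewrite invf_lt1; lra.
have dlK : dl * (K + 1) = 1 by rewrite mulVf // gt_eqF //; lra.
have [a aE] : exists a, a = 1 - dl%:C *: (1 + x) by eexists.
have as_ : star a = a by rewrite aE starB starZr starD star1 xs.
have aq u : qform a u = nsq u - dl * (nsq u + qform x u).
  by rewrite aE qformB qformZ qformD qform1.
have a1 u : qform a u <= (1 - dl) * nsq u by rewrite aq; have := xq u; nra.
have ap : qpos a.
  split=> // u; rewrite aq; have := hK u; rewrite ler_norml => /andP[_ h].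
  have := ler_wpM2l (ltW dl0) h; have := nsq_ge0 hH u; nra.
pose s := fix s n : M := if n is n.+1 then 1 + a * s n else 0.
have sa n : a * s n = s n * a.
  elim: n => [|n IH] /=; first by rewrite mulr0 mul0r.
  by rewrite mulrDr mulrDl mulr1 mul1r {1}IH mulrA.
have ss n : star (s n) = s n.
  elim: n => [|n IH] /=; first exact: star0.
  by rewrite starD star1 starM as_ IH sa.
have sd n : s n.+1 - s n = a ^+ n.
  elim: n => [|n IH]; first by rewrite /= mulr0 addr0 subr0.
  by rewrite exprS -IH mulrBr /= opprD addrACA subrr add0r.
have si n : lev (s n) (s n.+1) by rewrite /lev sd; exact: qposX.
have sb n : forall u, qform (s n) u <= dl^-1 * nsq u.
  have dv : dl * dl^-1 = 1 by rewrite mulfV // gt_eqF.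
  have dv0 : 0 < dl^-1 by rewrite invr_gt0.
  elim: n {-2}n (leqnn n) => [|m IH] [|[|n]] // hn u /=.
  - by rewrite /qform pi0 /rip (ip0l hH) mulr_ge0 ?(nsq_ge0 hH) // ltW.
  - by rewrite /qform pi0 /rip (ip0l hH) mulr_ge0 ?(nsq_ge0 hH) // ltW.
  - rewrite mulr0 addr0 qform1 ler_peMl ?(nsq_ge0 hH) //.
    by rewrite -invr1 lef_pV2 ?posrE ?ltW.
  (* Two terms are added at once so that [s n] stands between two factors [a]. The bound reproduces
     itself because [1 + (1 - dl) + (1 - dl)^2 / dl = 1 / dl]. *)
  - have -> : 1 + a * (1 + a * s n) = 1 + a + star a * s n * a.
      by rewrite mulrDr mulr1 addrA as_ {1}sa mulrA.
    rewrite 2!qformD qform1 qform_conj.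
    have hn' : (n <= m)%N by rewrite -ltnS; apply: leq_trans hn.
    have := IH n hn' (pi a u).
    have d1 : 0 <= 1 - dl by lra.
    have := qpos_sqr_le ap d1 a1 u; have := a1 u.
    have := nsq_ge0 hH u; have := nsq_ge0 hH (pi a u).
    move: (nsq u) (nsq _) (qform a u) (qform _ _) => n_u n_a q1 q2 p1 p2 p3 p4 p5.
    have := ler_wpM2l (ltW dv0) p4.
    have -> : dl^-1 * ((1 - dl) ^+ 2 * n_u) = dl^-1 * n_u - 2 * n_u + dl * n_u.
      have -> : (1 - dl) ^+ 2 = 1 - 2 * dl + dl * dl by ring.
      by rewrite mulrCA; move: dv; move: (dl^-1) => i; nra.
    lra.
have [z [zs zc zl]] := vigier_seq ss si sb.
have zE : z = 1 + a * z.
  apply: cvg_op_unique (cvg_op_shift zc) _ => /=.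
  by apply: cvg_opD (cvg_op_cst _) _; exact: cvg_opMl.
have z1 : dl%:C *: ((1 + x) * z) = 1.
  move/eqP: zE; rewrite -subr_eq -{1}[z]mul1r -mulrBl aE opprB addrC subrK.
  by rewrite -scalerAl => /eqP.
exists (dl%:C *: z); split.
- by apply: qposZ; rewrite ?ltW //; have := zl 0%N; rewrite /lev /= subr0.
- rewrite -[LHS]starK starM starZr starD star1 xs zs.
  by rewrite -scalerAr z1 star1.
- by rewrite -scalerAr.
Qed.

(** * Normal endomorphisms *)

Definition resolvent_of x g : Prop :=
  [/\ qpos g, g * (1 + x) = 1 & (1 + x) * g = 1].

(** With [v = g u] and [w = h u], expand [0 <= qform (1 + x) (w - v)] and bound [qform (1 + x) w] by
    [qform (1 + y) w]. Together with the next two lemmas this makes [1 - (1 + x)^-1] a bounded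
    monotone substitute for [x]: at most [x], and at least [x / 2] when [x <= 1]. *)
Lemma resolvent_antitone x y g h : qpos x -> lev x y ->
  resolvent_of x g -> resolvent_of y h -> lev h g.
Proof.
move=> [xs xq] [_ xy] [[gs _] gx xg] [[hs _] hy yh].
apply: levP => // u; pose v := pi g u; pose w := pi h u.
have uv : pi (1 + x) v = u by rewrite -piM xg pi1.
have uw : pi (1 + y) w = u by rewrite -piM yh pi1.
have s1 : star (1 + x) = 1 + x by rewrite starD star1 xs.
have xp : 0 <= qform (1 + x) (w - v).
  by rewrite qformD qform1 addr_ge0 ?(nsq_ge0 hH).
have -> : qform h u = qform (1 + y) w by rewrite {2}/qform uw (ripC hH).
have -> : qform g u = rip u v by rewrite (ripC hH).
have e1 : qform (1 + x) w <= qform (1 + y) w.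
  by have := xy w; rewrite qformB !qformD; lra.
have e2 : rip (pi (1 + x) w) v = qform (1 + y) w.
  by rewrite rip_adj s1 uv {1}/qform uw (ripC hH).
move: xp; rewrite {1}/qform piBr (ripBl hH) !(ripC hH _ (w - v)) !(ripBl hH).
rewrite !(ripC hH _ (pi (1 + x) _)) e2 uv.
have -> : rip (pi (1 + x) w) w = qform (1 + x) w by [].
have -> : rip u w = qform (1 + y) w by rewrite /qform uw.
lra.
Qed.

(** Substituting [u = (1 + x) w] turns the claim into an inequality between polynomials in [x],
    which follows from [x^3 <= x^2 <= x]. *)
Lemma resolvent_ge_half x g : qpos x -> lev x 1 -> resolvent_of x g ->
  lev ((2^-1 : R)%:C *: x) (1 - g).
Proof.
move=> xp x1 [[gs _] gx xg]; have [xs xq] := xp.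
apply: levP; rewrite ?starZr ?starB ?star1 ?xs ?gs // => u.
pose w := pi g u; have uw : u = pi (1 + x) w by rewrite -piM xg pi1.
have s1 : star (1 + x) = 1 + x by rewrite starD star1 xs.
have -> : qform (1 - g) u = qform x w + nsq (pi x w).
  rewrite {1}uw -qform_conj s1 -qform_sq -qformD xs; congr qform.
  by rewrite mulrBr mulr1 xg [1 + x]addrC addrK mulrDr mulr1 addrC.
have -> : qform ((2^-1 : R)%:C *: x) u =
    2^-1 * (qform x w + 2 * nsq (pi x w) + qform x (pi x w)).
  rewrite qformZ {1}uw -(qform_conj x (1 + x)) -(qform_conj x x) -qform_sq s1 xs.
  congr (_ * _).
  have -> : (1 + x) * x * (1 + x) = x + (x * x + x * x) + x * x * x.
    by rewrite mulrDl mul1r !mulrDr !mulr1 mulrDl !addrA.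
  by rewrite !qformD; lra.
have b1 : forall v, qform x v <= 1 * nsq v.
  by move=> v; have := lev_qform v x1; rewrite qform1 mul1r.
by have := qpos_bound xp ler01 b1 w; have := b1 (pi x w); lra.
Qed.

Lemma resolvent_le x g : qpos x -> resolvent_of x g -> lev (1 - g) x.
Proof.
move=> [xs xq] [[gs gq] gx xg].
have e : x - (1 - g) = star x * g * x.
  have e1 : x * g = 1 - g by rewrite -xg mulrDl mul1r addrAC subrr add0r.
  have e2 : g * x = 1 - g by rewrite -gx mulrDr mulr1 addrAC subrr add0r.
  by rewrite xs e1 mulrBl mul1r e2.
by rewrite /lev e; exact: qpos_conj.
Qed.

Section NormalEndo.
Variable (f : M -> M).
Hypotheses (fh : star_hom f) (fn : normal_map f).

Lemma homD x y : f (x + y) = f x + f y. Proof. by case: (shom_additive fh). Qed.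
Lemma homZ k x : f (k *: x) = k *: f x. Proof. by case: (shom_additive fh). Qed.
Lemma homN x : f (- x) = - f x.
Proof. by rewrite -scaleN1r homZ scaleN1r. Qed.
Lemma homB x y : f (x - y) = f x - f y.
Proof. by rewrite homD homN. Qed.

Lemma hom_qpos x : qpos x -> qpos (f x).
Proof.
by move=> /qpos_positive_elt[y ->]; rewrite (shomM fh) (shomS fh); exact: qpos_sq.
Qed.

Lemma hom_lev x y : lev x y -> lev (f x) (f y).
Proof. by move=> h; rewrite /lev -homB; exact: hom_qpos. Qed.

Lemma hom_sup_strong (D : set M) x u e : increasing_net D -> is_sup D x ->
  0 < e -> exists2 b, D b & qform (f x) u - qform (f b) u < e.
Proof.
move=> hD xD e0; have [D0 sD dD] := hD; have fD : increasing_net (f @` D).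
  split; first by case: D0 => b Db; exists (f b), b.
  - by move=> _ [b Db <-]; rewrite /selfadjoint -(shomS fh) sD.
  - move=> _ _ [b Db <-] [c Dc <-]; have [d [Dd bd cd]] := dD _ _ Db Dc.
    exists (f d); split; first by exists d.
    + by apply/lev_positive_elt/hom_lev/lev_positive_elt.
    + by apply/lev_positive_elt/hom_lev/lev_positive_elt.
by have [_ [b Db <-] hb] := sup_strong u fD (fn hD xD) e0; exists b.
Qed.

(** * The largest projection of [M] killing finitely many vectors *)

Section SupportProjection.
Variable (s : seq H).

Definition kills y : Prop := star y = y /\ forall w, w \in s -> pi y w = 0.

Definition killed u : Prop := forall y, kills y -> pi y u = 0.

Definition kill_range : set H :=
  [set v | exists2 r : seq (M * H), (forall p, p \in r -> kills p.1) &
    v = \sum_(p <- r) pi p.1 p.2].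

Lemma kill_range_subspace : real_subspace kill_range /\
  forall k u, kill_range u -> kill_range (k *: u).
Proof.
have Z k u : kill_range u -> kill_range (k *: u).
  move=> [r hr ->]; exists [seq (p.1, k *: p.2) | p <- r].
    by move=> _ /mapP[p pr ->] /=; exact: hr.
  by rewrite big_map scaler_sumr; apply: eq_bigr => p _; rewrite piZr.
split=> //; split=> [|u v [r hr ->] [r' hr' ->]|a u]; last exact: Z.
  by exists [::]; rewrite ?big_nil.
exists (r ++ r'); last by rewrite big_cat.
by move=> p; rewrite mem_cat => /orP[/hr|/hr'].
Qed.

Lemma kill_range_orth u v : kill_range u -> killed v -> ip u v = 0.
Proof.
move=> [r hr ->] kv.
have : forall p, p \in r -> ip (pi p.1 p.2) v = 0.
  by move=> p /hr pk; rewrite ip_adj pk.1 kv // (ip0r hH).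
elim: r {hr} => [|p r IH] h; first by rewrite big_nil (ip0l hH).
rewrite big_cons (ipDl hH) h ?mem_head // add0r; apply: IH => q qr.
by apply: h; rewrite in_cons qr orbT.
Qed.

Definition support_part w w0 : Prop :=
  adherent ip kill_range w0 /\ killed (w - w0).

Lemma killedD u v : killed u -> killed v -> killed (u + v).
Proof. by move=> hu hv y ky; rewrite piDr hu // hv // addr0. Qed.

Lemma killedZ k u : killed u -> killed (k *: u).
Proof. by move=> hu y ky; rewrite piZr hu // scaler0. Qed.

Lemma adherentD (S : set H) u v : real_subspace S ->
  adherent ip S u -> adherent ip S v -> adherent ip S (u + v).
Proof.
move=> [_ SD _] hu hv e e0; have e4 : 0 < e / 4 by lra.
have [u' Su hu'] := hu _ e4; have [v' Sv hv'] := hv _ e4.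
exists (u' + v'); first exact: SD.
rewrite opprD addrACA; have := nsqD_le hH (u - u') (v - v'); lra.
Qed.

Lemma adherent_op (t : H -> H) (S S' : set H) u K : (forall v w, t (v - w) = t v - t w) ->
  0 < K -> (forall v, nsq (t v) <= K * nsq v) -> (forall v, S v -> S' (t v)) ->
  adherent ip S u -> adherent ip S' (t u).
Proof.
move=> tB K0 hK tS hu e e0; have [v Sv hv] := hu _ (divr_gt0 e0 K0).
exists (t v); first exact: tS.
rewrite -tB; apply: le_lt_trans (hK _) _; by rewrite mulrC -ltr_pdivlMr.
Qed.

Lemma adherentZ (S : set H) k u : (forall k u, S u -> S (k *: u)) ->
  adherent ip S u -> adherent ip S (k *: u).
Proof.
move=> SZ; have k0 : 0 <= k * k^* := mulcJ_ge0 k.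
have k0' : 0 <= complex.Re (k * k^*) by move: k0; rewrite lecE => /andP[].
apply: (@adherent_op (fun v => k *: v) S S u (complex.Re (k * k^*) + 1)) => //.
- by move=> v w; rewrite scalerBr.
- by lra.
- move=> v; rewrite /nsq (ipZl hH) (ipZr hH) mulrA [k * k^*]ge0_ReE // ReMr.
  by rewrite ler_wpM2r ?(nsq_ge0 hH) //= ; lra.
- by move=> v; exact: SZ.
Qed.

Lemma support_part_unique w w0 w1 :
  support_part w w0 -> support_part w w1 -> w0 = w1.
Proof.
have [rS SZ] := kill_range_subspace.
move=> [a0 k0] [a1 k1]; apply/eqP; rewrite -subr_eq0.
apply/eqP/(hilbert_eq0 hH); rewrite /nsq.
suff -> : ip (w0 - w1) (w0 - w1) = 0 by [].
apply: (adherent_orth hH (S := kill_range)).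
  move=> v Sv; apply: kill_range_orth Sv _.
  have -> : w0 - w1 = (w - w1) + (-1) *: (w - w0).
    by rewrite scaleN1r opprB [RHS]addrC addrA subrK.
  by apply: killedD => //; exact: killedZ.
by apply: adherentD => //; rewrite -scaleN1r; exact: adherentZ.
Qed.

(** Operators of the commutant map [kill_range] into itself and preserve killed vectors, so they
    commute with the orthogonal projection onto the closure of [kill_range]; that projection
    therefore belongs to [M]. *)
Lemma support_projection : exists p, [/\ star p = p,
  forall w, support_part w (pi p w), forall w, qform p w = nsq (pi p w) &
  forall w, w \in s -> pi p w = 0].
Proof.
have [rS SZ] := kill_range_subspace.
have /choice[P hP] w : exists w0, support_part w w0.
  have [w0 [aw ow]] := best_approximation_complex hH w rS SZ.
  exists w0; split=> // y [ys ky]; apply: rip_inj => v.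
  rewrite [RHS](ripC hH) {2}/rip (ip0r hH) (rip_adj y) ys (ripC hH) /rip ow //.
  by exists [:: (y, v)]; [move=> p; rewrite inE => /eqP ->|rewrite big_seq1].
have Pl : linear P.
  move=> k u v; apply: support_part_unique (hP _) _; split.
    by apply: adherentD => //; [apply: adherentZ|]; case: (hP u); case: (hP v).
  rewrite opprD addrACA -scalerBr.
  by apply: killedD; [apply: killedZ|]; case: (hP u); case: (hP v).
have Po w v : ip (P w) (v - P v) = 0.
  have [aw _] := hP w; have [_ kv] := hP v.
  by apply: (adherent_orth hH _ aw) => z Sz; exact: kill_range_orth.
have Pn w : rip (P w) w = nsq (P w).
  by rewrite -{2}[w](subrK (P w)) /rip (ipDr hH) Po add0r.
have P1 w : nsq (P w) <= 1 * nsq w.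
  have := nsq_ge0 hH (w - P w); rewrite (nsqB hH) (ripC hH) Pn mul1r; lra.
have Pc t : commutant (range pi) t -> forall u, t (P u) = P (t u).
  move=> [bt ht] u; have [K K0 hK] := bounded_op_nsq bt.
  have t0 : t 0 = 0 by have := bt.1 (-1) 0 0; rewrite scaler0 addr0 scaleN1r addNr.
  have tD v w : t (v + w) = t v + t w by have := bt.1 1 v w; rewrite !scale1r.
  have tB v w : t (v - w) = t v - t w.
    by have := bt.1 (-1) w v; rewrite !scaleN1r ![- _ + _]addrC.
  apply: esym; apply: support_part_unique (hP _) _; have [au ku] := hP u; split.
    apply: (adherent_op tB K0 hK _ au) => v [r hr ->].
    exists [seq (p.1, t p.2) | p <- r].
      by move=> _ /mapP[p pr ->] /=; exact: hr.
    rewrite big_map (big_morph t tD t0); apply: eq_bigr => p _.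
    by rewrite ht //; exists p.1.
  move=> y ky; rewrite -tB -ht; last by exists y.
  by rewrite ku // t0.
have [p hp] := pi_lift Pl P1 Pc; exists p; split.
- apply: pi_inj => u; apply: rip_inj => v; rewrite rip_adj starK !hp.
  rewrite -{1}[u](subrK (P u)) (ripDl hH) (ripC hH) {1}/rip Po add0r.
  by rewrite -{2}[v](subrK (P v)) /rip (ipDr hH) Po add0r.
- by move=> w; rewrite hp.
- by move=> w; rewrite /qform hp.
- move=> w ws; rewrite hp; apply: support_part_unique (hP w) _; split.
    by move=> e e0; exists 0; rewrite ?subrr ?(nsq0 hH) //; case: rS.
  by rewrite subr0 => y [_ ky]; exact: ky.
Qed.

(** A killing [y] vanishes on the complement of the range of [p], so [y] equals [p y p], and
    [y <= 1] gives [p y p <= p]. *)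
Lemma kills_le_support p y : (forall w, support_part w (pi p w)) ->
  (forall w, qform p w = nsq (pi p w)) -> star p = p ->
  kills y -> lev y 1 -> lev y p.
Proof.
move=> hp pq ps ky y1; apply: levP => //; first by case: ky.
move=> w; have yw : pi y w = pi y (pi p w).
  by rewrite -{1}[w](subrK (pi p w)) piDr; have [_ ->] := hp w; rewrite ?add0r.
have -> : qform y w = qform y (pi p w).
  rewrite /qform yw [LHS]rip_adj [RHS]rip_adj; have [-> _] := ky.
  by rewrite yw.
by rewrite pq -qform1; exact: lev_qform.
Qed.

End SupportProjection.

Section StrongContinuity.
Variables (s : seq H) (z : H) (e : R).
Hypothesis e0 : 0 < e.
Hypothesis bad : forall d, 0 < d -> exists a, [/\ qpos a, lev a 1,
  \sum_(w <- s) qform a w < d & e <= qform (f a) z].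

Lemma sum_half_lt (n m : nat) :
  \sum_(k < m) (2^-1 : R) ^+ (n + k) < 2 * 2^-1 ^+ n.
Proof.
suff -> : \sum_(k < m) (2^-1 : R) ^+ (n + k) = 2 * 2^-1 ^+ n - 2 * 2^-1 ^+ (n + m).
  by rewrite ltrBlDr ltrDl mulr_gt0 // exprn_gt0 // invr_gt0.
elim: m => [|m IH]; first by rewrite big_ord0 addn0 subrr.
rewrite big_ord_recr /= IH addnS exprS.
by move: (_ ^+ (n + m)) (_ ^+ n) => A B; lra.
Qed.

Lemma half_small (d : R) : 0 < d -> exists n, 2 * (2^-1 : R) ^+ n < d.
Proof.
move=> d0; have [N hN] := natSinv_lt (divr_gt0 d0 (ltr0n R 2)).
exists N.+1; have := hN N.+1 (leqnSn N); rewrite ltr_pdivlMr // mulrC.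
apply: le_lt_trans; rewrite ler_wpM2l // exprVn lef_pV2 ?posrE ?exprn_gt0 //.
by rewrite -natrX ler_nat ltn_expl.
Qed.

(** Choose violators [a k] with sums below [2^-k] on [s]. Their tails, truncated by the resolvent,
    have limits [y n] that stay above [a n / 2] but are at most [2 * 2^-n] on [s]. The [y n]
    decrease, their limit kills [s], and normality keeps its image large at [z]. *)
Lemma bad_limit : exists y, [/\ qpos y, lev y 1, kills s y &
  e / 4 <= qform (f y) z].
Proof.
have /choice[a ha] (k : nat) : exists a, [/\ qpos a, lev a 1,
    \sum_(w <- s) qform a w < (2^-1) ^+ k & e <= qform (f a) z].
  by apply: bad; rewrite exprn_gt0 // invr_gt0.
have ap k : qpos (a k) by case: (ha k).
pose b n m := \sum_(k < m) a (n + k)%N.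
have bp n m : qpos (b n m) by apply: qpos_sum => k _.
have /choice[g0 hg0] x : exists g, qpos x -> resolvent_of x g.
  have [xp|nx] := pselect (qpos x); last by exists 0.
  by have [g hg] := resolvent xp; exists g.
have hg n m : resolvent_of (b n m) (g0 (b n m)) by exact: hg0.
(* The sums [b n m] need not be bounded in [m]; their truncations are still increasing in [m] and
   stay below 1, so [vigier_seq] applies. *)
pose Y n m := 1 - g0 (b n m).
have gs n m : star (g0 (b n m)) = g0 (b n m) by case: (hg n m) => -[].
have Ys n m : star (Y n m) = Y n m by rewrite starB star1 gs.
have Yanti n m n' m' : lev (b n m) (b n' m') -> lev (Y n m) (Y n' m').
  move=> h; rewrite /lev /Y opprB addrC addrA subrK.
  by apply: resolvent_antitone h _ _.
have bi n m : lev (b n m) (b n m.+1).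
  by rewrite /lev /b big_ord_recr /= [X in X - _]addrC addrK.
have Yi n m : lev (Y n m) (Y n m.+1) by exact: Yanti.
have Y1 n m u : qform (Y n m) u <= 1 * nsq u.
  by rewrite /Y qformB qform1 mul1r gerBl; case: (hg n m) => -[].
have /choice[y hy] n : exists y, [/\ star y = y, cvg_op (Y n) y & forall m, lev (Y n m) y].
  exact: vigier_seq (Ys n) (Yi n) (Y1 n).
have ys n : star (y n) = y n by case: (hy n).
have Y0 n m u : 0 <= qform (Y n m) u.
  have : lev (b n 0%N) (b n m).
    by apply: (lev_seq (b := b n)).
  move=> /Yanti /lev_qform h; apply: le_trans (h u).
  rewrite /Y; have := hg n 0%N; rewrite /b big_ord0 => -[_ + _].
  by rewrite addr0 mulr1 => ->; rewrite subrr /qform pi0 /rip (ip0l hH).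
have yp n : qpos (y n).
  split=> // u; have [_ c _] := hy n; exact: cvg_qform_ge c (fun m => Y0 n m u).
have y1 n u : qform (y n) u <= 1 * nsq u.
  by have [_ c _] := hy n; exact: cvg_qform_le c (fun m => Y1 n m u).
have ydec n : lev (y n.+1) (y n).
  apply: levP => // u; have [_ c _] := hy n.+1; apply: (cvg_qform_le c) => m.
  have [_ _ l] := hy n; apply: lev_qform; apply: lev_trans (l m.+1).
  apply: Yanti; rewrite /lev /b big_ord_recl addn0.
  rewrite [X in _ + X - _](eq_bigr (fun k : 'I_m => a (n.+1 + k)%N)) => [|k _].
    by rewrite addrK.
  by rewrite lift0 addnS addSn.
have ysmall n w : w \in s -> qform (y n) w <= 2 * 2^-1 ^+ n.
  move=> ws; have [_ c _] := hy n; apply: (cvg_qform_le c) => m.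
  apply: le_trans (lev_qform w (resolvent_le (bp n m) (hg n m))) _.
  apply: ltW; apply: le_lt_trans (sum_half_lt n m).
  rewrite /b /qform pi_sum.
  have -> : rip (\sum_(k < m) pi (a (n + k)%N) w) w = \sum_(k < m) qform (a (n + k)%N) w.
    exact: (big_morph (fun v => rip v w) (fun u v => ripDl hH u v w) (congr1 (@complex.Re R) (ip0l hH w))).
  apply: ler_sum => k _; have [_ _ h _] := ha (n + k)%N.
  apply: le_trans (ltW h); rewrite (big_rem w) //= lerDl sumr_ge0 // => v _.
  by case: (ap (n + k)%N).
have ylow n : e / 2 <= qform (f (y n)) z.
  have [_ _ l] := hy n; have := lev_qform z (hom_lev (l 1%N)).
  apply: le_trans; have [an a1 _ h] := ha n.
  have b1 : b n 1%N = a n by rewrite /b big_ord1 addn0.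
  have hg1 := hg n 1%N; rewrite /Y b1 in hg1 *.
  have := lev_qform z (hom_lev (resolvent_ge_half an a1 hg1)).
  rewrite homZ qformZ; apply: le_trans; lra.
(* The [y n] decrease, so the increasing sequence [- y n] is used; the element sought is [- x]. *)
have [x [xs xc xl]] : exists x, [/\ star x = x, cvg_op (fun n => - y n) x &
    forall n, lev (- y n) x].
  apply: (vigier_seq (C := 0)) => [n|n|n u]; first by rewrite starN ys.
  - by rewrite /lev opprK addrC; exact: ydec.
  - by rewrite mul0r qformN oppr_le0; case: (yp n).
exists (- x).
have xp : qpos (- x).
  split=> [|u]; first by rewrite starN xs.
  rewrite qformN oppr_ge0; apply: (cvg_qform_le xc) => n.
  by rewrite qformN oppr_le0; case: (yp n).
have xy n : lev (- x) (y n) by rewrite /lev opprK addrC -[y n]opprK; exact: xl.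
have x1 : lev (- x) 1.
  apply: levP; rewrite ?star1 ?starN ?xs // => u.
  by apply: le_trans (lev_qform u (xy 0%N)) _; rewrite qform1 -[nsq u]mul1r.
split=> //.
- split=> [|w ws]; first by case: xp.
  have q0 : qform (- x) w = 0.
    apply/eqP; rewrite eq_le; case: xp => _ /(_ w) ->; rewrite andbT.
    apply: lt_eps_le => d d0; rewrite add0r; have [n hn] := half_small d0.
    by apply: le_lt_trans hn; apply: le_trans (lev_qform w (xy n)) (ysmall n w ws).
  apply: (hilbert_eq0 hH); apply/eqP; rewrite eq_le (nsq_ge0 hH) andbT.
  have b1 v : qform (- x) v <= 1 * nsq v by have := lev_qform v x1; rewrite qform1 mul1r.
  by have := qpos_bound xp ler01 b1 w; rewrite q0 mulr0.
- pose D := range (fun n => - y n).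
  have yl : forall m n, (m <= n)%N -> lev (- y m) (- y n).
    by apply: lev_seq => n; rewrite /lev opprK addrC; exact: ydec.
  have hD : increasing_net D.
    split; first by exists (- y 0%N), 0%N.
    + by move=> _ [n _ <-]; rewrite /selfadjoint starN ys.
    + move=> _ _ [m _ <-] [n _ <-]; exists (- y (maxn m n)); split.
      * by exists (maxn m n).
      * by apply/lev_positive_elt/yl/leq_maxl.
      * by apply/lev_positive_elt/yl/leq_maxr.
  have xD : is_sup D x.
    apply: is_sup_strong => //.
    + by move=> _ [n _ <-].
    + by move=> _ [n _ <-]; rewrite starN ys.
    + move=> u d d0; have [N hN] := cvg_qform u xc d0.
      exists (- y N); first by exists N.
      by have := hN _ (leqnn N); rewrite ltr_norml => /andP[]; lra.
  have e4 : 0 < e / 4 by rewrite divr_gt0.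
  have [_ [n _ <-]] := hom_sup_strong z hD xD e4.
  rewrite !homN !qformN; have := ylow n; lra.
Qed.

End StrongContinuity.

(* Otherwise, for every finite [s], the elements [a] violating the bound
   accumulate to some [y] killing [s] with [e / 2 <= qform (f y) z]; as the
   complements of the support projections of such [y] increase to 1, this
   contradicts normality. *)
Lemma normal_strongly_continuous z e : 0 < e ->
  exists (s : seq H) (d : R), 0 < d /\ forall a, qpos a -> lev a 1 ->
    \sum_(w <- s) qform a w < d -> qform (f a) z < e.
Proof.
move=> e0; apply: contrapT => hno.
have bad (s : seq H) d : 0 < d -> exists a, [/\ qpos a, lev a 1,
    \sum_(w <- s) qform a w < d & e <= qform (f a) z].
  move=> d0; apply: contrapT => h; apply: hno; exists s, d; split=> // a ap a1 ad.
  by rewrite ltNge; apply/negP => ea; apply: h; exists a.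
have /choice[p hp] := support_projection.
(* Enlarging [s] shrinks its support projection, and [p [:: u]] kills [u]; hence the elements
   [1 - p s] increase to 1. *)
pose D := range (fun s => 1 - p s).
have ps s : star (p s) = p s by case: (hp s).
have p1 s u : qform (p s) u <= nsq u.
  have [_ hs pq _] := hp s; have [_ ku] := hs u.
  have [au _] := hs u.
  have h : ip (pi (p s) u) (u - pi (p s) u) = 0.
    apply: (adherent_orth hH _ au) => v Sv; exact: kill_range_orth Sv ku.
  have := nsq_ge0 hH (u - pi (p s) u); rewrite (nsqB hH) (ripC hH).
  rewrite -/(qform (p s) u) pq; lra.
have pm s s' : {subset s <= s'} -> lev (p s') (p s).
  move=> ss; apply: levP => // u; have [_ hs pq _] := hp s.
  have [_ hs' pq' _] := hp s'; rewrite pq pq'.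
  have [au' _] := hs' u; have [_ ku] := hs u.
  have h : ip (pi (p s') u) (u - pi (p s) u) = 0.
    apply: (adherent_orth hH _ au') => v [r hr ->].
    apply: kill_range_orth ku; exists r => // q /hr[q1 q2]; split=> // w /ss.
    exact: q2.
  have e1 : nsq (pi (p s') u) = rip (pi (p s') u) (pi (p s) u).
    rewrite -pq' /qform -{2}[u](subrK (pi (p s) u)) /rip (ipDr hH) h.
    by rewrite add0r.
  have := cauchy_schwarz hH (pi (p s') u) (pi (p s) u); rewrite -e1.
  have := nsq_ge0 hH (pi (p s') u); have := nsq_ge0 hH (pi (p s) u).
  move: (nsq _) (nsq _) => A B; nra.
have hD : increasing_net D.
  split; first by exists (1 - p [::]), [::].
  - by move=> _ [s _ <-]; rewrite /selfadjoint starB star1 ps.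
  - move=> _ _ [s _ <-] [s' _ <-]; exists (1 - p (s ++ s')); split.
    + by exists (s ++ s').
    + apply/lev_positive_elt; rewrite /lev opprB addrC addrA subrK.
      by apply: pm => w ws; rewrite mem_cat ws.
    + apply/lev_positive_elt; rewrite /lev opprB addrC addrA subrK.
      by apply: pm => w ws; rewrite mem_cat ws orbT.
have D1 : is_sup D 1.
  apply: is_sup_strong; rewrite ?star1 //.
  - move=> _ [s _ <-]; rewrite /lev opprB addrC subrK; split=> // u.
    by have [_ _ -> _] := hp s; exact: nsq_ge0.
  - by move=> _ [s _ <-]; rewrite starB star1 ps.
  - move=> u d d0; exists (1 - p [:: u]); first by exists [:: u].
    have [_ _ pq h] := hp [:: u]; rewrite qformB opprB addrC subrK pq.
    by rewrite h ?mem_head // (nsq0 hH).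
have e4 : 0 < e / 4 by lra.
(* Normality makes the form of [f (p s)] at [z] smaller than [e / 4] for some [s], whereas
   [bad_limit] supplies [y <= p s] whose image has at least [e / 4] there. *)
have [_ [s _ <-]] := hom_sup_strong z hD D1 e4.
have [y [yp y1 ky ylow]] := bad_limit e0 (bad s).
have [_ hs pq _] := hp s.
have := lev_qform z (hom_lev (kills_le_support hs pq (ps s) ky y1)).
by rewrite homB qformB; lra.
Qed.

End NormalEndo.

(** * Weak closure *)

Section Amplification.
Variable (m : nat).
Local Notation Hm := {ffun 'I_m -> H}.

Definition ipm (u v : Hm) : R[i] := \sum_i ip (u i) (v i).
Definition amp (t : H -> H) (u : Hm) : Hm := [ffun i => t (u i)].

Lemma nsq_ipm (u : Hm) : sqn ipm u = \sum_i nsq (u i).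
Proof.
rewrite /sqn /ipm.
exact: (big_morph (@complex.Re R) (@ReD R) (erefl : complex.Re (0 : R[i]) = 0)).
Qed.

Lemma hilbert_ipm : hilbert ipm.
Proof.
split.
- move=> k u v w; rewrite /ipm mulr_sumr -big_split; apply: eq_bigr => i _ /=.
  by rewrite !ffunE (ipDl hH) (ipZl hH).
- move=> u v; rewrite /ipm rmorph_sum; apply: eq_bigr => i _ /=.
  by rewrite (hilbert_conj hH).
- by move=> u; apply: sumr_ge0 => i _; exact: (hilbert_ge0 hH).
- move=> u /eqP; rewrite nsq_ipm psumr_eq0 => [/allP u0|i _]; last exact: (nsq_ge0 hH).
  apply/ffunP => i; rewrite ffunE; apply: (hilbert_eq0 hH); apply/eqP.
  by have := u0 i (mem_index_enum _).
- move=> x hx.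
  have /choice[l hl] (i : 'I_m) : exists l, forall e, 0 < e -> exists N,
      forall n, (N <= n)%N -> nsq (x n i - l) < e.
    apply: (hilbert_complete hH (x := fun n => x n i)) => e /hx[N hN].
    exists N => a b Na Nb; apply: le_lt_trans (hN a b Na Nb).
    rewrite nsq_ipm (bigD1 i) //= !ffunE lerDl.
    by apply: sumr_ge0 => j _; exact: (nsq_ge0 hH).
  exists [ffun i => l i] => e e0.
  have m0 : 0 < (m.+1)%:R :> R by rewrite ltr0n.
  have /choice[N hN] i : exists N, forall n, (N <= n)%N -> nsq (x n i - l i) < e / m.+1%:R.
    exact: hl (divr_gt0 e0 m0).
  exists (\max_i N i)%N => n hn; rewrite nsq_ipm.
  apply: (@le_lt_trans _ _ (\sum_(i < m) e / m.+1%:R)).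
    apply: ler_sum => i _; rewrite !ffunE; apply/ltW/hN.
    exact: leq_trans (leq_bigmax _) hn.
  rewrite sumr_const card_ord -[_ *+ m]mulr_natr mulrAC ltr_pdivrMr //.
  by rewrite ltr_pM2l // ltr_nat.
Qed.

Lemma ampB x (u v : Hm) : amp (pi x) (u - v) = amp (pi x) u - amp (pi x) v.
Proof. by apply/ffunP => i; rewrite !ffunE piBr. Qed.

Lemma ipm_adj x (u v : Hm) : ipm (amp (pi x) u) v = ipm u (amp (pi (star x)) v).
Proof. by apply: eq_bigr => i _; rewrite !ffunE ip_adj. Qed.

End Amplification.

Section WeakClosure.
Variable N : set M.
Hypotheses (N1 : N 1) (NL : forall (k : R[i]) x y, N x -> N y -> N (k *: x + y))
  (NM : forall x y, N x -> N y -> N (x * y)) (NS : forall x, N x -> N (star x)).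

(** Weak operator closure, expressed by duality: the weakly continuous functionals are the finite
    sums of vector functionals, and [x] is in the closure when each of them that vanishes on [N]
    vanishes at [x]. *)
Definition wclosure x : Prop := forall m (u v : {ffun 'I_m -> H}),
  (forall n, N n -> ipm (amp (pi n) u) v = 0) -> ipm (amp (pi x) u) v = 0.

Lemma NZ k x : N x -> N (k *: x).
Proof.
move=> Nx; have N0 : N 0 by have := NL (-1) N1 N1; rewrite scaleN1r addNr.
by have := NL k Nx N0; rewrite addr0.
Qed.

Lemma ND x y : N x -> N y -> N (x + y).
Proof. by move=> Nx Ny; have := NL 1 Nx Ny; rewrite scale1r. Qed.

(** Von Neumann's density argument: in the [m]-fold power, the projection [P] onto the closure of
    [N u] commutes with [N], so its matrix entries lie in the commutant of [N] and [x] commutes with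
    [P]. Since [N] contains 1, [P] fixes [u], and [x u] is adherent to [N u]. *)
Lemma bicommutant_wclosure x :
  commutant (commutant (pi @` N)) (pi x) -> wclosure x.
Proof.
move=> [_ hx] m u v huv; have hm := hilbert_ipm m.
pose S : set {ffun 'I_m -> H} := [set p | exists2 n, N n & p = amp (pi n) u].
have SZ k p : S p -> S (k *: p).
  move=> [n Nn ->]; exists (k *: n); first exact: NZ.
  by apply/ffunP => i; rewrite !ffunE piZ.
have rS : real_subspace S.
  split=> [|p q [n Nn ->] [n' Nn' ->]|a p]; last exact: SZ.
    exists 0; first by have := NL (-1) N1 N1; rewrite scaleN1r addNr.
    by apply/ffunP => i; rewrite !ffunE pi0.
  exists (n + n'); first exact: ND.
  by apply/ffunP => i; rewrite !ffunE piD.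
pose part p p0 := adherent (@ipm m) S p0 /\ forall s, S s -> ipm s (p - p0) = 0.
have adhD p q : adherent (@ipm m) S p -> adherent (@ipm m) S q ->
    adherent (@ipm m) S (p + q).
  move=> ha hb e e0; have e4 : 0 < e / 4 by lra.
  have [s Ss hs] := ha _ e4; have [t St ht] := hb _ e4.
  exists (s + t); first by have [_ + _] := rS; apply.
  rewrite opprD addrACA; have := nsqD_le hm (p - s) (q - t); lra.
have adhZ k p : adherent (@ipm m) S p -> adherent (@ipm m) S (k *: p).
  move=> ha e e0; have k0 : 0 <= k * k^* := mulcJ_ge0 k.
  have k0' : 0 <= complex.Re (k * k^*) by move: k0; rewrite lecE => /andP[].
  have k1 : 0 < complex.Re (k * k^*) + 1 by lra.
  have [s Ss hs] := ha _ (divr_gt0 e0 k1); exists (k *: s); first exact: SZ.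
  rewrite -scalerBr /sqn (ipZl hm) (ipZr hm) mulrA (ge0_ReE k0) ReMr.
  move: hs; rewrite ltr_pdivlMr // /sqn.
  have := nsq_ge0 hm (p - s); rewrite /sqn; nra.
have part_unique p p1 p2 : part p p1 -> part p p2 -> p1 = p2.
  move=> [ha oa] [hb ob]; apply/eqP; rewrite -subr_eq0.
  apply/eqP/(hilbert_eq0 hm); rewrite /sqn.
  suff -> : ipm (p1 - p2) (p1 - p2) = 0 by [].
  apply: (adherent_orth hm (S := S)) => [s Ss|].
    have -> : p1 - p2 = (p - p2) + (-1) *: (p - p1).
      by rewrite scaleN1r opprB [RHS]addrC addrA subrK.
    by rewrite (ipDr hm) (ipZr hm) oa // ob // mulr0 addr0.
  by apply: adhD => //; rewrite -scaleN1r; exact: adhZ.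
have /choice[P hP] p : exists p0, part p p0.
  by have [p0 hp0] := best_approximation_complex hm p rS SZ; exists p0.
have Pl : linear P.
  move=> k p q; apply: part_unique (hP _) _; split.
    by apply: adhD; [apply: adhZ|]; case: (hP p); case: (hP q).
  move=> s Ss; rewrite opprD addrACA -scalerBr (ipDr hm) (ipZr hm).
  have [_ ->] := hP p => //; have [_ ->] := hP q => //.
  by rewrite mulr0 addr0.
have PD p q : P (p + q) = P p + P q by have := Pl 1 p q; rewrite !scale1r.
have P0 : P 0 = 0 by have := Pl (-1) 0 0; rewrite scaler0 addr0 scaleN1r addNr.
have P1 p : sqn (@ipm m) (P p) <= sqn (@ipm m) p.
  have [ha oa] := hP p; have h : ipm (P p) (p - P p) = 0.
    exact: (adherent_orth hm oa ha).
  have := nsqD hm (P p) (p - P p); rewrite /reip h addrC subrK /=.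
  have := nsq_ge0 hm (p - P p); lra.
have Pn n p : N n -> P (amp (pi n) p) = amp (pi n) (P p).
  move=> Nn; apply: part_unique (hP _) _; have [ha oa] := hP p; split.
    move=> e e0; have [K K0 hK] := pi_bounded n.
    have [s Ss hs] := ha _ (divr_gt0 e0 K0); exists (amp (pi n) s).
      case: Ss => n' Nn' ->; exists (n * n'); first exact: NM.
      by apply/ffunP => i; rewrite !ffunE piM.
    rewrite -ampB; apply: (@le_lt_trans _ _ (K * sqn (@ipm m) (P p - s))).
      rewrite !nsq_ipm mulr_sumr; apply: ler_sum => i _.
      by rewrite ffunE; exact: hK.
    by rewrite mulrC -ltr_pdivlMr.
  move=> _ [n' Nn' ->]; rewrite -ampB -[n]starK -ipm_adj.
  by apply: oa; exists (star n * n'); [exact/NM/Nn'/NS|apply/ffunP => i; rewrite !ffunE piM].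
pose E (j : 'I_m) (p : H) : {ffun 'I_m -> H} := [ffun i => if i == j then p else 0].
have El j k p q : E j (k *: p + q) = k *: E j p + E j q.
  by apply/ffunP => i; rewrite !ffunE; case: eqP => // _; rewrite scaler0 addr0.
have Ec (p : {ffun 'I_m -> H}) : p = \sum_j E j (p j).
  apply/ffunP => i; rewrite sum_ffunE (bigD1 i) //= big1 => [|j /negPf ji].
    by rewrite ffunE eqxx addr0.
  by rewrite ffunE eq_sym ji.
have tC i j : commutant (pi @` N) (fun p => P (E j p) i).
  split.
    apply: (@nsq_bounded_op _ 1); first by move=> k p q; rewrite El Pl !ffunE.
    move=> p; rewrite mul1r; apply: (@le_trans _ _ (sqn (@ipm m) (E j p))).
      apply: le_trans (P1 _); rewrite nsq_ipm (bigD1 i) //= lerDl.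
      by apply: sumr_ge0 => k _; exact: (nsq_ge0 hH).
    rewrite nsq_ipm (bigD1 j) //= big1 => [|k /negPf kj].
      by rewrite ffunE eqxx addr0.
    by rewrite ffunE kj (nsq0 hH).
  move=> _ [n Nn <-] p.
  have -> : E j (pi n p) = amp (pi n) (E j p).
    by apply/ffunP => k; rewrite !ffunE; case: eqP => // _; rewrite pi0r.
  by rewrite Pn // ffunE.
have Px p : P (amp (pi x) p) = amp (pi x) (P p).
  rewrite {1}(Ec (amp (pi x) p)) {2}(Ec p) !(big_morph P PD P0).
  apply/ffunP => i; rewrite !ffunE !sum_ffunE.
  rewrite (big_morph (pi x) (piDr x) (pi0r x)); apply: eq_bigr => j _.
  by rewrite ffunE (hx _ (tC i j)).
have Pu : P u = u.
  apply: part_unique (hP u) _; split=> [e e0|s Ss].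
    exists u; last by rewrite subrr (nsq0 hm).
    by exists 1 => //; apply/ffunP => i; rewrite ffunE pi1.
  by rewrite subrr (ip0r hm).
rewrite -Pu -Px; have [ha _] := hP (amp (pi x) u).
by apply: (adherent_orth hm _ ha) => _ [n Nn ->]; exact: huv.
Qed.

Lemma wclosure_star x : wclosure x -> wclosure (star x).
Proof.
move=> wx m u v huv; have hm := hilbert_ipm m.
rewrite ipm_adj starK (hilbert_conj hm) wx ?conjC0 // => n Nn.
by rewrite (hilbert_conj hm) -[n]starK -ipm_adj huv ?conjC0 //; exact: NS.
Qed.

Lemma wclosureZD k x y : wclosure x -> wclosure y -> wclosure (k *: x + y).
Proof.
move=> wx wy m u v huv; have hm := hilbert_ipm m.
have -> : amp (pi (k *: x + y)) u = k *: amp (pi x) u + amp (pi y) u.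
  by apply/ffunP => i; rewrite !ffunE piD piZ.
by rewrite (ipDl hm) (ipZl hm) wx // wy // mulr0 addr0.
Qed.

Lemma cartesian x : exists a b, [/\ star a = a, star b = b,
  x = a + 'i *: b, star x = a - 'i *: b &
  a = (2^-1 : R[i]) *: (x + star x) /\ b = (2 * 'i)^-1 *: (x - star x)].
Proof.
have i0 : ('i : R[i]) != 0 by exact: neq0Ci.
have h2 : (2 : R[i]) != 0 by rewrite pnatr_eq0.
have half y : (2^-1 : R[i]) *: (y + y) = y.
  by rewrite -mulr2n -[y *+ 2]scaler_nat scalerA mulVf // scale1r.
exists ((2^-1 : R[i]) *: (x + star x)), ((2 * 'i)^-1 *: (x - star x)); split=> //.
- by rewrite starZ starD starK fmorphV rmorph_nat addrC.
- rewrite starZ starB starK fmorphV rmorphM /= rmorph_nat conjCi mulrN invrN.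
  by rewrite scaleNr -scalerN opprB.
- rewrite scalerA invfM mulrCA mulfV // mulr1 -scalerDr addrACA subrr addr0.
  by rewrite half.
- rewrite scalerA invfM mulrCA mulfV // mulr1 -scalerBr opprB [x + _]addrC.
  by rewrite addrACA subrr addr0 half.
Qed.

(** The error [v] of the best approximation is orthogonal, in real part only, to the vectors [n u]
    with [n] self-adjoint. The complex functional [x |-> ip (x u) v + ip (x v) u] then vanishes on
    the self-adjoint part of [N], so on [N], so at [h]; this forces [v = 0]. *)
Lemma wclosure_approx m h (u : {ffun 'I_m -> H}) e :
  wclosure h -> star h = h -> 0 < e ->
  exists n, [/\ N n, star n = n &
    sqn (@ipm m) (amp (pi h) u - amp (pi n) u) < e].
Proof.
move=> wh hs e0; have hm := hilbert_ipm m.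
pose S : set {ffun 'I_m -> H} :=
  [set p | exists2 n, N n /\ star n = n & p = amp (pi n) u].
have rS : real_subspace S.
  split=> [|p q [n [Nn sn] ->] [n' [Nn' sn'] ->]|k p [n [Nn sn] ->]].
  - exists 0; last by apply/ffunP => i; rewrite !ffunE pi0.
    by split; [have := NL (-1) N1 N1; rewrite scaleN1r addNr|exact: star0].
  - exists (n + n'); last by apply/ffunP => i; rewrite !ffunE piD.
    by split; [exact: ND|rewrite starD sn sn'].
  - exists (k%:C *: n); last by apply/ffunP => i; rewrite !ffunE piZ.
    by split; [exact: NZ|rewrite starZr sn].
have [p0 [ap op]] := best_approximation hm (amp (pi h) u) rS.
pose v := amp (pi h) u - p0.
have swap n : star n = n -> ipm (amp (pi n) v) u = (ipm (amp (pi n) u) v)^*.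
  by move=> sn; rewrite ipm_adj sn (hilbert_conj hm).
have re0 (z : R[i]) : complex.Re z = 0 -> z + z^* = 0.
  by case: z => a b /= ->; rewrite -[LHS]/((0 + 0) +i* (b + - b)) addr0 subrr.
have psi0 n : N n -> ipm (amp (pi n) u) v + ipm (amp (pi n) v) u = 0.
  have sa n' : N n' -> star n' = n' -> ipm (amp (pi n') u) v + ipm (amp (pi n') v) u = 0.
    move=> Nn sn; rewrite swap //; apply: re0; apply: op.
    by exists n'.
  move=> Nn; have [a [b [sa' sb nE _ [aE bE]]]] := cartesian n.
  have Na : N a by rewrite aE; apply/NZ/ND => //; exact: NS.
  have Nb : N b.
    by rewrite bE -scaleN1r; apply: NZ; apply: ND => //; apply: NZ; exact: NS.
  have ampE p : amp (pi n) p = amp (pi a) p + 'i *: amp (pi b) p.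
    by apply/ffunP => i; rewrite !ffunE {1}nE piD piZ.
  rewrite !ampE !(ipDl hm) !(ipZl hm) addrACA -mulrDr.
  by rewrite (sa a) // (sa b) // mulr0 addr0.
have psih : ipm (amp (pi h) u) v + ipm (amp (pi h) v) u = 0.
  (* Concatenating the two families writes the sum of two functionals as a single one on [m + m]
     vectors, as [wclosure] requires. *)
  pose U : {ffun 'I_(m + m) -> H} :=
    [ffun i => match fintype.split i with inl j => u j | inr j => v j end].
  pose V : {ffun 'I_(m + m) -> H} :=
    [ffun i => match fintype.split i with inl j => v j | inr j => u j end].
  have UV x : ipm (amp (pi x) U) V = ipm (amp (pi x) u) v + ipm (amp (pi x) v) u.
    rewrite /ipm big_split_ord /=; congr (_ + _); apply: eq_bigr => i _; rewrite !ffunE.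
      by rewrite (unsplitK (inl i) : fintype.split (lshift m i) = inl i) !ffunE.
    by rewrite (unsplitK (inr i) : fintype.split (rshift m i) = inr i) !ffunE.
  by rewrite -UV; apply: wh => n Nn; rewrite UV psi0.
have r0 : reip (@ipm m) (amp (pi h) u) v = 0.
  move: psih; rewrite swap // /reip; case: (ipm _ _) => a b /= [] /eqP.
  by rewrite -mulr2n mulrn_eq0 /= => /eqP.
have rp : reip (@ipm m) p0 v = 0.
  apply/eqP; rewrite -sqrf_eq0 eq_le sqr_ge0 andbT.
  apply: lt_eps_le => d d0; rewrite add0r.
  have K0 : 0 < sqn (@ipm m) v + 1 by have := nsq_ge0 hm v; lra.
  have [p Sp hp] := ap _ (divr_gt0 d0 K0).
  have := cauchy_schwarz hm (p0 - p) v; rewrite (ripBl hm) (op _ Sp) subr0.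
  move: hp; rewrite ltr_pdivlMr //; have := nsq_ge0 hm (p0 - p).
  have := nsq_ge0 hm v; nra.
have v0 : v = 0.
  apply: (hilbert_eq0 hm).
  have : reip (@ipm m) (amp (pi h) u - p0) v = 0 by rewrite (ripBl hm) r0 rp subrr.
  by [].
have [p [n [Nn sn] pE] hp] := ap _ e0; exists n; split=> //.
by rewrite -pE; move/eqP: v0; rewrite subr_eq0 => /eqP ->.
Qed.

End WeakClosure.

(* The values at h of the function (h + i)^-1, which is bounded on self-adjoint
   elements, unlike h itself. *)
Lemma cayley_resolvent h : star h = h -> exists k,
  [/\ k * (h + 'i%:A) = 1, (h + 'i%:A) * k = 1 &
      forall u, nsq (pi k u) <= nsq u].
Proof.
move=> hs; have [g [_ g1 g2]] := resolvent (qpos_sq h); rewrite hs in g1 g2.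
have e1 : (h - 'i%:A) * (h + 'i%:A) = 1 + h * h.
  rewrite mulrDr mulrBl mulrBl -scalerAr mulr1 -!scalerAl !mul1r scalerA.
  by rewrite -(expr2 'i) sqrCi scaleN1r opprK addrA subrK addrC.
have e2 : (h + 'i%:A) * (h - 'i%:A) = 1 + h * h.
  rewrite mulrBr mulrDl mulrDl -scalerAr mulr1 -!scalerAl !mul1r scalerA.
  by rewrite -(expr2 'i) sqrCi scaleN1r opprD opprK addrA addrK addrC.
have r1 : (h + 'i%:A) * ((h - 'i%:A) * g) = 1 by rewrite mulrA e2.
have l1 : (g * (h - 'i%:A)) * (h + 'i%:A) = 1 by rewrite -mulrA e1.
have kE : (h - 'i%:A) * g = g * (h - 'i%:A).
  by rewrite -[LHS]mul1r -{1}l1 -mulrA r1 mulr1.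
exists ((h - 'i%:A) * g); split=> //; first by rewrite kE.
move=> u; set w := pi _ u.
have -> : u = pi h w + 'i *: w by rewrite -[in LHS](pi1 u) -r1 piM piD piZ pi1.
rewrite (nsqD hH); have -> : rip (pi h w) ('i *: w) = 0.
  rewrite /rip (ipZr hH) conjCi.
  have : ip (pi h w) w = (ip (pi h w) w)^*.
    by rewrite -(hilbert_conj hH) {1}ip_adj hs.
  rewrite mulNr ReN; case: (ip _ _) => a b [] b0 /=.
  by rewrite mul0r mul1r; lra.
rewrite mulr0 addr0; have -> : nsq ('i *: w) = nsq w.
  by rewrite /nsq (ipZl hH) (ipZr hH) mulrA conjCi mulrN -(expr2 'i) sqrCi opprK mul1r.
by rewrite lerDr (nsq_ge0 hH).
Qed.

(** * Weak closedness of the algebra cut out by an intertwining relation *)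

Section FixedAlgebra.
Variables (f : M -> M) (r : M).
Hypotheses (fh : star_hom f) (fn : normal_map f).

Definition fixed_algebra : set M :=
  [set x | r * x = f x * r /\ r * star x = f (star x) * r].

Let N := fixed_algebra.

Lemma fixed1 : N 1. Proof. by split; rewrite ?star1 (shom1 fh) mulr1 mul1r. Qed.

Lemma fixedL (k : R[i]) x y : N x -> N y -> N (k *: x + y).
Proof.
move=> [x1 x2] [y1 y2]; split.
  by rewrite (homD fh) (homZ fh) mulrDr mulrDl -scalerAr -scalerAl x1 y1.
by rewrite starD starZ (homD fh) (homZ fh) mulrDr mulrDl -scalerAr -scalerAl x2 y2.
Qed.

Lemma fixedM x y : N x -> N y -> N (x * y).
Proof.
move=> [x1 x2] [y1 y2]; split; rewrite ?starM (shomM fh) mulrA.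
  by rewrite x1 -mulrA y1 mulrA.
by rewrite y2 -mulrA x2 mulrA.
Qed.

Lemma fixedS x : N x -> N (star x).
Proof. by move=> [x1 x2]; split; rewrite ?starK. Qed.

Lemma mulr_shift (a b : M) (k : R[i]) : a * (b + k%:A) = a * b + k *: a.
Proof. by rewrite mulrDr -scalerAr mulr1. Qed.

Lemma hom_shift_mul (a b : M) (k : R[i]) : f (a + k%:A) * b = f a * b + k *: b.
Proof. by rewrite (homD fh) (homZ fh) (shom1 fh) mulrDl -scalerAl mul1r. Qed.

(** Approximate [h] by self-adjoint [n] in [N], with resolvents [k] and [kn]. The difference
    [z = kn (n - h) k] is small on prescribed vectors and its squared norm is at most 4, so strong
    continuity of [f] on the positive unit ball applies to [star z * z / 4]. *)
Lemma fixed_sa_closed h : star h = h -> wclosure N h -> r * h = f h * r.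
Proof.
move=> hs wh; have [k [k1 k2 kb]] := cayley_resolvent hs.
suff kr : r * k = f k * r.
  have : f (h + 'i%:A) * (r * k) * (h + 'i%:A) = f (h + 'i%:A) * (f k * r) * (h + 'i%:A).
    by rewrite kr.
  rewrite -!mulrA k1 mulr1 2!mulrA -(shomM fh) k2 (shom1 fh) mul1r.
  by rewrite hom_shift_mul mulr_shift => /addIr.
apply: pi_inj => u; apply/eqP; rewrite -subr_eq0 -piB; apply/eqP/nsq_small => e e0.
have [B B0 hB] := pi_bounded r.
(* After the factor [1 / 4] is undone, [e / 16] leaves [e / 4] for the term with [f z]; the
   threshold [e / (4 * B)] leaves as much for [r z], and [nsqD_le] doubles their sum. *)
have e16 : 0 < e / 16 by lra.
have [s [d [d0 hd]]] := normal_strongly_continuous fh fn (pi r u) e16.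
pose l := u :: s; pose m := size l.
(* Approximation is needed at the vectors [k w], since [z w = kn (n - h) (k w)] and [kn] is a
   contraction. *)
pose U : {ffun 'I_m -> H} := [ffun i : 'I_m => pi k (nth u l i)].
pose c := Num.min (e / (4 * B)) d; have c0 : 0 < c.
  by rewrite lt_min d0 andbT divr_gt0 // mulr_gt0.
have [n [Nn ns hn]] := wclosure_approx fixed1 fixedL fixedS U wh hs c0.
have [kn [kn1 kn2 knb]] := cayley_resolvent ns.
have knr : r * kn = f kn * r.
  have : f kn * (r * (n + 'i%:A)) * kn = f kn * (f (n + 'i%:A) * r) * kn.
    by rewrite mulr_shift hom_shift_mul; case: Nn => ->.
  by rewrite !mulrA -(shomM fh) kn1 (shom1 fh) mul1r -!mulrA kn2 mulr1 => <-.
pose z := k - kn.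
have zE : z = kn * (n - h) * k.
  have -> : n - h = (n + 'i%:A) - (h + 'i%:A) by rewrite opprD addrACA subrr addr0.
  by rewrite mulrBr mulrBl kn1 mul1r -mulrA k2 mulr1.
have zn (i : 'I_m) : nsq (pi z (nth u l i)) <= nsq ((amp (pi h) U - amp (pi n) U) i).
  rewrite zE -mulrA piM; apply: le_trans (knb _) _.
  by rewrite !ffunE (nsqBC hH) -piB piM.
have zs : \sum_(i < m) nsq (pi z (nth u l i)) < c.
  by apply: le_lt_trans hn; rewrite nsq_ipm; apply: ler_sum => i _.
have zsl : \sum_(w <- l) nsq (pi z w) < c by rewrite (big_nth u) big_mkord.
move: zsl; rewrite /l big_cons => zsl.
have s0 : 0 <= \sum_(w <- s) nsq (pi z w) by apply: sumr_ge0 => w _; exact: (nsq_ge0 hH).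
have zu0 := nsq_ge0 hH (pi z u).
have zu : nsq (pi z u) * (4 * B) < e.
  rewrite -ltr_pdivlMr ?mulr_gt0 //; apply: (@lt_le_trans _ _ c); first by lra.
  by rewrite ge_min lexx.
pose a := (4^-1 : R)%:C *: (star z * z).
have ap : qpos a by apply: qposZ; [rewrite invr_ge0|exact: qpos_sq].
have aq w : qform a w = 4^-1 * nsq (pi z w) by rewrite qformZ qform_sq.
have a1 : lev a 1.
  apply: levP; rewrite ?star1 //; first by case: ap.
  move=> w; rewrite aq qform1; have := nsqD_le hH (pi k w) (- pi kn w).
  by rewrite (nsqN hH) -piN -piD; have := kb w; have := knb w; lra.
have := hd _ ap a1.
have -> : \sum_(w <- s) qform a w = 4^-1 * \sum_(w <- s) nsq (pi z w).
  by rewrite mulr_sumr; apply: eq_bigr => w _; rewrite aq.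
have cd : c <= d by rewrite ge_min lexx orbT.
move=> /(_ ltac:(lra)).
rewrite (homZ fh) (shomM fh) (shomS fh) qformZ qform_sq -piM => hz.
have -> : r * k - f k * r = r * z - f z * r.
  by rewrite mulrBr (homB fh) mulrBl knr opprB addrA subrK.
have := nsqD_le hH (pi (r * z) u) (- pi (f z * r) u).
rewrite (nsqN hH) -piN -piD; have := hB (pi z u); rewrite -piM.
by nra.
Qed.

Lemma fixed_wclosed x : wclosure N x -> N x.
Proof.
move=> wx; have [a [b [sa sb xE sxE [aE bE]]]] := cartesian x.
have wsx := wclosure_star fixedS wx.
have w0 : wclosure N 0.
  move=> m u v _; have -> : amp (pi 0) u = 0 by apply/ffunP => i; rewrite !ffunE pi0.
  exact: (ip0l (hilbert_ipm m)).
have wZ k y : wclosure N y -> wclosure N (k *: y).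
  by move=> wy; rewrite -[_ *: _]addr0; exact: wclosureZD.
have wa : wclosure N a.
  by rewrite aE; apply: wZ; have := wclosureZD 1 wx wsx; rewrite scale1r.
have wb : wclosure N b.
  by rewrite bE; apply: wZ; rewrite -scaleN1r addrC; exact: wclosureZD.
have ea := fixed_sa_closed sa wa; have eb := fixed_sa_closed sb wb.
split; last rewrite sxE; rewrite ?xE.
  by rewrite (homD fh) (homZ fh) mulrDr mulrDl -scalerAr -scalerAl ea eb.
by rewrite (homB fh) (homZ fh) mulrBr mulrBl -scalerAr -scalerAl ea eb.
Qed.

Lemma fixed_bicommutant : commutant (commutant (pi @` N)) `<=` pi @` N.
Proof.
move=> t ht; have [x _ xt] : range pi t.
  apply: (vnpi_bicommutant (v0 := W)); case: ht => bt ht; split=> // s hs u.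
  apply: ht; case: hs => bs hs; split=> // _ [x _ <-] v.
  by apply: hs; exists x.
exists x => //; apply: fixed_wclosed.
apply: (bicommutant_wclosure fixed1 fixedL fixedM fixedS).
by rewrite xt.
Qed.

End FixedAlgebra.

(** The images of the projection [S * star S] under the powers of [w] are mutually orthogonal. With
    [e] their sum, [w * e + (1 - e)] shifts them by one step and fixes the rest, so precisely the
    first summand is missing from its range. *)
Lemma complement_isometry (S w : M) : Defs.isometry S -> Defs.isometry w ->
  star S * w = 0 -> exists2 v, Defs.isometry v & v * star v = 1 - S * star S.
Proof.
move=> S1 w1 Sw; have wS : star w * S = 0 by rewrite -[S]starK -starM Sw star0.
have SSw : S * star S * w = 0 by rewrite -mulrA Sw mulr0.
have wSS : star w * (S * star S) = 0 by rewrite mulrA wS mul0r.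
pose s := fix s n : M := if n is n.+1 then S * star S + w * s n * star w else 0.
have sS n : s n.+1 = S * star S + w * s n * star w by [].
have ss n : star (s n) = s n.
  elim: n => [|n IH]; first exact: star0.
  by rewrite sS starD !starM !starK IH mulrA.
have sp n : s n * s n = s n.
  elim: n => [|n IH]; first exact: mul0r.
  rewrite sS mulrDl !mulrDr.
  rewrite -!mulrA [star S * (S * _)]mulrA S1 mul1r.
  rewrite [star S * (w * _)]mulrA Sw mul0r mulr0 addr0.
  rewrite [star w * (S * _)]mulrA wS mul0r !mulr0 add0r.
  by rewrite [star w * (w * _)]mulrA w1 mul1r [s n * (s n * _)]mulrA IH.
have si n : lev (s n) (s n.+1).
  elim: n => [|n IH].
    rewrite /lev subr0 sS mulr0 mul0r addr0; rewrite -{1}[S]starK.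
    exact: qpos_sq.
  rewrite /lev (sS n.+1) [in X in _ - X](sS n) opprD addrACA subrr add0r.
  by rewrite -mulrBl -mulrBr -{1}[w]starK; exact: qpos_conj.
have s1 n : lev (s n) 1.
  have -> : 1 = (1 - s n) + s n by rewrite subrK.
  rewrite /lev addrK; have -> : 1 - s n = star (1 - s n) * (1 - s n).
    by rewrite starB star1 ss mulrBl mul1r mulrBr mulr1 sp subrr subr0.
  exact: qpos_sq.
have sb n u : qform (s n) u <= 1 * nsq u by rewrite mul1r -qform1; exact: lev_qform.
have [e [es ec _]] := vigier_seq ss si sb.
have sq n : qpos (s n) by rewrite -{1}(sp n) -{1}(ss n); exact: qpos_sq.
have ee : e * e = e.
  apply: (cvg_op_unique _ ec).
  have c : cvg_op (fun n => s n * s n) (e * e).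
    by apply: (cvg_opM (K := 1 ^+ 2) ec ec) => n u; exact: qpos_sqr_le (sq n) ler01 (sb n) u.
  by move=> u d /(c u)[n hn]; exists n => k /hn; rewrite sp.
have eE : e = S * star S + w * e * star w.
  apply: cvg_op_unique (cvg_op_shift ec) _.
  exact: cvg_opD (cvg_op_cst _) (cvg_opMr _ (cvg_opMl _ ec)).
have we : w * e = e * w.
  by rewrite {2}eE mulrDl SSw add0r -mulrA w1 mulr1.
have ew : star w * e = e * star w by rewrite -{1}es -starM -we starM es.
exists (w * e + (1 - e)).
  rewrite /Defs.isometry starD starM starB star1 es mulrDl.
  rewrite [e * star w * (_ + _)]mulrDr [(1 - e) * (_ + _)]mulrDr.
  have -> : e * star w * (w * e) = e by rewrite mulrA -(mulrA e) w1 mulr1.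
  have -> : e * star w * (1 - e) = 0.
    by rewrite mulrBr mulr1 -mulrA ew mulrA ee subrr.
  have -> : (1 - e) * (w * e) = 0 by rewrite we mulrA mulrBl mul1r ee subrr mul0r.
  rewrite mulrBl mul1r mulrBr mulr1 ee subrr subr0 addr0 add0r addrC subrK //.
rewrite starD starM starB star1 es mulrDl.
rewrite [w * e * (_ + _)]mulrDr [(1 - e) * (_ + _)]mulrDr.
have -> : w * e * (e * star w) = e - S * star S.
  by rewrite mulrA -(mulrA w) ee {2}eE addrAC subrr add0r.
have -> : w * e * (1 - e) = 0 by rewrite mulrBr mulr1 -mulrA ee subrr.
have -> : (1 - e) * (e * star w) = 0 by rewrite mulrA mulrBl mul1r ee subrr mul0r.
rewrite mulrBl mul1r mulrBr mulr1 ee subrr subr0 addr0 add0r.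
by rewrite addrC addrA subrK.
Qed.

Lemma normal_sum_endo (v0 v1 : M) (f0 f1 f : M -> M) :
  star_hom f0 -> normal_map f0 -> star_hom f1 -> normal_map f1 ->
  star_hom f -> (forall x, f x = v0 * f0 x * star v0 + v1 * f1 x * star v1) ->
  normal_map f.
Proof.
move=> h0 n0 h1 n1 hf fE D x hD xD; have [D0 sD dD] := hD; have [xs xl _] := xD.
have fq y u : qform (f y) u = qform (f0 y) (pi (star v0) u) + qform (f1 y) (pi (star v1) u).
  by rewrite fE qformD -{1}[v0]starK qform_conj -{1}[v1]starK qform_conj.
apply: is_sup_strong.
- by rewrite -(shomS hf) xs.
- by move=> _ [b Db <-]; apply: (hom_lev hf); apply/lev_positive_elt; exact: xl.
- by move=> _ [b Db <-]; rewrite -(shomS hf) sD.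
move=> u e e0; have e2 : 0 < e / 2 by lra.
have [b Db hb] := hom_sup_strong h0 n0 (pi (star v0) u) hD xD e2.
have [c Dc hc] := hom_sup_strong h1 n1 (pi (star v1) u) hD xD e2.
have [d [Dd /lev_positive_elt bd /lev_positive_elt cd]] := dD _ _ Db Dc.
exists (f d); first by exists d.
have := lev_qform (pi (star v0) u) (hom_lev h0 bd).
have := lev_qform (pi (star v1) u) (hom_lev h1 cd).
by rewrite !fq; lra.
Qed.

Lemma positive_scalar (k : R) : positive_elt ((k%:C)%:A : M) -> 0 <= k.
Proof.
move=> /positive_elt_qpos[_ h].
have [u u0] : exists u : H, u != 0.
  apply: contrapT => hu; have : (1 : M) = 0.
    apply: (vnpi_inj (v0 := W)) => u; rewrite pi1; apply/eqP.
    by apply: contrapT => /negP u0; apply: hu; exists u.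
  by apply/eqP; exact: oner_neq0.
have := h u; rewrite qformZ qform1 => hk.
have n0 : 0 < nsq u.
  rewrite lt_def (nsq_ge0 hH) andbT; apply: contraNneq u0 => n0.
  exact/eqP/(hilbert_eq0 hH).
by move: hk; rewrite pmulr_lge0.
Qed.

End VN.

(** * Q-systems *)

Section QSystem.
Variables (R : realType) (M : starAlgType R).
Variables (v0 v1 : M) (rho : M -> M) (a b : M) (D : R).
Hypotheses (hrho : star_hom rho) (i0 : Defs.isometry v0) (i1 : Defs.isometry v1)
  (v01 : v0 * star v0 + v1 * star v1 = 1) (D0 : 0 < D).
Hypotheses (aI : forall x, a * x = rho (rho x) * a)
  (bI : forall x, b * rho x = rho (rho x) * b).
Hypotheses (aa : star a * a = D%:C%:A) (bb : star b * b = (D - 1)%:C%:A)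
  (ab : star a * b = 0).
Hypotheses (rba : rho b * a = b * a) (rabb : a + b * b = rho a + rho b * b)
  (raa : rho (star a) * a = 1) (rab : rho (star a) * b = star b)
  (rbsa : rho (star b) * a = b)
  (rbsb : a * star a + b * star b = 1 + rho (star b) * b).
Implicit Types x y : M.

Let rM x y : rho (x * y) = rho x * rho y. Proof. exact: (shomM hrho). Qed.
Let rS x : rho (star x) = star (rho x). Proof. exact: (shomS hrho). Qed.
Let rD x y : rho (x + y) = rho x + rho y.
Proof. by case: (shom_additive hrho). Qed.
Let rZ k x : rho (k *: x) = k *: rho x.
Proof. by case: (shom_additive hrho). Qed.
Let r0 : rho 0 = 0. Proof. by case: (shom_additive hrho). Qed.
Let r1 : rho 1 = 1. Proof. exact: (shom1 hrho). Qed.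

Lemma v0v1 : star v0 * v1 = 0.
Proof.
have : star v0 * (v0 * star v0 + v1 * star v1) * v1 = star v0 * v1.
  by rewrite v01 mulr1.
rewrite mulrDr mulrA i0 mul1r mulrDl -!mulrA i1 mulr1 => h.
by apply: (addrI (star v0 * v1)); rewrite h addr0.
Qed.

Lemma v1v0 : star v1 * v0 = 0.
Proof. by rewrite -[v0]starK -starM v0v1 star0. Qed.

Lemma ext_v x y : x * v0 = y * v0 -> x * v1 = y * v1 -> x = y.
Proof.
by move=> h0 h1; rewrite -[x]mulr1 -[y]mulr1 -v01 !mulrDr !mulrA h0 h1.
Qed.

Definition sum_endo x := v0 * x * star v0 + v1 * rho x * star v1.
Local Notation gam := sum_endo.

Lemma gam_v0 x : gam x * v0 = v0 * x.
Proof. by rewrite /gam mulrDl -!mulrA i0 v1v0 !mulr0 mulr1 addr0. Qed.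

Lemma gam_v1 x : gam x * v1 = v1 * rho x.
Proof. by rewrite /gam mulrDl -!mulrA i1 v0v1 !mulr0 mulr1 add0r. Qed.

Lemma sum_endo_hom : star_hom gam.
Proof.
split=> [k x y||x y|x].
- by rewrite /gam rD rZ !mulrDr !mulrDl -!scalerAr -!scalerAl scalerDr addrACA.
- by rewrite /gam r1 !mulr1 v01.
- apply: ext_v; rewrite -[in RHS]mulrA ?gam_v0 ?gam_v1.
    by rewrite [RHS]mulrA gam_v0 mulrA.
  by rewrite rM [RHS]mulrA gam_v1 mulrA.
- by rewrite /gam starD !starM !starK rS !mulrA.
Qed.

(** The coproduct from [gam] to [gam \o gam], column by column. The terms [v0 * v0], [v1 * rho v0]
    and [v0 * v1] are forced by the unit laws, while [a] and [b] carry the maps from id and [rho] to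
    [rho \o rho]. The norms [D] and [D - 1] give both columns the same norm, as
    [1 + D = 2 + (D - 1)]. *)
Definition qmult0 := v0 * v0 + v1 * rho v1 * a.
Definition qmult1 := v1 * rho v0 + v0 * v1 + v1 * rho v1 * b.
Definition qmult := qmult0 * star v0 + qmult1 * star v1.
Local Notation r := qmult.

Lemma qmult_v0 : r * v0 = qmult0.
Proof. by rewrite /r mulrDl -!mulrA i0 v1v0 mulr0 mulr1 addr0. Qed.

Lemma qmult_v1 : r * v1 = qmult1.
Proof. by rewrite /r mulrDl -!mulrA i1 v0v1 mulr0 mulr1 add0r. Qed.

Lemma v0_qmult : star v0 * r = 1.
Proof.
apply: ext_v; rewrite -mulrA mul1r.
  by rewrite qmult_v0 mulrDr !mulrA i0 v0v1 !mul0r addr0 mul1r.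
by rewrite qmult_v1 !mulrDr !mulrA i0 v0v1 !mul0r add0r addr0 mul1r.
Qed.

Let cut x y : star x * x = 1 -> star x * (x * y) = y.
Proof. by move=> h; rewrite mulrA h mul1r. Qed.

Let cut0 x y z : star x * y = 0 -> star x * (y * z) = 0.
Proof. by move=> h; rewrite mulrA h mul0r. Qed.

Let w1 : star (rho v1) * rho v1 = 1. Proof. by rewrite -rS -rM i1 r1. Qed.
Let w0 : star (rho v0) * rho v0 = 1. Proof. by rewrite -rS -rM i0 r1. Qed.
Let w10 : star (rho v1) * rho v0 = 0. Proof. by rewrite -rS -rM v1v0 r0. Qed.
Let w01 : star (rho v0) * rho v1 = 0. Proof. by rewrite -rS -rM v0v1 r0. Qed.

Let mult_v y x0 x1 : y * v0 = x0 -> y * v1 = x1 ->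
  (y * qmult0 = x0 * v0 + x1 * (rho v1 * a)) *
  (y * qmult1 = x1 * rho v0 + x0 * v1 + x1 * (rho v1 * b)).
Proof.
by move=> <- <-; rewrite /qmult0 /qmult1 !mulrDr !mulrA.
Qed.

Lemma gam_v0_qmult : gam (star v0) * r = 1.
Proof.
have hv := mult_v (gam_v0 (star v0)) (gam_v1 (star v0)).
rewrite rS in hv; apply: ext_v; rewrite -mulrA mul1r ?qmult_v0 ?qmult_v1 hv -!mulrA.
  by rewrite i0 mulr1 (cut0 _ w01) mulr0 addr0.
by rewrite w0 v0v1 (cut0 _ w01) !mulr0 mulr1 !addr0.
Qed.

Lemma qmult_intertwiner x : r * gam x = gam (gam x) * r.
Proof.
have hv := mult_v (gam_v0 (gam x)) (gam_v1 (gam x)).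
have g1 : rho (gam x) * rho v1 = rho v1 * rho (rho x) by rewrite -!rM gam_v1.
have g0 : rho (gam x) * rho v0 = rho v0 * rho x by rewrite -!rM gam_v0.
apply: ext_v; rewrite -!mulrA ?gam_v0 ?gam_v1 ?qmult_v0 ?qmult_v1 hv mulrA
  ?qmult_v0 ?qmult_v1.
  rewrite /qmult0 mulrDl -!mulrA aI gam_v0; congr (_ + _ * _).
  by rewrite !mulrA g1.
rewrite /qmult1 !mulrDl -!mulrA bI g0 gam_v1; congr (_ + _ + _ * _).
by rewrite !mulrA g1.
Qed.

Lemma qmult_norm : star r * r = (1 + D)%:C%:A.
Proof.
have h00 : star qmult0 * qmult0 = (1 + D)%:C%:A.
  rewrite /qmult0 starD !starM mulrDl !mulrDr -!mulrA !(cut _ i0) !(cut _ i1).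
  rewrite (cut0 _ v0v1) (cut0 _ v1v0) (cut _ w1) aa i0 !mulr0 addr0 add0r.
  by rewrite rmorphD /= scalerDl rmorph1 scale1r.
have h01 : star qmult0 * qmult1 = 0.
  rewrite /qmult0 /qmult1 starD !starM mulrDl !mulrDr -!mulrA !(cut _ i0) !(cut _ i1).
  rewrite !(cut0 _ v0v1) !(cut0 _ v1v0) (cut _ w1) ab v0v1.
  by rewrite w10 !mulr0 !addr0.
have h10 : star qmult1 * qmult0 = 0 by rewrite -[qmult0]starK -starM h01 star0.
have h11 : star qmult1 * qmult1 = (1 + D)%:C%:A.
  rewrite /qmult1 !starD !starM !mulrDl !mulrDr -!mulrA !(cut _ i0) !(cut _ i1).
  rewrite !(cut0 _ v0v1) !(cut0 _ v1v0) (cut _ w1) w0 i1 bb.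
  rewrite (cut0 _ w01) w10 !mulr0 !addr0 !add0r.
  rewrite -mulr2n -[1 *+ 2](scaler_nat 2) -scalerDl; congr (_ *: _).
  by rewrite !rmorphD rmorphN rmorph1 /=; ring.
have sr : star r = v0 * star qmult0 + v1 * star qmult1.
  by rewrite /r starD !starM !starK.
apply: ext_v; rewrite -mulrA ?qmult_v0 ?qmult_v1 sr mulrDl -!mulrA.
  by rewrite h00 h10 mulr0 addr0 -scalerAl -scalerAr mul1r mulr1.
by rewrite h01 h11 mulr0 add0r -scalerAl -scalerAr mul1r mulr1.
Qed.

(** Restricted to [v0] and [v1], all terms match by the intertwining relations except those settled
    by [rba] and [rabb]. *)
Lemma qmult_assoc : r * r = gam r * r.
Proof.
have hv := mult_v (gam_v0 r) (gam_v1 r); have hr := mult_v qmult_v0 qmult_v1.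
have e1 x : rho r * (rho v1 * x) = rho qmult1 * x by rewrite mulrA -rM qmult_v1.
have e0 : rho r * rho v0 = rho qmult0 by rewrite -rM qmult_v0.
have aI' x y : a * (x * y) = rho (rho x) * (a * y) by rewrite mulrA aI mulrA.
have bI' x y : b * (rho x * y) = rho (rho x) * (b * y) by rewrite mulrA bI mulrA.
apply: ext_v; rewrite -!mulrA ?qmult_v0 ?qmult_v1 hv hr -!mulrA ?qmult_v0 ?qmult_v1 ?e1 ?e0.
  rewrite /qmult0 /qmult1 !rD !rM !mulrDl !mulrDr -!mulrA aI bI' rba.
  by rewrite !addrA [RHS](ACl (1*3*4*2*5)).
rewrite /qmult0 /qmult1 !rD !rM !mulrDl !mulrDr -!mulrA aI bI bI'.
rewrite !addrA [LHS](ACl (1*2*3*4*6*7*(5*8))) [RHS](ACl (1*3*6*4*7*5*(2*8))) /=.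
by rewrite -!(mulrDr v1) -!(mulrDr (rho v1)) -!(mulrDr (rho (rho v1))) rabb.
Qed.

Lemma star_qmult_v0 : star r * v0 = 1.
Proof. by rewrite -[LHS]starK starM starK v0_qmult star1. Qed.

Lemma qmult_frobenius : r * star r = gam (star r) * r.
Proof.
pose Z := v0 * (star a * rho (star v1)) +
  v1 * (rho (star v0) + star b * rho (star v1)).
have rv1 : star r * v1 = Z.
  rewrite /r starD !starM !starK mulrDl -!mulrA /qmult0 /qmult1 !starD !starM.
  rewrite !mulrDl -!mulrA v0v1 i1 !mulr0 !mulr1 !addr0 add0r.
  by rewrite /Z !rS mulrDr.
have hv := mult_v (gam_v0 (star r)) (gam_v1 (star r)).
have hr x : r * (v0 * x) = qmult0 * x by rewrite mulrA qmult_v0.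
have hr1 x : r * (v1 * x) = qmult1 * x by rewrite mulrA qmult_v1.
have e1 x : rho (star r) * (rho v1 * x) = rho Z * x by rewrite mulrA -rM rv1.
have e0 : rho (star r) * rho v0 = 1 by rewrite -rM star_qmult_v0 r1.
apply: ext_v; rewrite -!mulrA ?qmult_v0 ?qmult_v1 ?star_qmult_v0 ?rv1 hv -!mulrA
  ?star_qmult_v0 ?rv1 ?e1 ?e0 !mulr1.
  have -> : v0 + v1 * (rho Z * a) = v0 * (v0 * star v0) + v0 * (v1 * star v1) + v1 * (rho Z * a).
    by rewrite -mulrDr v01 mulr1.
  rewrite /r /qmult0 /qmult1 /Z !rD !rM !rD !rM !mulrDl -!mulrA !mulrDl -!mulrA.
  rewrite -!aI (mulrA (rho (star a))) raa mul1r (mulrA (rho (star b))) rbsa.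
  by rewrite !mulrDr !addrA [RHS](ACl (1*4*3*2*5)).
have -> : v1 + v0 * Z + v1 * (rho Z * b) =
    v1 * (rho v0 * rho (star v0)) + v1 * (rho v1 * rho (star v1)) + v0 * Z + v1 * (rho Z * b).
  by rewrite -mulrDr -!rM -rD v01 r1 mulr1.
rewrite /Z !mulrDr hr !hr1 /qmult0 /qmult1 !rD !rM !mulrDl -!mulrA.
rewrite -!bI (mulrA (rho (star a))) rab !mulrDr.
rewrite !addrA [LHS](ACl (1*3*4*5*6*7*(2*8))) [RHS](ACl (3*1*4*7*6*5*(2*8))) /=.
congr (_ + _); rewrite -!(mulrDr v1) -!(mulrDr (rho v1)).
congr (v1 * (rho v1 * _)).
by rewrite !mulrA -!mulrDl rbsb mulrDl mul1r.
Qed.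

Variable (W : von_neumann M).
Hypotheses (Mfac : Defs.factor [set: M]) (nrho : normal_map rho)
  (irr : irreducible_endo rho) (D1 : 1 < D).

Let c := Num.sqrt (1 + D).
Let c0 : 0 < c. Proof. by rewrite sqrtr_gt0 addr_gt0. Qed.
Let c2 : c ^+ 2 = 1 + D. Proof. by rewrite sqr_sqrtr // ltW // addr_gt0. Qed.
Let cC0 : (c%:C : R[i]) != 0. Proof. by rewrite fmorph_eq0 gt_eqF. Qed.

Definition qiso := (c^-1)%:C *: r.
Local Notation p := qiso.

Let center x : (forall y, x * y = y * x) -> exists k : R[i], x = k%:A.
Proof. by move=> h; apply: Mfac => // y _. Qed.

Let sq_eq0 x : star x * x = 0 -> x = 0.
Proof.
move=> h; apply: (pi_inj (W := W)) => u; rewrite pi0.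
apply: (hilbert_eq0 (hilbert_vn W)).
by rewrite -qform_sq h /qform pi0 /rip (ip0l (hilbert_vn W)).
Qed.

Let scalar_eq0 (k : R[i]) x : k%:A * x = 0 -> x != 0 -> k = 0.
Proof.
rewrite -scalerAl mul1r => /eqP; rewrite scaler_eq0 => /orP[/eqP //|/eqP ->].
by rewrite eqxx.
Qed.

Let scalarC (k : R[i]) x : k%:A * x = x * k%:A.
Proof. by rewrite -scalerAl -scalerAr mul1r mulr1. Qed.

(** A nonzero [t] would be a multiple of a unitary, and so would [w = rho t * t], which intertwines
    id with [rho \o rho] as [a] does. Then [a] is a nonzero multiple of [w], so [star a * b = 0]
    gives [b = 0], contrary to [star b * b = D - 1 > 0]. *)
Lemma not_inner t : (forall x, t * x = rho x * t) -> t = 0.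
Proof.
move=> ht; apply/eqP; apply: contrapT => /negP t0.
have hts x : star t * rho x = x * star t.
  by rewrite -[x]starK rS -starM -ht starM starK.
have [k kE] : exists k : R[i], star t * t = k%:A.
  by apply: center => y; rewrite -mulrA ht !mulrA hts.
have [k' k'E] : exists k : R[i], t * star t = k%:A.
  by apply: irr => y; rewrite -mulrA hts !mulrA ht.
have k_n0 : k != 0.
  by apply: contraNneq t0 => h; apply/eqP/sq_eq0; rewrite kE h scale0r.
have kk : k = k'.
  apply/eqP; rewrite -subr_eq0; apply/eqP/(@scalar_eq0 _ t) => //.
  by rewrite scalerBl mulrBl -k'E -mulrA kE -scalarC subrr.
pose w := rho t * t.
have hw x : w * x = rho (rho x) * w.
  by rewrite /w -mulrA ht !mulrA -rM ht rM.
have ww : w * star w = (k * k)%:A.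
  rewrite /w starM !mulrA -(mulrA (rho t)) k'E -kk -scalarC -mulrA -rS -rM.
  by rewrite k'E -kk rZ r1 -scalerAl mul1r scalerA.
have [m mE] : exists m : R[i], star w * a = m%:A.
  apply: center => y; rewrite -mulrA aI !mulrA; congr (_ * _).
  by rewrite -{1}[y]starK (rS (star y)) (rS (rho _)) -starM -hw starM starK.
have aE : (k * k) *: a = m *: w.
  by rewrite -[a]mul1r scalerAl -ww -mulrA mE -scalerAr mulr1.
have kk0 : k * k != 0 by rewrite mulf_neq0.
have scal0 (z : R) : z != 0 -> (z%:C%:A : M) != 0.
  by move=> z0; rewrite scaler_eq0 oner_eq0 orbF fmorph_eq0.
have m0 : m != 0.
  apply/eqP => m0; move: aE; rewrite m0 scale0r => /eqP.
  rewrite scaler_eq0 (negPf kk0) /= => /eqP a0.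
  have := scal0 D; rewrite gt_eqF // -aa a0 mulr0 eqxx => /(_ isT) //.
have wb : star w * b = 0.
  have : star ((k * k) *: a) * b = 0 by rewrite starZ -scalerAl ab scaler0.
  rewrite aE starZ -scalerAl => /eqP; rewrite scaler_eq0 conjC_eq0 (negPf m0).
  by move/eqP.
have b0 : b = 0.
  have /eqP : (k * k)%:A * b = 0 by rewrite -ww -mulrA wb mulr0.
  by rewrite -scalerAl mul1r scaler_eq0 (negPf kk0) => /eqP.
have := scal0 (D - 1); rewrite subr_eq0 gt_eqF // -bb b0 mulr0 eqxx => /(_ isT) //.
Qed.

Lemma qiso_v0 : star v0 * p = (c^-1)%:C%:A.
Proof. by rewrite -scalerAr v0_qmult. Qed.

Lemma gam_v0_qiso : gam (star v0) * p = (c^-1)%:C%:A.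
Proof. by rewrite -scalerAr gam_v0_qmult. Qed.

Lemma qiso_isometry : Defs.isometry p.
Proof.
rewrite /Defs.isometry starZr -scalerAl -scalerAr qmult_norm !scalerA -!rmorphM /=.
have -> : c^-1 / c * (1 + D) = 1.
  by rewrite -c2 -invfM -expr2 mulVf // expf_neq0 // gt_eqF.
by rewrite rmorph1 scale1r.
Qed.

Lemma qiso_intertwiner x : p * gam x = gam (gam x) * p.
Proof. by rewrite -scalerAr -scalerAl qmult_intertwiner. Qed.

Let N := fixed_algebra gam p.

Lemma fixed_gam x : N (gam x).
Proof.
split; rewrite ?qiso_intertwiner // -(shomS sum_endo_hom).
exact: qiso_intertwiner.
Qed.

Let gamZ k x : gam (k *: x) = k *: gam x.
Proof. by case: (shom_additive sum_endo_hom). Qed.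

Lemma fixed_qiso : N p.
Proof.
split; rewrite ?starZr -!scalerAl -!scalerAr gamZ -!scalerAl.
  by rewrite qmult_assoc.
by rewrite qmult_frobenius.
Qed.

Let hgam := sum_endo_hom.
Let gM x y : gam (x * y) = gam x * gam y. Proof. exact: (shomM hgam). Qed.
Let gS x : gam (star x) = star (gam x). Proof. exact: (shomS hgam). Qed.
Let g1 : gam 1 = 1. Proof. exact: (shom1 hgam). Qed.

Lemma gam_v0_star x : star v0 * gam x = x * star v0.
Proof. by rewrite -[x]starK gS -starM gam_v0 starM starK. Qed.

(** Commuting with the range of [gam] makes the corner of [t] at [v0] scalar and, by [not_inner],
    kills the adjacent off-diagonal corner. Commuting with [qiso] as well transports this scalar to
    all of [t], because [star v0 * qiso] is a nonzero scalar. *)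
Lemma relative_commutant t : (forall x, N x -> t * x = x * t) ->
  exists k : R[i], t = k%:A.
Proof.
move=> ht.
have tg x : t * gam x = gam x * t by apply: ht; exact: fixed_gam.
have [k kE] : exists k : R[i], star v0 * t * v0 = k%:A.
  apply: center => y; rewrite -mulrA -gam_v0 !mulrA -(mulrA (star v0)) tg.
  by rewrite !mulrA gam_v0_star -!mulrA.
have t01 : star v0 * t * v1 = 0.
  rewrite -[LHS]starK; have -> : star (star v0 * t * v1) = 0; last by rewrite star0.
  apply: not_inner => x; rewrite -[x]starK rS -!starM; congr star.
  rewrite -[RHS]mulrA -gam_v1 !mulrA -(mulrA (star v0)) tg.
  by rewrite !mulrA gam_v0_star.
have v0t : star v0 * t = k *: star v0.
  rewrite -[LHS]mulr1 -v01 mulrDr !mulrA t01 kE mul0r addr0.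
  by rewrite -scalerAl mul1r.
exists k; have : star v0 * (t * p) = star v0 * (p * t) by rewrite ht //; exact: fixed_qiso.
rewrite !mulrA v0t qiso_v0 -scalerAl qiso_v0 -!scalerAl mul1r.
move=> /(congr1 (fun z => c%:C *: z)); rewrite !scalerA mulrAC -!rmorphM /=.
rewrite mulfV ?gt_eqF // rmorph1 scale1r => <-.
by rewrite mul1r.
Qed.

Let cc : c%:C * (c^-1)%:C = 1 :> R[i].
Proof. by rewrite -rmorphM /= mulfV ?gt_eqF // rmorph1. Qed.

(** The factor [star p * gam x] lies in [N], so this says [M = N v0]: a left [N]-linear map on [M]
    is determined by its value at [v0]. *)
Lemma reconstruct x : x = c%:C *: (star p * gam x * v0).
Proof.
have pv : star p * v0 = (c^-1)%:C%:A.
  by rewrite -[LHS]starK starM starK qiso_v0 star_alg conjC_real.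
by rewrite -mulrA gam_v0 mulrA pv -scalerAl mul1r scalerA cc scale1r.
Qed.

(** The isometry [Q] defines a conditional expectation [E] onto [N]. The trivial relative commutant
    makes [E v0] a multiple of [p], and [E 1 = 1] fixes the multiple, so [E x = star p * gam x * p]
    whatever the conjugate. The Pimsner-Popa inequality with constant [C^-2], tested at
    [v0 * star v0], where [E] takes the value [c^-2], gives the bound. *)
Lemma index_minimal ib Q P C : conjugate_eqns N ib Q P C -> 1 + D <= C ^+ 2.
Proof.
case=> [[hib _] ibN [NQ iQ Qint] [iP Pint] C0 PQ QP].
have ibM x y : ib (x * y) = ib x * ib y by exact: (shomM hib).
have ibS x : ib (star x) = star (ib x) by exact: (shomS hib).
pose E x := star Q * ib x * Q.
have NL := fixedL hgam (r := p); have NM := fixedM hgam (r := p).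
have NS := @fixedS _ _ gam p.
have NE x : N (E x).
  by apply: (NM) => //; apply: (NM); [exact: (NS)|exact: ibN].
have QintS n : N n -> star Q * ib n = n * star Q.
  by move=> Nn; rewrite -[n]starK ibS -starM -Qint ?starM ?starK //; exact: NS.
have El n x : N n -> E (n * x) = n * E x.
  by move=> Nn; rewrite /E ibM mulrA QintS // -!mulrA.
have Er n x : N n -> E (x * n) = E x * n.
  by move=> Nn; rewrite /E ibM -!mulrA -Qint // !mulrA.
have pint n : N n -> p * n = gam n * p by case.
have pintS n : N n -> star p * gam n = n * star p.
  by move=> Nn; rewrite -[n]starK gS -starM -pint ?starM ?starK //; exact: NS.
pose t := E v0.
have tn n : N n -> t * n = gam n * t.
  by move=> Nn; rewrite -Er // -gam_v0 El //; exact: fixed_gam.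
have [m mE] : exists m : R[i], star v0 * t = m%:A.
  apply: relative_commutant => n Nn; rewrite -mulrA tn // mulrA gam_v0_star.
  by rewrite mulrA.
have gvp : star p * gam v0 = (c^-1)%:C%:A.
  by rewrite -[LHS]starK starM starK -gS gam_v0_qiso star_alg conjC_real.
have tE : t = (c%:C * m) *: p.
  have : star p * (gam v0 * gam (star v0)) * p * t = (c^-1)%:C *: (m *: p).
    have -> : star p * (gam v0 * gam (star v0)) * p * t =
        star p * gam v0 * (gam (star v0 * t) * p).
      by rewrite gM -!mulrA pint //; exact: NE.
    by rewrite mE gamZ g1 gvp -!scalerAl !mul1r.
  rewrite mulrA gvp -(mulrA _ (gam _)) gam_v0_qiso -!scalerAl !mul1r.
  have ci0 : (c^-1)%:C != 0 :> R[i] by rewrite fmorph_eq0 invr_eq0 gt_eqF.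
  move=> /(scalerI ci0); rewrite -scalerAl mul1r => h.
  transitivity (c%:C *: ((c^-1)%:C *: t)); first by rewrite scalerA cc scale1r.
  by rewrite h [LHS]scalerA.
have EE x : E x = (c%:C * (c%:C * m)) *: (star p * gam x * p).
  have Nx : N (star p * gam x) by apply: NM; [exact/NS/fixed_qiso|exact: fixed_gam].
  have EZ k y : E (k *: y) = k *: E y.
    by case: (shom_additive hib) => _ _ ibZ; rewrite /E ibZ -scalerAr -scalerAl.
  by rewrite {1}(reconstruct x) EZ El // -/t tE -scalerAr scalerA.
have k1 : c%:C * (c%:C * m) = 1.
  have := EE 1; rewrite /E (shom1 hib) g1 !mulr1 iQ.
  have -> : star p * p = 1 := qiso_isometry.
  move=> /eqP; rewrite -[X in X == _]scale1r -subr_eq0 -scalerBl scaler_eq0.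
  by rewrite oner_eq0 orbF subr_eq0 => /eqP.
have Evv : E (v0 * star v0) = (c^-1 * c^-1)%:C%:A.
  rewrite EE k1 scale1r gM mulrA gvp -scalerAl mul1r -scalerAl gam_v0_qiso.
  by rewrite scalerA -rmorphM.
have C_n0 : C != 0 by rewrite gt_eqF.
(* [z] is the defect in the Pimsner-Popa inequality: removing the range projection of [P] subtracts
   exactly the contribution [C^-2], so [star z * z] is the scalar [c^-2 - C^-2]. *)
pose Y := ib (star v0) * Q; pose z := (1 - P * star P) * (Y * v0).
have iP' : star P * P = 1 := iP.
have proj : star (1 - P * star P) * (1 - P * star P) = 1 - P * star P.
  rewrite starB star1 starM starK mulrBl mul1r mulrBr mulr1.
  by rewrite -!mulrA (mulrA (star P)) iP' mul1r subrr subr0.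
have QibP x : star Q * ib x * P = (C^-1)%:C *: x.
  rewrite -mulrA -Pint mulrA.
  have -> : star Q * P = (C^-1)%:C%:A.
    by rewrite -[LHS]starK starM starK PQ star_alg conjC_real.
  by rewrite -scalerAl mul1r.
have PibQ x : star P * (ib x * Q) = (C^-1)%:C *: x.
  by apply: (can_inj (@starK _ _)); rewrite !starM starK starZr -ibS QibP.
have iv : star v0 * v0 = 1 := i0.
have zz : star z * z = (c^-1 * c^-1 - C^-1 * C^-1)%:C%:A.
  have -> : star z * z = star v0 * (E (v0 * star v0) - (star Q * ib v0 * P) * (star P * (ib (star v0) * Q))) * v0.
    have -> : star z * z = star v0 * (star Y * (1 - P * star P) * Y) * v0.
      by rewrite /z !starM -!mulrA (mulrA (star (1 - _))) proj.
    have -> : star Y * (1 - P * star P) * Y = star Y * Y - star Y * P * (star P * Y).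
      by rewrite mulrBr mulr1 mulrBl !mulrA.
    have YS : star Y = star Q * ib v0 by rewrite starM -ibS starK.
    by rewrite YS /E ibM !mulrA.
  rewrite Evv QibP PibQ -scalerAl -scalerAr scalerA mulrBr mulrBl.
  rewrite -scalerAr mulr1 -scalerAl iv -scalerAr -scalerAl mulrA iv mul1r iv.
  by rewrite -scalerBl -!rmorphM -rmorphB.
have := @positive_scalar _ _ W (c^-1 * c^-1 - C^-1 * C^-1).
move=> /(_ _); rewrite -zz => /(_ (ex_intro _ z erefl)).
rewrite subr_ge0 -!invfM -!expr2 lef_pV2 ?posrE ?exprn_gt0 //.
by rewrite c2.
Qed.

Lemma qsystem_subfactor : exists (N : set M) (ib : M -> M),
  [/\ subfactor W N, has_index N (1 + D), conjugate_inclusion N ib &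
      direct_sum_endo ib id rho].
Proof.
have hid : star_hom (id : M -> M) by split.
have nid : normal_map (id : M -> M).
  by move=> B x _ hx; rewrite image_id.
have gn : normal_map gam.
  by apply: (normal_sum_endo W hid nid hrho nrho hgam (v0 := v0) (v1 := v1)) => x.
have ce : conjugate_eqns N gam p v0 c.
  split=> //.
  - exact: fixed_gam.
  - by split; [exact: fixed_qiso|exact: qiso_isometry|move=> x []].
  - by split=> // x; rewrite gam_v0.
  - exact: qiso_v0.
  - by rewrite -[LHS]starK starM starK -gS gam_v0_qiso star_alg conjC_real.
exists N, gam; split.
- split.
  + exact: fixed1.
  + by move=> k x y; exact: fixedL.
  + by move=> x y; exact: fixedM.
  + by move=> x; exact: fixedS.
  + exact: fixed_bicommutant.
  + by move=> x Nx hx; apply: relative_commutant => y; exact: hx.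
- split; first by exists gam, p, v0, c.
  by move=> ib Q P C; exact: index_minimal.
- by exists p, v0, c.
- by exists v0, v1; split.
Qed.

End QSystem.

(** * Realizations *)

Section Schur.
Variables (R : realType) (M : starAlgType R) (W : von_neumann M).
Implicit Types (f g : M -> M) (t x : M).

Lemma star_mul_eq0 x : star x * x = 0 -> x = 0.
Proof.
move=> h; apply: (pi_inj (W := W)) => u; rewrite pi0.
apply: (hilbert_eq0 (hilbert_vn W)).
by rewrite -qform_sq h /qform pi0 /rip (ip0l (hilbert_vn W)).
Qed.

(** Compress the completeness relation by [V j]: the term of index [j] already equals 1, so the
    other terms, which are positive, must vanish. *)
Lemma isometries_orthogonal (I : finType) (V : I -> M) :
  (forall i, Defs.isometry (V i)) -> \sum_i V i * star (V i) = 1 ->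
  forall i j, i != j -> star (V i) * V j = 0.
Proof.
move=> Vi V1 i j ij; apply: (pi_inj (W := W)) => u; rewrite pi0.
apply: (hilbert_eq0 (hilbert_vn W)); apply/eqP.
rewrite eq_le (nsq_ge0 (hilbert_vn W)) andbT.
have h : star (V j) * (\sum_k V k * star (V k)) * V j = 1.
  by rewrite V1 mulr1 Vi.
have := congr1 (fun x => qform x u) h.
rewrite qform1 mulr_sumr mulr_suml (bigD1 j) //= (bigD1 i) //= !qformD.
have -> : star (V j) * (V j * star (V j)) * V j = 1.
  by rewrite !mulrA Vi mul1r Vi.
have sq k : star (V j) * (V k * star (V k)) * V j = star (star (V k) * V j) * (star (V k) * V j).
  by rewrite starM starK !mulrA.
rewrite sq qform_sq qform1.
have : 0 <= qform (\sum_(k | (k != j) && (k != i)) star (V j) * (V k * star (V k)) * V j) u.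
  have : qpos W (\sum_(k | (k != j) && (k != i)) star (V j) * (V k * star (V k)) * V j).
    by apply: qpos_sum => k _; rewrite sq; exact: qpos_sq.
  by case.
lra.
Qed.

Lemma intertwiner_star f g t : star_hom f -> star_hom g ->
  intertwiner f g t -> intertwiner g f (star t).
Proof.
move=> hf hg ht x; rewrite -[x]starK (shomS hf) (shomS hg) -!starM.
by rewrite -ht.
Qed.

(** Both products of [t] with its adjoint are self-intertwiners, hence scalars; they agree because
    [t * (star t * t) = (t * star t) * t]. *)
Lemma schur f g t : star_hom f -> star_hom g -> irreducible_endo f ->
  irreducible_endo g -> intertwiner f g t -> t != 0 ->
  exists2 k : R, 0 < k & star t * t = k%:C%:A /\ t * star t = k%:C%:A.
Proof.
move=> hf hg irf irg ht t0; have hts := intertwiner_star hf hg ht.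
have [k kE] : exists k : R[i], star t * t = k%:A.
  by apply: irf => x; rewrite -mulrA ht mulrA hts mulrA.
have [k' k'E] : exists k : R[i], t * star t = k%:A.
  by apply: irg => x; rewrite -mulrA hts mulrA ht mulrA.
have k_n0 : k != 0.
  by apply: contraNneq t0 => h; apply/eqP/star_mul_eq0; rewrite kE h scale0r.
have kk : k = k'.
  have /eqP : (k - k') *: t = 0.
    rewrite scalerBl -[in X in X - _](mulr1 t) -[in X in _ - X](mul1r t).
    by rewrite (scalerAr k t 1) (scalerAl k' 1 t) -k'E -kE mulrA subrr.
  by rewrite scaler_eq0 (negPf t0) orbF subr_eq0 => /eqP.
have kc : k^* = k.
  have : star (star t * t) = star t * t by rewrite starM starK.
  rewrite kE star_alg => /eqP; rewrite -subr_eq0 -scalerBl scaler_eq0.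
  by rewrite oner_eq0 orbF subr_eq0 => /eqP.
have kR : k = (complex.Re k)%:C.
  move: kc; case: k {kE k_n0 kk} => a b [] /= h.
  by congr (_ +i* _); lra.
exists (complex.Re k); last by rewrite -kR kE k'E -kk.
have k0 : 0 <= complex.Re k.
  by apply: (positive_scalar W); rewrite -kR -kE; exists t.
rewrite lt_def k0 andbT; apply: contraNneq k_n0 => h.
by rewrite kR h.
Qed.

End Schur.

Section Realization.
Variables (R : realType) (G : finZmodType) (M : starAlgType R).
Variables (W : von_neumann M) (al : G -> M -> M) (rho : M -> M) (S : M).
Variables (T : G -> M) (s : datum R G).
Hypotheses (Mfac : Defs.factor [set: M]) (hr : realizes al rho S T s).
Implicit Types (x y t : M) (g h k : G).

Let hal g : star_hom (al g).
Proof. by case: (real_outer hr) => ha _; exact: action_hom. Qed.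
Let hrho : star_hom rho := real_hom hr.
Let al0 x : al 0 x = x.
Proof. by case: (real_outer hr) => ha _; exact: action0. Qed.
Let alD g h x : al (g + h) x = al g (al h x).
Proof. by case: (real_outer hr) => ha _; exact: actionD. Qed.
Let alK g x : al g (al (- g) x) = x.
Proof. by rewrite -alD subrr al0. Qed.
Let alKV g x : al (- g) (al g x) = x.
Proof. by rewrite -alD addNr al0. Qed.
Let alM g x y : al g (x * y) = al g x * al g y. Proof. exact: (shomM (hal g)). Qed.
Let alS g x : al g (star x) = star (al g x). Proof. exact: (shomS (hal g)). Qed.
Let al00 g : al g 0 = 0. Proof. by case: (shom_additive (hal g)). Qed.

Lemma real_S1 : star S * S = 1. Proof. by case: (real_S hr). Qed.
Lemma real_Sint x : S * x = rho (rho x) * S.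
Proof. by case: (real_S hr) => _ /(_ x). Qed.
Lemma real_T1 g : star (T g) * T g = 1. Proof. by case: (real_T hr g). Qed.
Lemma real_Tint g x : T g * al g (rho x) = rho (rho x) * T g.
Proof. by case: (real_T hr g) => _ /(_ x). Qed.

Let V (o : option G) : M := if o is Some g then T g else S.

Let V_orth o o' : o != o' -> star (V o) * V o' = 0.
Proof.
apply: (isometries_orthogonal W); first by case=> [g|]; [exact: real_T1|exact: real_S1].
rewrite (bigD1 None) //= (reindex_omap Some id) /=; last by case.
rewrite -[RHS](real_sum hr); congr (_ + _); apply: eq_bigl => g.
by rewrite eqxx.
Qed.

Lemma real_ST g : star S * T g = 0. Proof. exact: (@V_orth None (Some g)). Qed.
Lemma real_TS g : star (T g) * S = 0. Proof. exact: (@V_orth (Some g) None). Qed.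
Lemma real_TT g h : star (T g) * T h = (g == h)%:R.
Proof.
have [->|gh] := eqVneq g h; first exact: real_T1.
by apply: (@V_orth (Some g) (Some h)); apply: contra gh => /eqP[->].
Qed.

Lemma irreducible_id : irreducible_endo (id : M -> M).
Proof. by move=> t ht; apply: Mfac => // y _; exact: ht. Qed.

Lemma irreducible_al_comp g f : irreducible_endo f -> irreducible_endo (al g \o f).
Proof.
move=> irf t ht; have [k kE] : exists k : R[i], al (- g) t = k%:A.
  by apply: irf => x; have /= := congr1 (al (- g)) (ht x); rewrite !alM alKV.
exists k; rewrite -[t](alK g) kE.
by case: (shom_additive (hal g)) => _ _ ->; rewrite (shom1 (hal g)).
Qed.

Let hcomp g : star_hom (al g \o rho).
Proof.
split=> [c x y||x y|x] /=.
- by rewrite (shom_lin hrho) (shom_lin (hal g)).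
- by rewrite (shom1 hrho) (shom1 (hal g)).
- by rewrite (shomM hrho) alM.
- by rewrite (shomS hrho) alS.
Qed.

Lemma intertwiner_al_id g t : g != 0 -> intertwiner (al g) id t -> t = 0.
Proof.
move=> g0 ht; apply/eqP; apply: contrapT => /negP t0.
have hid : star_hom (id : M -> M) by split.
have ir : irreducible_endo (al g) by exact: (irreducible_al_comp (g := g) irreducible_id).
have [k k0 [tt tts]] := schur W (hal g) hid ir irreducible_id ht t0.
have [_ /(_ g g0) no] := real_outer hr; apply: no.
have kC : ((Num.sqrt k)^-1)%:C * ((Num.sqrt k)^-1)%:C * k%:C = 1 :> R[i].
  rewrite -!rmorphM /= -invfM -expr2 sqr_sqrtr ?ltW // mulVf ?gt_eqF //.
exists (((Num.sqrt k)^-1)%:C *: star t).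
  by split; rewrite !starZr starK -scalerAl -scalerAr ?tt ?tts !scalerA kC scale1r.
move=> x; rewrite starZr starK -!scalerAl -scalerAr scalerA -mulrA -ht mulrA tt.
by rewrite -scalerAl mul1r scalerA kC scale1r.
Qed.

(** Otherwise some [t'] intertwines an automorphism with [rho] and is a multiple of a unitary. Then
    [S] is a multiple of a unitary too, up to the factor [y], and orthogonality to [S] leaves no
    room for the isometry [T 0]. *)
Lemma intertwiner_al_rho g h t : intertwiner (al g) (al h \o rho) t -> t = 0.
Proof.
move=> ht; apply/eqP; apply: contrapT => /negP t0.
pose t' := al (- h) t; pose k := g - h.
have ht' x : t' * al k x = rho x * t'.
  have /= := congr1 (al (- h)) (ht x).
  by rewrite !alM alKV -alD addrC.
have t'0 : t' != 0.
  by apply: contraNneq t0 => e; rewrite -[t](alK h) -/t' e al00.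
have hid : star_hom (id : M -> M) by split.
have irk j : irreducible_endo (al j).
  exact: (irreducible_al_comp (g := j) irreducible_id).
have [c c0 [tt tts]] := schur W (hal k) hrho (irk k) (real_irr hr) ht' t'0.
have hst := intertwiner_star (hal k) hrho ht'.
pose y := al k (star t') * (star t' * S).
have hy : intertwiner id (al (k + k)) y.
  move=> x; rewrite /= /y -!mulrA real_Sint (mulrA (star t')) hst alD.
  by rewrite -!mulrA mulrA -alM hst alM -mulrA.
have cc (z : M) : c%:C%:A * z = c%:C *: z by rewrite -scalerAl mul1r.
have akc : al k c%:C%:A = c%:C%:A.
  by case: (shom_additive (hal k)) => _ _ ->; rewrite (shom1 (hal k)).
have cC0 : (c%:C : R[i]) != 0 by rewrite fmorph_eq0 gt_eqF.
have Sy : t' * al k t' * y = (c * c)%:C *: S.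
  rewrite /y -!mulrA (mulrA (al k t')) -alM tts akc cc -scalerAr mulrA tts cc.
  by rewrite scalerA -rmorphM.
have S0 : S != 0.
  apply/eqP => e; have := real_S1; rewrite e mulr0 => /esym/eqP.
  by rewrite oner_eq0.
have y0 : y != 0.
  apply: contraNneq S0 => e; move: Sy; rewrite e mulr0 => /esym/eqP.
  by rewrite scaler_eq0 fmorph_eq0 mulf_eq0 gt_eqF.
have [d d0 [_ yys]] := schur W hid (hal (k + k)) irreducible_id (irk (k + k)) hy y0.
have TS0 : star (T 0) * (t' * al k t') = 0.
  have : star (T 0) * (t' * al k t' * y) * star y = 0.
    by rewrite Sy -scalerAr real_TS scaler0 mul0r.
  have -> : star (T 0) * (t' * al k t' * y) * star y =
    star (T 0) * (t' * al k t') * (y * star y) by rewrite !mulrA.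
  rewrite yys -scalerAr mulr1 => /eqP.
  by rewrite scaler_eq0 fmorph_eq0 gt_eqF //= => /eqP.
have : star (T 0) * (t' * al k t') * (al k (star t') * star t') = 0.
  by rewrite TS0 mul0r.
rewrite -!mulrA (mulrA (al k t')) -alM tts akc cc -!scalerAr tts -scalerAr mulr1.
rewrite scalerA => /eqP; rewrite scaler_eq0 mulf_eq0 !(negPf cC0) /= => /eqP e.
by have := real_T1 0; rewrite e mul0r => /esym/eqP; rewrite oner_eq0.
Qed.

(** The product [t * S] intertwines [al g] with [rho \o rho]. Its components along [S] and all [T h]
    vanish by the two preceding lemmas, so [t * S = 0], which contradicts that [t] is a multiple of
    a unitary. *)
Lemma intertwiner_al_rho_rho g t : g != 0 -> intertwiner (al g \o rho) rho t ->
  t = 0.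
Proof.
move=> g0 ht; apply/eqP; apply: contrapT => /negP t0.
have [k k0 [tt _]] := schur W (hcomp g) hrho (irreducible_al_comp (g := g) (real_irr hr)) (real_irr hr) ht t0.
have htS x : t * S * al g x = rho (rho x) * (t * S).
  rewrite -mulrA -{1}(real_alS hr g) -alM real_Sint alM (real_alS hr).
  by rewrite mulrA ht mulrA.
have S0 : star S * (t * S) = 0.
  apply: (intertwiner_al_id g0) => x /=; rewrite -mulrA htS !mulrA.
  congr (_ * _ * _); have := real_Sint (star x).
  move=> /(congr1 star); rewrite !starM starK (shomS hrho) (shomS hrho) starK.
  by move=> ->.
have T0 h : star (T h) * (t * S) = 0.
  apply: (@intertwiner_al_rho g h) => x /=; rewrite -mulrA htS !mulrA.
  congr (_ * _ * _); have := real_Tint h (star x).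
  by move=> /(congr1 star); rewrite !starM !(shomS hrho) alS !starK => ->.
have tS0 : t * S = 0.
  rewrite -[LHS]mul1r -(real_sum hr) mulrDl mulr_suml -mulrA S0 mulr0 add0r.
  by rewrite big1 // => h _; rewrite -mulrA T0 mulr0.
have : star t * (t * S) = 0 by rewrite tS0 mulr0.
rewrite mulrA tt -scalerAl mul1r => /eqP; rewrite scaler_eq0 fmorph_eq0 gt_eqF //=.
move/eqP => S_0; have := real_S1; rewrite S_0 mulr0 => /esym/eqP.
by rewrite oner_eq0.
Qed.

Hypothesis Pd : 1 < gdim R G.
Let d := gdim R G.
Let d0 : 0 < d. Proof. exact: lt_trans ltr01 Pd. Qed.
Let sd := Num.sqrt d.
Let sd0 : 0 < sd. Proof. by rewrite sqrtr_gt0. Qed.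
Let sdC0 : (sd%:C : R[i]) != 0. Proof. by rewrite fmorph_eq0 gt_eqF. Qed.
Let sdd : sd%:C * sd%:C = d%:C :> R[i].
Proof. by rewrite -rmorphM -expr2 sqr_sqrtr ?ltW. Qed.

Lemma real_rhoS_S : star S * rho S = (d^-1)%:C%:A.
Proof.
rewrite (real_rhoS hr) mulrDr -!scalerAr real_S1 mulr_sumr big1 ?scaler0 ?addr0 //.
by move=> g _; rewrite mulrA real_ST mul0r.
Qed.

Lemma real_rhoS_T g : star (T g) * rho S = (sd^-1)%:C *: T g.
Proof.
rewrite (real_rhoS hr) mulrDr -!scalerAr real_TS scaler0 add0r mulr_sumr.
rewrite (bigD1 g) //= big1 => [|h hg]; first by rewrite mulrA real_T1 mul1r addr0.
by rewrite mulrA real_TT eq_sym (negPf hg) mul0r.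
Qed.

Hypotheses (eta0 : eta s (0 : G) = 1) (Psol : is_solution s)
  (special : forall h, coef s 0 h 0 = kron R h 0 - ((d - 1)^-1)%:C).

Let rhoT0 : rho (T 0) = T 0 * S * star S + (sd^-1)%:C *: (S * star (T 0)) +
  \sum_h \sum_k coef s 0 h k *: (T h * T (h + k) * star (T k)).
Proof.
rewrite -[LHS]al0 (real_rhoT hr) eta0 scale1r conjC1 mul1r -fmorphV.
congr (_ + _ + _); apply: eq_bigr => h _; apply: eq_bigr => k _.
by rewrite !add0r.
Qed.

Let rhoT0S : rho (T 0) * S = T 0 * S.
Proof.
rewrite rhoT0 !mulrDl -!mulrA real_S1 mulr1 -scalerAl -mulrA real_TS mulr0 scaler0.
rewrite addr0 mulr_suml big1 ?addr0 // => h _; rewrite mulr_suml big1 // => k _.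
by rewrite -scalerAl -(mulrA _ (star _)) real_TS mulr0 scaler0.
Qed.

Let rhoT0T : rho (T 0) * T 0 = (sd^-1)%:C *: S + \sum_h coef s 0 h 0 *: (T h * T h).
Proof.
rewrite rhoT0 !mulrDl -!mulrA real_ST !mulr0 add0r -scalerAl -mulrA real_T1 mulr1.
congr (_ + _); rewrite mulr_suml; apply: eq_bigr => h _.
rewrite mulr_suml (bigD1 0) //= big1 => [|k k0].
  by rewrite -scalerAl -(mulrA _ (star _)) real_T1 mulr1 !addr0.
by rewrite -scalerAl -(mulrA _ (star _)) real_TT (negPf k0) mulr0 scaler0.
Qed.

Let STrhoT0 : star S * rho (T 0) = (sd^-1)%:C *: star (T 0).
Proof.
rewrite rhoT0 !mulrDr !mulrA real_ST !mul0r add0r -scalerAr mulrA real_S1 mul1r.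
rewrite mulr_sumr big1 ?addr0 // => h _; rewrite mulr_sumr big1 // => k _.
by rewrite -scalerAr !mulrA real_ST !mul0r scaler0.
Qed.

Let TTrhoT0 : star (T 0) * rho (T 0) = S * star S + \sum_k coef s 0 0 k *: (T k * star (T k)).
Proof.
rewrite rhoT0 !mulrDr !mulrA real_T1 mul1r -scalerAr mulrA real_TS mul0r scaler0 addr0.
congr (_ + _); rewrite mulr_sumr (bigD1 0) //= [X in _ + X]big1 => [|h h0].
  rewrite addr0 mulr_sumr; apply: eq_bigr => k _.
  by rewrite -scalerAr !mulrA real_T1 mul1r add0r.
rewrite mulr_sumr big1 // => k _.
by rewrite -scalerAr !mulrA real_TT eq_sym (negPf h0) !mul0r scaler0.
Qed.

Lemma special_subfactor : normal_map rho -> exists (N : set M) (ib : M -> M),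
  [/\ subfactor W N, has_index N (1 + d), conjugate_inclusion N ib &
      direct_sum_endo ib id rho].
Proof.
move=> nrho.
have [v1 i1 v1v1] := complement_isometry W (real_S1 : Defs.isometry S) (real_T1 0) (real_ST 0).
have d1 : 0 < d - 1 by rewrite subr_gt0.
pose e := (Num.sqrt (d - 1))%:C : R[i].
have ee : e * e = (d - 1)%:C by rewrite -rmorphM -expr2 sqr_sqrtr ?ltW.
have d1C : ((d - 1)%:C : R[i]) != 0 by rewrite fmorph_eq0 gt_eqF.
have rZ (k : R[i]) x : rho (k *: x) = k *: rho x by case: (shom_additive hrho).
have rD x y : rho (x + y) = rho x + rho y by case: (shom_additive hrho).
have sdV : sd%:C * (sd^-1)%:C = 1 :> R[i] by rewrite -rmorphM mulfV ?gt_eqF.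
have TT0 : star (T 0) * rho (T 0) = star (rho (star (T 0)) * T 0).
  by rewrite starM (shomS hrho) starK.
have sp h : (d - 1)%:C * coef s 0 h 0 = (h == 0)%:R * (d - 1)%:C - 1.
  rewrite special mulrBr -[X in _ - X]rmorphM mulfV ?gt_eqF // rmorph1 /kron.
  by rewrite mulrC.
have spC h : (coef s 0 0 h)^* = coef s 0 h 0 by rewrite -sol_P6.
apply: (@qsystem_subfactor _ _ S v1 rho (sd%:C *: S) (e *: T 0) d hrho
  (real_S1 : Defs.isometry S) i1 _ _ _ _ _ _ _ _ _ _ _ _ _ W Mfac nrho (real_irr hr) Pd) => //.
- by rewrite v1v1 addrC subrK.
- by move=> x; rewrite -scalerAl -scalerAr real_Sint.
- by move=> x; rewrite -scalerAl -scalerAr -real_Tint al0.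
- by rewrite starZr -scalerAl -scalerAr real_S1 scalerA sdd.
- by rewrite starZr -scalerAl -scalerAr real_T1 scalerA ee.
- by rewrite starZr -scalerAl -scalerAr real_ST !scaler0.
- by rewrite rZ -!scalerAl -!scalerAr rhoT0S.
- rewrite !rZ -!scalerAl -!scalerAr !scalerA ee rhoT0T (real_rhoS hr).
  rewrite !scalerDr !scalerA sdV scale1r scaler_sumr.
  (* The constant part of the special row contributes [- \sum_g T g * T g], which cancels the
     corresponding sum in [rho S]; the two coefficients of [S] add up to [sd]. *)
  rewrite [X in _ = _ + (_ + X)](_ : _ = (d - 1)%:C *: (T 0 * T 0) - \sum_g T g * T g).
    have -> : sd%:C * (d^-1)%:C = (sd^-1)%:C :> R[i].
      apply: (mulIf sdC0); rewrite mulrAC sdd [RHS]mulrC sdV -rmorphM.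
      by rewrite mulfV ?gt_eqF.
    rewrite addrACA -scalerDl.
    have -> : (sd^-1)%:C + (d - 1)%:C * (sd^-1)%:C = sd%:C :> R[i].
      rewrite -{1}[(sd^-1)%:C]mul1r -mulrDl -(rmorph1 (real_complex R)) -rmorphD addrC subrK.
      transitivity (sd%:C * sd%:C * (sd^-1)%:C : R[i]); first by rewrite sdd.
      by rewrite -mulrA sdV mulr1.
    by rewrite (addrC (\sum_g _)) subrK.
  rewrite (eq_bigr (fun h => ((h == 0)%:R * (d - 1)%:C) *: (T h * T h) - T h * T h)); last first.
    by move=> h _; rewrite scalerA sp scalerBl scale1r.
  rewrite sumrB (bigD1 0) //= big1 ?addr0 ?eqxx ?mul1r // => h /negPf ->.
  by rewrite mul0r scale0r.
- by rewrite (shomS hrho) rZ starZr -scalerAl -scalerAr -[_ * S]starK starM starK real_rhoS_S star_alg conjC_real !scalerA sdd -rmorphM mulfV ?gt_eqF // rmorph1 scale1r.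
- rewrite (shomS hrho) rZ !starZr -scalerAl -scalerAr -[_ * T 0]starK starM starK.
  by rewrite real_rhoS_T starZr !scalerA mulrAC sdV mul1r.
- rewrite (shomS hrho) rZ !starZr -scalerAl -scalerAr -[_ * S]starK starM starK.
  by rewrite STrhoT0 starZr starK !scalerA -mulrA sdV mulr1.
(* By [sp] the sum over [h] becomes [(d - 1) T_0 star T_0] minus all range projections of the [T h],
   and the completeness relation turns the latter into [S * star S - 1]. *)
- rewrite (shomS hrho) rZ !starZr -!scalerAl -!scalerAr !scalerA sdd ee.
  rewrite -[star (rho _) * _]starK starM starK TTrhoT0 starD starM starK scalerDr.
  rewrite star_sum scaler_sumr (eq_bigr (fun h => ((h == 0)%:R * (d - 1)%:C) *: (T h * star (T h)) - T h * star (T h))); last first.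
    by move=> h _; rewrite starZ starM starK spC scalerA sp scalerBl scale1r.
  rewrite sumrB (bigD1 0) //= big1 ?addr0 => [|h /negPf ->]; last first.
    by rewrite mul0r scale0r.
  rewrite eqxx mul1r -(real_sum hr).
  have -> : d%:C = 1 + (d - 1)%:C :> R[i].
    by rewrite -(rmorph1 (real_complex R)) -rmorphD addrC subrK.
  rewrite scalerDl scale1r -!addrA; congr (_ + _).
  by rewrite [RHS]addrC -addrA subrK.
Qed.

End Realization.

(** * Crossed products *)

Section CrossedMonomials.
Variables (R : realType) (G : finZmodType) (M : starAlgType R).
Variable al : action G M.
Implicit Types (a b : M) (g h k : G) (X : crossed al).

(* The element [a * lambda_g] of the crossed product. *)
Definition mono a g : crossed al := [ffun k => if k == g then a else 0].

Let hal g : star_hom (al g) := action_hom (actP al) g.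
Let al00 g : al g 0 = 0. Proof. by case: (shom_additive (hal g)). Qed.

Lemma mono_sum X : X = \sum_g mono (cfam X g) g.
Proof.
apply/ffunP => k; rewrite sum_ffunE (bigD1 k) //= ffunE eqxx big1 ?addr0 //.
by move=> g gk; rewrite ffunE eq_sym (negPf gk).
Qed.

Lemma mono_inj g a b : mono a g = mono b g -> a = b.
Proof. by move=> /ffunP/(_ g); rewrite !ffunE eqxx. Qed.

Lemma mono0 g : mono 0 g = 0.
Proof. by apply/ffunP => k; rewrite !ffunE if_same. Qed.

Lemma mono1 : mono 1 0 = 1.
Proof. by apply/ffunP => k; rewrite !ffunE; case: eqP. Qed.

Lemma monoD g : {morph mono^~ g : a b / a + b}.
Proof. by move=> a b; apply/ffunP => k; rewrite !ffunE; case: eqP; rewrite ?addr0. Qed.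

Lemma monoZ g (c : R[i]) a : mono (c *: a) g = c *: mono a g.
Proof. by apply/ffunP => k; rewrite !ffunE; case: eqP; rewrite ?scaler0. Qed.

Lemma mono_bigsum g (I : finType) (P : pred I) (F : I -> M) :
  mono (\sum_(i | P i) F i) g = \sum_(i | P i) mono (F i) g.
Proof. exact: (big_morph (mono^~ g) (monoD g) (mono0 g)). Qed.

Lemma mono_coefM a g X k : cfam (mono a g * X) k = a * al g (cfam X (k - g)).
Proof.
rewrite /cfam ffunE (bigD1 g) //= big1 ?addr0 => [|h hg]; first by rewrite /cfam ffunE eqxx.
by rewrite /cfam ffunE (negPf hg) mul0r.
Qed.

Lemma mono_coefMr a g X k : cfam (X * mono a g) k = cfam X (k - g) * al (k - g) a.
Proof.
rewrite /cfam ffunE (bigD1 (k - g)) //= big1 ?addr0 => [|h hg].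
  by rewrite /cfam ffunE subKr eqxx.
have /negbTE kh : k - h != g by apply: contra hg => /eqP <-; rewrite subKr.
by rewrite /cfam ffunE kh al00 mulr0.
Qed.

Lemma monoM a g b h : mono a g * mono b h = mono (a * al g b) (g + h).
Proof.
apply/ffunP => k; have := mono_coefM a g (mono b h) k; rewrite /cfam => ->.
by rewrite !ffunE subr_eq [h + g]addrC; case: eqP; rewrite ?al00 ?mulr0.
Qed.

Lemma star_mono a g : star (mono a g) = mono (al (- g) (star a)) (- g).
Proof.
apply/ffunP => k; rewrite !ffunE eqr_oppLR; case: eqP => [->|_] //=.
by rewrite star0 al00.
Qed.

Lemma extend_mono (rho : M -> M) a g : star_hom rho ->
  crossed_extend rho (mono a g) = mono (rho a) (- g) :> crossed al.
Proof.
move=> hrho; apply/ffunP => k; rewrite !ffunE eqr_oppLR.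
by case: eqP => //; case: (shom_additive hrho).
Qed.

Lemma dual_mono (chi : G -> R[i]) a g :
  crossed_dual chi (mono a g) = mono (chi g *: a) g.
Proof. by apply/ffunP => k; rewrite !ffunE; case: eqP => [->|]; rewrite ?scaler0. Qed.

Lemma extend_lin (rho : M -> M) : star_hom rho -> forall (c : R[i]) X Y,
  crossed_extend rho (c *: X + Y) = c *: crossed_extend rho X + crossed_extend rho Y.
Proof.
by move=> hrho c X Y; apply/ffunP => k; rewrite !ffunE -(shom_lin hrho) /cfam ?ffunE.
Qed.

Lemma dual_lin (chi : G -> R[i]) (c : R[i]) X Y :
  crossed_dual chi (c *: X + Y) = c *: crossed_dual chi X + crossed_dual chi Y.
Proof.
apply/ffunP => k; rewrite !ffunE /cfam ?ffunE scalerDr !scalerA.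
by rewrite mulrC.
Qed.

Lemma extend_hom (rho : M -> M) : star_hom rho ->
  (forall g a, al g (rho a) = rho (al (- g) a)) ->
  star_hom (@crossed_extend R G M al rho).
Proof.
move=> hrho comm; split; first exact: extend_lin.
- by rewrite -mono1 extend_mono // (shom1 hrho) oppr0.
- move=> X Y; apply/ffunP => k; rewrite !ffunE.
  have [rho0 rhoD _] := shom_additive hrho.
  rewrite (big_morph rho rhoD rho0) [RHS](reindex_inj oppr_inj) /=.
  apply: eq_bigr => h _; rewrite (shomM hrho) /cfam !ffunE opprK.
  by rewrite comm opprK /cfam opprD addrC.
- move=> X; apply/ffunP => k; rewrite !ffunE.
  by rewrite -comm (shomS hrho).
Qed.

Lemma dual_hom (chi : G -> R[i]) : chi 0 = 1 ->
  (forall g h, chi (g + h) = chi g * chi h) -> (forall g, (chi (- g))^* = chi g) ->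
  star_hom (@crossed_dual R G M al chi).
Proof.
move=> chi0 chiD chiN; split; first exact: dual_lin.
- by rewrite -mono1 dual_mono chi0 scale1r.
- move=> X Y; apply/ffunP => k; rewrite !ffunE scaler_sumr.
  apply: eq_bigr => h _; rewrite /cfam !ffunE.
  have [_ _ ->] := shom_additive (hal h).
  by rewrite -scalerAl -scalerAr scalerA -chiD subrKC.
- move=> X; apply/ffunP => k; rewrite !ffunE starZ.
  by have [_ _ ->] := shom_additive (hal k); rewrite chiN.
Qed.

End CrossedMonomials.

Lemma scale_mul (K : comNzRingType) (A : algType K) (a b : K) (x y : A) :
  (a *: x) * (b *: y) = (a * b) *: (x * y).
Proof. by rewrite -scalerAl -scalerAr scalerA. Qed.

Lemma unitary_comm (R : realType) (A : starAlgType R) (u x y : A) :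
  y = u * x * star u -> star u * u = 1 -> y * u = u * x.
Proof. by move=> -> uu; rewrite -mulrA uu mulr1. Qed.

Section Accompanying.
Variables (R : realType) (G : finZmodType) (M : starAlgType R).
Variables (W : von_neumann M) (al : action G M) (rho : M -> M) (S : M).
Variables (T : G -> M) (s s' : datum R G).
Hypotheses (Mfac : Defs.factor [set: M]) (hr : realizes al rho S T s).
Hypothesis (s_sign : forall h g, eps s h g = 1 \/ eps s h g = -1).
Variables (chi c : G -> G -> R[i]).
Hypothesis hchi : dual_pairing chi.
Hypothesis chi_conj : forall k g, (chi k (- g))^* = chi k g.
Hypothesis c_row : forall k l, \sum_g (c k g)^* * c l g = (k == l)%:R.
Hypothesis c_col : forall g h, \sum_k c k g * (c k h)^* = (g == h)%:R.
Hypothesis c_int : forall k g h, c k g * eps s h g = chi k (- h) * c k (g + h *+ 2).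
Hypothesis c_dual : forall k g h, chi h g * c k g = eps s' h k * c (k + h *+ 2) g.
Hypothesis c_bil : forall g h, \sum_k c k g * c k h = (h == - g)%:R * eps s g (- g).
Hypothesis c_eta : forall k g,
  chi k g * c k (- g) * eta s (- g) * eps s g (- g) = eta s' k * c k g.
Hypothesis c_eta' : forall k g,
  chi k (- g) * c k g * (eta s g)^* = (eta s' k)^* * (c k g)^*.
Hypothesis c_coef : forall k x y z,
  let g := z - x - y in let h := z - y in let l := x + y in
  chi k (- g) * c k g * coef s g h l * eps s (- g) (g + h) * eps s (- h) (g + h + l) =
  \sum_h' \sum_l' coef s' k h' l' * c (k + h') x * c (k + h' + l') y * (c (k + l') z)^*.
Implicit Types (a b : M) (g h k l : G) (X : crossed al).

Let hal g : star_hom (al g) := action_hom (actP al) g.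
Let hrho : star_hom rho := real_hom hr.
Let al00 g : al g 0 = 0. Proof. by case: (shom_additive (hal g)). Qed.
Let alZ g (z : R[i]) x : al g (z *: x) = z *: al g x.
Proof. by case: (shom_additive (hal g)). Qed.
Let al0 x : al 0 x = x. Proof. exact: action0 (actP al) x. Qed.
Let alD g h x : al (g + h) x = al g (al h x). Proof. exact: actionD (actP al) g h x. Qed.
Let alM g : {morph al g : x y / x * y}. Proof. exact: shomM (hal g). Qed.
Let alS g : {morph al g : x / star x}. Proof. exact: shomS (hal g). Qed.

Let chi0 k : chi k 0 = 1. Proof. by case: hchi. Qed.
Let chiD k g h : chi k (g + h) = chi k g * chi k h. Proof. by case: hchi. Qed.
Let chiDl k l g : chi (k + l) g = chi k g * chi l g. Proof. by case: hchi. Qed.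
Let chi_neq0 k g : chi k g != 0.
Proof.
apply/eqP => e; have := chi0 k; rewrite -(subrr g) chiD e mul0r => /eqP.
by rewrite eq_sym oner_eq0.
Qed.
Let chi00 g : chi 0 g = 1.
Proof. by apply: (mulfI (chi_neq0 0 g)); rewrite -chiDl addr0 mulr1. Qed.
Let chiNN k g : chi (- k) (- g) = chi k g.
Proof.
apply: (mulfI (chi_neq0 (- k) g)); rewrite -chiD subrr chi0.
by rewrite -chiDl addNr chi00.
Qed.

Let eps_sq h g : eps s h g * eps s h g = 1.
Proof. by case: (s_sign h g) => ->; rewrite ?mulr1 // mulrNN mulr1. Qed.

Let mn : M -> G -> crossed al := @mono R G M al.
Let lam g : crossed al := mn 1 g.
Let U g : crossed al := mn (T g) g.
Let S' : crossed al := mn S 0.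
(** Conjugation by [lam h] sends [T g] to a sign times [T (g + h *+ 2)], so a single [U g] does not
    intertwine the extension of [rho] with its square. The matrix [c] mixes the [U g] into
    eigenvectors of this shift: [c_int] says that [T' k] belongs to the character [chi k], [c_row]
    and [c_col] that the mixing is unitary, and the other hypotheses translate one realization
    formula each. *)
Let T' k : crossed al := \sum_g c k g *: U g.

Let lamD g h : lam g * lam h = lam (g + h).
Proof. by rewrite /lam /mn monoM (shom1 (hal g)) mulr1. Qed.

Let lamT h g : lam h * mn (T g) 0 = eps s h g *: (mn (T (g + h *+ 2)) 0 * lam h).
Proof.
rewrite /lam /mn !monoM (real_alT hr) mul1r addr0 add0r (shom1 (hal 0)) mulr1.
by rewrite monoZ.
Qed.

Let U_lam g : U g = mn (T g) 0 * lam g.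
Proof. by rewrite /U /lam /mn monoM (shom1 (hal 0)) mulr1 add0r. Qed.

Let lamT' g : lam (- g) * mn (T g) 0 = eps s (- g) g *: U (- g).
Proof.
rewrite lamT U_lam; congr (_ *: (mn (T _) 0 * _)).
by rewrite mulr2n addrA subrr add0r.
Qed.

Let starU g : star (U g) = lam (- g) * mn (star (T g)) 0.
Proof. by rewrite /U /lam /mn star_mono monoM mul1r addr0. Qed.

Let mn_lam g a : mn (al g a) g = lam g * mn a 0.
Proof. by rewrite /lam /mn monoM mul1r addr0. Qed.

Let mn0M a b : mn (a * b) 0 = mn a 0 * mn b 0.
Proof. by rewrite /mn monoM al0 addr0. Qed.

Let mn0S a : mn (star a) 0 = star (mn a 0).
Proof. by rewrite /mn star_mono oppr0 al0. Qed.

Let mn01 : mn 1 0 = 1. Proof. exact: mono1. Qed.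

Let lamS h : lam h * S' = S' * lam h.
Proof.
by rewrite /lam /S' /mn !monoM (real_alS hr) (shom1 (hal 0)) mul1r mulr1 addrC.
Qed.

Let lamTSS g : lam (- g) * mn (T g * S * star S) 0 =
  eps s (- g) g *: (U (- g) * S' * star S').
Proof. by rewrite !mn0M !mulrA lamT' mn0S -!scalerAl. Qed.

Let lamST g : lam (- g) * mn (S * star (T g)) 0 = S' * star (U g).
Proof. by rewrite mn0M mulrA lamS -mulrA -starU. Qed.

Let lamTTT g h l :
  lam (- g) * mn (T (g + h) * T (g + h + l) * star (T (g + l))) 0 =
  (eps s (- g) (g + h) * eps s (- h) (g + h + l)) *:
    (U (h - g) * U (g - h + l) * star (U (g + l))).
Proof.
rewrite !mn0M 2!mulrA lamT -!scalerAl -scalerA; congr (_ *: _).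
have -> : g + h + - g *+ 2 = h - g.
  by rewrite mulr2n addrA addrAC subrr add0r.
have -> : mn (T (h - g)) 0 * lam (- g) = U (h - g) * lam (- h).
  by rewrite U_lam -mulrA lamD; congr (_ * lam _); rewrite addrAC subrr add0r.
rewrite -(mulrA _ (lam (- h))) lamT -scalerAr -scalerAl; congr (_ *: _).
have -> : g + h + l + - h *+ 2 = g - h + l.
  by rewrite mulr2n addrA (addrAC g h l) addrK addrAC.
have -> : mn (T (g - h + l)) 0 * lam (- h) = U (g - h + l) * lam (- (g + l)).
  rewrite U_lam -mulrA lamD; congr (_ * lam _).
  by rewrite (addrAC g) (addrAC (g + l)) subrr add0r.
by rewrite mulrA -(mulrA _ (lam _)) -starU.
Qed.

Let U1 g h : star (U g) * U h = (g == h)%:R.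
Proof.
rewrite starU U_lam -mulrA (mulrA (mn _ 0)) -mn0M (real_TT W hr).
case: eqP => [->|_]; first by rewrite mn01 mul1r lamD addNr; exact: mn01.
by rewrite /mn mono0 mul0r mulr0.
Qed.

Let UU g : U g * star (U g) = mn (T g * star (T g)) 0.
Proof. by rewrite starU U_lam mulrA -(mulrA _ (lam g)) lamD subrr [lam 0]mn01 mulr1 mn0M. Qed.

(** The coefficient at [g] of an implementing unitary intertwines [al g] with id, so it vanishes for
    nonzero [g]. The unitary is then a scalar, the dual automorphism is trivial, and so is its
    character. *)
Lemma crossed_dual_outer : outer_action (fun k => @crossed_dual R G M al (chi k)).
Proof.
split; first split.
- move=> k; apply: dual_hom => // g; exact: chi_conj.
- by move=> X; apply/ffunP => g; rewrite ffunE chi00 scale1r.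
- by move=> k l X; apply/ffunP => g; rewrite !ffunE /cfam ?ffunE scalerA chiDl.
move=> k k0 [u [uu uu'] hu]; have hu' X : crossed_dual (chi k) X * u = u * X := unitary_comm (hu X) uu.
have ug g a : a * cfam u g = cfam u g * al g a.
  have := hu' (mn a 0) => /ffunP/(_ g); rewrite /mn dual_mono chi0 scale1r.
  have := mono_coefM a 0 u g; rewrite /cfam => ->.
  have := mono_coefMr a 0 u g; rewrite /cfam => ->.
  by rewrite al0 subr0.
have ug0 g : g != 0 -> cfam u g = 0.
  by move=> g0; apply: (intertwiner_al_id W Mfac hr g0) => a /=; rewrite ug.
have [z uz] : exists z : R[i], cfam u 0 = z%:A.
  by apply: Mfac => // a _; rewrite ug al0.
have uE : u = z *: 1.
  rewrite (mono_sum u) (bigD1 0) //= big1 ?addr0 => [|g g0].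
    by rewrite uz monoZ mono1.
  by rewrite ug0 // mono0.
have z0 : z != 0.
  apply/eqP => e; move: uu; rewrite uE e scale0r mulr0 => /eqP.
  by rewrite eq_sym oner_eq0.
have /eqP := k0; apply; case: hchi => _ _ _; apply => g.
have := hu' (lam g); rewrite uE -scalerAr -scalerAl mulr1 mul1r => /(scalerI z0).
rewrite /lam /mn dual_mono => /mono_inj /eqP.
by rewrite -subr_eq0 -{2}[1]scale1r -scalerBl scaler_eq0 oner_eq0 orbF subr_eq0 => /eqP.
Qed.

(** The coefficient at [g] of a self-intertwiner intertwines [al g \o rho] with [rho]; it vanishes
    for nonzero [g] and is scalar for [g = 0]. *)
Lemma extend_irreducible : irreducible_endo (@crossed_extend R G M al rho).
Proof.
move=> t ht.
have tg g a : cfam t g * al g (rho a) = rho a * cfam t g.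
  have := ht (mn a 0) => /ffunP/(_ g); rewrite /mn extend_mono // oppr0.
  have := mono_coefM (rho a) 0 t g; rewrite /cfam => ->.
  have := mono_coefMr (rho a) 0 t g; rewrite /cfam => ->.
  by rewrite al0 subr0.
have tg0 g : g != 0 -> cfam t g = 0.
  by move=> g0; apply: (intertwiner_al_rho_rho W Mfac hr g0) => a /=; rewrite tg.
have [z tz] : exists z : R[i], cfam t 0 = z%:A.
  by apply: (real_irr hr) => a; rewrite -tg al0.
exists z; rewrite (mono_sum t) (bigD1 0) //= big1 ?addr0 => [|g g0].
  by rewrite tz monoZ mono1.
by rewrite tg0 // mono0.
Qed.

Let star_sumC (I : finType) (F : I -> crossed al) : star (\sum_i F i) = \sum_i star (F i).
Proof. by apply: (big_morph star (@starD R _)); exact: star0. Qed.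

Let T'_star k : star (T' k) = \sum_g (c k g)^* *: star (U g).
Proof. by rewrite /T' star_sumC; apply: eq_bigr => g _; rewrite starZ. Qed.

Let sumTT (u : G -> G -> crossed al) (e : G -> G -> R[i]) :
  (forall g h, e g h = (g == h)%:R) ->
  \sum_g \sum_h e g h *: u g h = \sum_g u g g.
Proof.
move=> eE; apply: eq_bigr => g _; rewrite (bigD1 g) //= big1 ?addr0 => [|h hg].
  by rewrite eE eqxx scale1r.
by rewrite eE eq_sym (negPf hg) scale0r.
Qed.

Let T'1 k : star (T' k) * T' k = 1.
Proof.
rewrite T'_star mulr_suml; under eq_bigr => g _ do rewrite mulr_sumr.
rewrite (eq_bigr (fun g => ((c k g)^* * c k g) *: 1)); last first.
  move=> g _; rewrite (bigD1 g) //= big1 ?addr0 => [|h hg].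
    by rewrite -scalerAl -scalerAr U1 eqxx scalerA.
  by rewrite -scalerAl -scalerAr U1 eq_sym (negPf hg) !scaler0.
by rewrite -scaler_suml c_row eqxx scale1r.
Qed.

Let T'sum : \sum_k T' k * star (T' k) = \sum_g U g * star (U g).
Proof.
rewrite -(@sumTT (fun g h => U g * star (U h)) _ c_col).
transitivity (\sum_k \sum_g \sum_h (c k g * (c k h)^*) *: (U g * star (U h))).
  apply: eq_bigr => k _; rewrite T'_star mulr_suml; apply: eq_bigr => g _.
  rewrite mulr_sumr; apply: eq_bigr => h _.
  by rewrite -scalerAl -scalerAr scalerA.
rewrite exchange_big; apply: eq_bigr => g _.
rewrite exchange_big; apply: eq_bigr => h _.
by rewrite scaler_suml.
Qed.

Let T'int k X : T' k * crossed_dual (chi k) (crossed_extend rho X) =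
  crossed_extend rho (crossed_extend rho X) * T' k.
Proof.
pose P X := T' k * crossed_dual (chi k) (crossed_extend rho X) =
  crossed_extend rho (crossed_extend rho X) * T' k.
have P0 a h : P (mn a h).
  rewrite /P /mn !extend_mono // opprK dual_mono /T' mulr_suml mulr_sumr.
  transitivity (\sum_g (c k g * chi k (- h)) *: mn (rho (rho a) * T g) (g - h)).
    apply: eq_bigr => g _; rewrite -scalerAl /U /mn monoM alZ -scalerAr.
    by rewrite (real_Tint hr) monoZ scalerA.
  rewrite (reindex_inj (addIr (h *+ 2))) /=; apply: eq_bigr => g _.
  rewrite -scalerAr [_ * chi _ _]mulrC -c_int /U /mn monoM (real_alT hr) -scalerAr.
  rewrite monoZ scalerA; congr (_ *: mono _ _).
  by rewrite mulr2n !addrA addrK addrC.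
rewrite -/(P X) (mono_sum X).
have hex := extend_hom hrho (real_comm hr).
have [e0 eD _] := shom_additive hex.
have hdu : star_hom (@crossed_dual R G M al (chi k)).
  by apply: dual_hom => // g; exact: chi_conj.
have [d0 dD _] := shom_additive hdu.
apply: (big_ind P); rewrite /P.
- by rewrite !e0 d0 mul0r mulr0.
- by move=> x y hx hy; rewrite !eD dD mulrDr mulrDl hx hy.
- by move=> g _; exact: P0.
Qed.

Lemma accompanying_realizes :
  realizes (fun k => @crossed_dual R G M al (chi k)) (@crossed_extend R G M al rho)
    S' T' s'.
Proof.
have hex := extend_hom hrho (real_comm hr).
split; first exact: crossed_dual_outer.
- exact: hex.
- exact: extend_irreducible.
- move=> k X; apply/ffunP => g; rewrite !ffunE /cfam ?ffunE.
  case: (shom_additive hrho) => _ _ ->.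
  by rewrite -(chiNN k).
- split; first by rewrite /Defs.isometry -mn0S -mn0M (real_S1 hr) mn01.
  move=> X /=; apply/ffunP => g.
  have := mono_coefM S 0 X g; rewrite /cfam => ->.
  have := mono_coefMr S 0 (crossed_extend rho (crossed_extend rho X)) g; rewrite /cfam => ->.
  by rewrite !ffunE /cfam ?ffunE opprK !subr0 al0 (real_alS hr) (real_Sint hr).
- by move=> k; split; [exact: T'1|move=> X; exact: T'int].
- rewrite T'sum -mn0S -mn0M; under eq_bigr => g _ do rewrite UU.
  by rewrite -mono_bigsum -monoD (real_sum hr) mono1.
- by move=> k; rewrite /S' /mn dual_mono chi0 scale1r.
- move=> h k; rewrite /T' scaler_sumr.
  have hdu : star_hom (@crossed_dual R G M al (chi h)).
    by apply: dual_hom => // g; exact: chi_conj.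
  have [d0 dD dZ] := shom_additive hdu.
  rewrite (big_morph _ dD d0); apply: eq_bigr => g _.
  by rewrite dZ /U /mn dual_mono monoZ !scalerA mulrC c_dual.
- rewrite /S' /mn extend_mono // oppr0 (real_rhoS hr) monoD !monoZ mono_bigsum.
  congr (_ + _ *: _).
  (* The sum of the [T g * T g] is written as a double sum over [U g * U h] supported on [h = - g];
     replacing its coefficients by [c_bil] and exchanging sums produces the [T' k * T' k]. *)
  transitivity (\sum_g \sum_h ((h == - g)%:R * eps s g (- g)) *: (U g * U h)).
    apply: eq_bigr => g _; rewrite (bigD1 (- g)) //= big1 ?addr0 => [|h /negPf ->].
      rewrite eqxx mul1r /U /mn monoM (real_alT hr) subrr -scalerAr monoZ scalerA.
      by rewrite eps_sq scale1r mulr2n addKr.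
    by rewrite mul0r scale0r.
  under eq_bigr => g _ do under eq_bigr => h _ do rewrite -c_bil scaler_suml.
  under eq_bigr => g _ do rewrite exchange_big.
  rewrite exchange_big; apply: eq_bigr => k _; rewrite /T' mulr_suml.
  apply: eq_bigr => g _; rewrite mulr_sumr; apply: eq_bigr => h _.
  by rewrite -scalerAl -scalerAr scalerA.
have [_ eD eZ] := shom_additive hex.
have e0 : crossed_extend rho (0 : crossed al) = 0 by case: (shom_additive hex).
move=> k; have hdu : star_hom (@crossed_dual R G M al (chi k)).
  by apply: dual_hom => // g; exact: chi_conj.
have [d0 dD dZ] := shom_additive hdu.
rewrite {1}/T' (big_morph _ eD e0) (big_morph _ dD d0).
pose cc g := c k g * chi k (- g).
have step g : crossed_dual (chi k) (crossed_extend rho (c k g *: U g)) =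
    (cc g * eta s g * eps s (- g) g) *: (U (- g) * S' * star S') +
    (cc g * ((eta s g)^* / (Num.sqrt (gdim R G))%:C)) *: (S' * star (U g)) +
    \sum_h \sum_l (cc g * coef s g h l * (eps s (- g) (g + h) *
      eps s (- h) (g + h + l))) *: (U (h - g) * U (g - h + l) * star (U (g + l))).
  rewrite eZ dZ /U /mn extend_mono // dual_mono monoZ scalerA -/(cc g).
  (* [rho (T g)] is read as [al (- g)] of [al g (rho (T g))]: the realization formula covers the
     inner part, and [al (- g)] becomes the factor [lam (- g)]. *)
  rewrite -{1}(al0 (rho (T g))) -(addNr g) alD -/(mn _ _) mn_lam (real_rhoT hr).
  rewrite /mn !monoD !monoZ mono_bigsum; under eq_bigr => h _ do rewrite mono_bigsum.
  rewrite !mulrDr -/(mn _ _) !scalerDr; congr (_ + _ + _).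
  - by rewrite -scalerAr scalerA lamTSS scalerA.
  - by rewrite -scalerAr scalerA lamST.
  rewrite mulr_sumr scaler_sumr; apply: eq_bigr => h _.
  rewrite mulr_sumr scaler_sumr; apply: eq_bigr => l _.
  by rewrite monoZ -/(mn _ _) -scalerAr scalerA lamTTT scalerA.
under eq_bigr => g _ do rewrite step.
rewrite !big_split /=; congr (_ + _ + _).
- rewrite (reindex_inj oppr_inj) /= -mulrA /T' mulr_suml scaler_sumr.
  apply: eq_bigr => g _; rewrite opprK -[in RHS]scalerAl [in RHS]scalerA -c_eta mulrA /cc opprK.
  by congr (_ *: _); ring.
- rewrite T'_star mulr_sumr scaler_sumr; apply: eq_bigr => g _.
  by rewrite -[in RHS]scalerAr [in RHS]scalerA [in RHS]mulrAC -c_eta' /cc; congr (_ *: _); ring.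
(* The summation variables become the indices of the three isometries: [x = h - g], [y = g - h + l],
   [z = g + l], with inverse [g = z - x - y], [h = z - y], [l = x + y]. This is the origin of the
   substitution in [c_coef]. *)
transitivity (\sum_x \sum_y \sum_z (cc (z - x - y) * coef s (z - x - y) (z - y) (x + y) *
    (eps s (- (z - x - y)) (z - x - y + (z - y)) *
      eps s (- (z - y)) (z - x - y + (z - y) + (x + y)))) *: (U x * U y * star (U z))).
  transitivity (\sum_g \sum_x \sum_y (cc g * coef s g (x + g) (x + y) *
    (eps s (- g) (g + (x + g)) * eps s (- (x + g)) (g + (x + g) + (x + y)))) *:
      (U x * U y * star (U (g + (x + y))))).
    apply: eq_bigr => g _; rewrite (reindex_inj (addIr g)) /=; apply: eq_bigr => x _.
    rewrite (reindex_inj (addrI x)) /=; apply: eq_bigr => y _.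
    rewrite addrK; congr (_ *: (_ * U _ * _)).
    by rewrite [x + g]addrC opprD (addrA g) subrr add0r addKr.
  rewrite exchange_big; apply: eq_bigr => x _.
  rewrite exchange_big; apply: eq_bigr => y _.
  rewrite (reindex_inj (addIr (- (x + y)))) /=; apply: eq_bigr => z _.
  have xz : x + (z - x - y) = z - y by rewrite (addrAC z) [x + _]addrC subrK.
  by rewrite subrK opprD (addrA z) xz.
transitivity (\sum_h \sum_l \sum_x \sum_y \sum_z (coef s' k h l * c (k + h) x *
    c (k + h + l) y * (c (k + l) z)^*) *: (U x * U y * star (U z))); last first.
  apply: eq_bigr => h _; apply: eq_bigr => l _.
  rewrite T'_star /T' mulr_suml mulr_suml scaler_sumr; apply: eq_bigr => x _.
  rewrite [_ *: U x * _]mulr_sumr mulr_suml scaler_sumr; apply: eq_bigr => y _.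
  rewrite mulr_sumr scaler_sumr; apply: eq_bigr => z _.
  by rewrite !scale_mul scalerA !mulrA.
have ex3 (F : G -> G -> G -> crossed al) :
    \sum_h \sum_l \sum_x F h l x = \sum_x \sum_h \sum_l F h l x.
  by under eq_bigr do rewrite exchange_big; rewrite exchange_big.
rewrite [RHS]ex3; apply: eq_bigr => x _; rewrite [RHS]ex3; apply: eq_bigr => y _.
rewrite [RHS]ex3; apply: eq_bigr => z _.
transitivity ((\sum_h \sum_l coef s' k h l * c (k + h) x *
    c (k + h + l) y * (c (k + l) z)^*) *: (U x * U y * star (U z))).
  rewrite -c_coef /cc; congr (_ *: _).
  by rewrite [c k _ * _]mulrC !mulrA.
by rewrite scaler_suml; apply: eq_bigr => h _; rewrite scaler_suml.
Qed.

End Accompanying.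

(** * Exact arithmetic over the golden ratio *)

(* The zero test only has to be sound; it lets products skip zero components. *)
Record kops (T : Type) := KOps {
  k0 : T; k1 : T; kadd : T -> T -> T; kmul : T -> T -> T; kopp : T -> T;
  kisz : T -> bool
}.

Record kmorph (F : comNzRingType) (T : Type) (O : kops T) (f : T -> F) : Prop := KMorph {
  km0 : f (k0 O) = 0;
  km1 : f (k1 O) = 1;
  kmD : forall x y, f (kadd O x y) = f x + f y;
  kmM : forall x y, f (kmul O x y) = f x * f y;
  kmN : forall x, f (kopp O x) = - f x;
  km_isz : forall x, kisz O x -> f x = 0
}.

Definition zops : kops Z :=
  KOps Z.zero Z.one Z.add Z.mul Z.opp (fun x => if x is Z0 then true else false).

Definition zev (F : comNzRingType) (x : Z) : F := (int_of_Z x)%:~R.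

Lemma zev_morph (F : comNzRingType) : kmorph zops (@zev F).
Proof.
split=> [||x y|x y|x|[]] //; rewrite /zev.
- by rewrite -rmorphD -(rmorphD int_of_Z).
- by rewrite -rmorphM -(rmorphM int_of_Z).
- by rewrite -rmorphN -(rmorphN int_of_Z).
Qed.

(* Pairs [(a, b)] stand for [a + b w], where [w ^ 2 = r + s w]. *)
Section QuadraticExtension.
Variables (F : comNzRingType) (T : Type) (O : kops T) (f : T -> F).
Hypothesis hf : kmorph O f.
Variables (r s : T) (w : F).
Hypothesis hw : w * w = f r + f s * w.

Definition ext_mul (x y : T * T) : T * T :=
  let: (a, b) := x in let: (c, d) := y in
  if kisz O b then
    (kmul O a c, if kisz O d then k0 O else kmul O a d)
  else if kisz O d then (kmul O a c, kmul O b c)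
  else let e := kmul O b d in
    (kadd O (kmul O a c) (kmul O r e),
     kadd O (kadd O (kmul O a d) (kmul O b c)) (if kisz O s then k0 O else kmul O s e)).

Definition ext_ops : kops (T * T) := KOps (k0 O, k0 O) (k1 O, k0 O)
  (fun x y => (kadd O x.1 y.1, kadd O x.2 y.2)) ext_mul
  (fun x => (kopp O x.1, kopp O x.2)) (fun x => kisz O x.1 && kisz O x.2).

Definition ext_ev (x : T * T) : F := f x.1 + f x.2 * w.

Lemma ext_ev_morph : kmorph ext_ops ext_ev.
Proof.
case: hf => f0 f1 fD fM fN fz; rewrite /ext_ev.
split=> [||x y|[a b] [c d]|x|x] /=; rewrite ?f0 ?f1 ?fD ?fN ?mul0r ?addr0 //.
- by rewrite mulrDl addrACA.
- case: ifP => [/fz b0|_]; [|case: ifP => [/fz d0|_]] => /=.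
  + by case: ifP => [/fz d0|_]; rewrite ?fM ?b0 ?d0 ?f0; ring.
  + by rewrite !fM d0; ring.
  have es : f (if kisz O s then k0 O else kmul O s (kmul O b d)) = f s * (f b * f d).
    by case: ifP => [/fz s0|_]; rewrite ?fM // f0 s0 mul0r.
  rewrite !fD es !fM; have e : f b * f d * (w * w) = f b * f d * (f r + f s * w) by rewrite hw.
  rewrite [RHS](_ : _ = f a * f c + (f a * f d + f b * f c) * w + f b * f d * (w * w)).
    by rewrite e; ring.
  by ring.
- by ring.
- by case/andP => /fz-> /fz->; rewrite mul0r addr0.
Qed.

End QuadraticExtension.

(** The tower adjoins to the integers the golden ratio [phi], then [psi] with [psi^2 = phi - 1],
    then [i], then the square root of 2; complex conjugation acts only on the third level. *)
Definition fi_ops := ext_ops zops Z.one Z.one.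
Definition v_ops := ext_ops fi_ops (Z.opp Z.one, Z.one) (k0 fi_ops).
Definition i_ops := ext_ops v_ops (kopp v_ops (k1 v_ops)) (k0 v_ops).
Definition r2_ops := ext_ops i_ops (kadd i_ops (k1 i_ops) (k1 i_ops)) (k0 i_ops).

Definition Kfi := (Z * Z)%type.
Definition Kv := (Kfi * Kfi)%type.
Definition Ki := (Kv * Kv)%type.
Definition Kr := (Ki * Ki)%type.

Definition i_conj (x : Ki) : Ki := (x.1, kopp v_ops x.2).
Definition r2_conj (x : Kr) : Kr := (i_conj x.1, i_conj x.2).

Section Golden.
Variable R : realType.
Local Notation C := R[i].

(** Both constants are locked so that simplification and the decision procedures treat them as
    atoms, known only through their quadratic equations and bounds. *)
Definition phi : R := locked ((1 + Num.sqrt 5) / 2).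
Definition psi : R := locked (Num.sqrt (phi - 1)).

Lemma sqrt5_sq : Num.sqrt 5 * Num.sqrt 5 = 5 :> R.
Proof. by rewrite -expr2 sqr_sqrtr // ler0n. Qed.

Lemma sqrt5_bounds : (2 : R) < Num.sqrt 5 /\ (Num.sqrt 5 : R) < 3.
Proof.
have := sqrt5_sq; have : (0 : R) <= Num.sqrt 5 by exact: sqrtr_ge0.
by set x := Num.sqrt 5 => x0 xx; split; nra.
Qed.

Lemma phi_sq : phi * phi = 1 + phi.
Proof. by rewrite /phi -lock; have := sqrt5_sq; set x := Num.sqrt 5 => xx; lra. Qed.

Lemma phi_bounds : 3 / 2 < phi /\ phi < 2.
Proof. by rewrite /phi -lock; have [] := sqrt5_bounds; set x := Num.sqrt 5 => *; split; lra. Qed.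

Lemma psi_sq : psi * psi = phi - 1.
Proof. by rewrite /psi -lock -expr2 sqr_sqrtr //; have [] := phi_bounds; lra. Qed.

Lemma psi_gt0 : 0 < psi.
Proof. by rewrite /psi -lock sqrtr_gt0; have [] := phi_bounds; lra. Qed.

Lemma gdim4 : gdim R 'Z_4 = 2 + Num.sqrt 5.
Proof.
rewrite /gdim card_ord; have -> : (4%:R ^+ 2 + 4 : R) = (2 * Num.sqrt 5) ^+ 2.
  by rewrite exprMn sqr_sqrtr ?ler0n //; ring.
by rewrite sqrtr_sqr ger0_norm; [rewrite (_ : (Zp_trunc 4).+2%:R = 4%:R) //; field|rewrite mulr_ge0 ?sqrtr_ge0].
Qed.

Lemma gdim4_phi : gdim R 'Z_4 = 1 + 2 * phi.
Proof. by rewrite gdim4 /phi -lock; field. Qed.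

Lemma gdim4V : (gdim R 'Z_4)^-1 = 2 * phi - 3.
Proof.
have [p1 p2] := phi_bounds; apply: (mulfI (_ : gdim R 'Z_4 != 0)).
  by rewrite gdim4_phi; apply/eqP; lra.
rewrite mulfV; last by rewrite gdim4_phi; apply/eqP; lra.
by rewrite gdim4_phi; have := phi_sq; lra.
Qed.

Definition fi_ev := ext_ev (@zev C) phi%:C.
Definition v_ev := ext_ev fi_ev psi%:C.
Definition i_ev := ext_ev v_ev 'i%C.
Definition r2_ev := ext_ev i_ev (Num.sqrt 2)%:C.

Lemma fi_morph : kmorph fi_ops fi_ev.
Proof.
apply: ext_ev_morph; first exact: zev_morph.
by rewrite -rmorphM phi_sq rmorphD rmorph1 /zev /= !mul1r.
Qed.

Lemma v_morph : kmorph v_ops v_ev.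
Proof.
apply: ext_ev_morph; first exact: fi_morph.
rewrite -rmorphM psi_sq rmorphB rmorph1 (km0 fi_morph) mul0r addr0 /fi_ev /ext_ev.
have zM := zev_morph C.
rewrite (kmN zM Z.one : zev C (Z.opp Z.one) = - zev C Z.one).
by rewrite (km1 zM : zev C Z.one = 1) mul1r addrC.
Qed.

Lemma i_morph : kmorph i_ops i_ev.
Proof.
apply: ext_ev_morph; first exact: v_morph.
by rewrite (kmN v_morph) (km1 v_morph) (km0 v_morph) mul0r addr0 -expr2 sqr_i.
Qed.

Lemma r2_morph : kmorph r2_ops r2_ev.
Proof.
apply: ext_ev_morph; first exact: i_morph.
rewrite (kmD i_morph) (km1 i_morph) (km0 i_morph) mul0r addr0.
by rewrite -rmorphM -expr2 sqr_sqrtr ?ler0n // rmorphD.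
Qed.

Lemma v_ev_real x : (v_ev x)^* = v_ev x.
Proof.
have z k : (@zev C k)^* = @zev C k by rewrite /zev rmorph_int.
have re (y : R) : (y%:C)^* = y%:C by exact: conjC_real.
have fr y : (@fi_ev y)^* = fi_ev y by rewrite /fi_ev /ext_ev rmorphD rmorphM /= !z re.
by rewrite /v_ev /ext_ev rmorphD rmorphM /= !fr re.
Qed.

Lemma i_ev_conj x : (i_ev x)^* = i_ev (i_conj x).
Proof.
rewrite /i_ev /ext_ev /= (kmN v_morph) rmorphD rmorphM /= !v_ev_real.
by rewrite conjCi mulrN mulNr.
Qed.

Lemma r2_ev_conj x : (r2_ev x)^* = r2_ev (r2_conj x).
Proof.
by rewrite /r2_ev /ext_ev /= rmorphD rmorphM /= !i_ev_conj; congr (_ + _ * _); exact: conjC_real.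
Qed.

End Golden.

(** * Verification of the equations by evaluation on four indices *)

Inductive q4 := Q0 | Q1 | Q2 | Q3.

Definition qnat (a : q4) : nat := match a with Q0 => 0 | Q1 => 1 | Q2 => 2 | Q3 => 3 end.
Definition qsucc (a : q4) : q4 := match a with Q0 => Q1 | Q1 => Q2 | Q2 => Q3 | Q3 => Q0 end.
Definition qadd (a b : q4) : q4 := iter (qnat a) qsucc b.
Definition qopp (a : q4) : q4 := match a with Q0 => Q0 | Q1 => Q3 | Q2 => Q2 | Q3 => Q1 end.
Definition qsub (a b : q4) : q4 := qadd a (qopp b).
Definition qeq (a b : q4) : bool := qnat a == qnat b.
Definition qall (P : pred q4) : bool := [&& P Q0, P Q1, P Q2 & P Q3].

Lemma qallP (P : pred q4) : qall P -> forall a, P a.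
Proof. by case/and4P => ? ? ? ? []. Qed.

(** Constructors stand in for the ordinals of ['Z_4], so that the checks evaluate without carrying
    proofs of bounds. *)
Definition zq (a : q4) : 'Z_4 := inZp (qnat a).

Lemma zq_surj (g : 'Z_4) : exists a, g = zq a.
Proof.
case: g => [[|[|[|[|//]]]] h]; [exists Q0|exists Q1|exists Q2|exists Q3]; exact: val_inj.
Qed.

Lemma zqD a b : zq a + zq b = zq (qadd a b).
Proof. by case: a; case: b; exact: val_inj. Qed.

Lemma zqN a : - zq a = zq (qopp a).
Proof. by case: a; exact: val_inj. Qed.

Lemma zq_double a : zq a *+ 2 = zq (qadd a a).
Proof. by rewrite mulr2n zqD. Qed.

Lemma zq0 : 0 = zq Q0.
Proof. exact: val_inj. Qed.

Lemma zq_eq a b : (zq a == zq b) = qeq a b.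
Proof. by case: a; case: b. Qed.

Lemma sum_zq (V : nmodType) (F : 'Z_4 -> V) :
  \sum_g F g = F (zq Q0) + F (zq Q1) + F (zq Q2) + F (zq Q3).
Proof.
rewrite !big_ord_recl big_ord0 addr0 !addrA.
by congr (F _ + F _ + F _ + F _); exact: val_inj.
Qed.

Definition zqE := (zqN, zqD, zq_double, zq_eq).

Section GoldenTable.
Variables (T : Type) (N cj : T -> T) (s p t q Y : T).

(* The shape to which [P5]-[P8] force [A] when [eta] is trivial and
   [epsilon] is [eps4]. *)
Definition gtable : seq (seq (seq T)) :=
  let Z := cj Y in
  [:: [:: [:: s; p; t; q]; [:: p; q; Y; N Y]; [:: t; Z; t; Y]; [:: q; N Z; Z; p]];
      [:: [:: s; p; t; q]; [:: p; q; Y; Y]; [:: t; Z; N t; N Y]; [:: q; Z; N Z; N p]];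
      [:: [:: s; p; t; q]; [:: p; q; N Y; Y]; [:: t; N Z; t; N Y]; [:: q; Z; N Z; p]];
      [:: [:: s; p; t; q]; [:: p; N q; N Y; Y]; [:: t; N Z; N t; Y]; [:: q; Z; Z; p]]].

Definition gcoef (g h k : nat) : T := nth s (nth [::] (nth [::] gtable g) h) k.

End GoldenTable.

Lemma gcoef_map (T T' : Type) (f : T -> T') (N cj : T -> T) (N' cj' : T' -> T')
    s p t q Y a b c :
  (forall x, f (N x) = N' (f x)) -> (forall x, f (cj x) = cj' (f x)) ->
  f (gcoef N cj s p t q Y (qnat a) (qnat b) (qnat c)) =
  gcoef N' cj' (f s) (f p) (f t) (f q) (f Y) (qnat a) (qnat b) (qnat c).
Proof.
by move=> fN fc; case: a; case: b; case: c; rewrite /gcoef /= ?fN ?fc.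
Qed.

Definition qeps (h g : q4) : bool :=
  match h, g with Q1, Q3 | Q3, Q1 | Q2, Q1 | Q2, Q3 => true | _, _ => false end.

Section Check.
Variables (K : Type) (O : kops K) (cj : K -> K) (lin : int -> int -> K).
Variable kcoef : q4 -> q4 -> q4 -> K.

Definition ksg (h g : q4) : K := if qeps h g then kopp O (k1 O) else k1 O.
Definition kron4 (a b : q4) : K := if qeq a b then k1 O else k0 O.
Definition keq (x y : K) : bool := kisz O (kadd O x (kopp O y)).
Definition ksum (F : q4 -> K) : K := kadd O (kadd O (kadd O (F Q0) (F Q1)) (F Q2)) (F Q3).

Local Notation "x +! y" := (kadd O x y) (at level 50, left associativity).
Local Notation "x *! y" := (kmul O x y) (at level 40, left associativity).
Local Notation "-! x" := (kopp O x) (at level 35, right associativity).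
Local Infix "+q" := qadd (at level 50, left associativity).
Local Infix "-q" := qsub (at level 50, left associativity).

(** [kcoef] holds twice the entries, and [eta] is 1. Here [lin (-3) 2] is [1 / d] and [lin 6 (-4)]
    is [- 2 / d]. The factor 4 clears the products of two entries in (P4); in (P9) everything is
    multiplied by 8, which leaves a factor 2 on the product of two entries. *)
Definition check3 := qall (fun g => keq (ksum (fun h => kcoef g h Q0)) (lin 6 (-4))).
Definition check4 := qall (fun g => qall (fun g' => qall (fun k =>
  keq (ksum (fun h => kcoef g (h -q g) k *! cj (kcoef g' (h -q g') k)))
    (lin 4 0 *! (kron4 g g' +! -! (lin (-3) 2 *! kron4 k Q0)))))).
Definition check5 := qall (fun g => qall (fun h => qall (fun x => qall (fun y =>
  keq (kcoef (g +q (h +q h)) x y)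
    (ksg h g *! ksg h (g +q x) *! ksg h (g +q y) *! ksg h (g +q x +q y) *! kcoef g x y))))).
Definition check678 := qall (fun g => qall (fun h => qall (fun k =>
  [&& keq (kcoef g k h) (cj (kcoef g h k)),
      keq (kcoef g h k) (kcoef g (qopp k) (h -q k) *! ksg (qopp k) (g +q h) *!
        ksg (qopp k) (g +q k) *! ksg (qopp k) (g +q h +q k)),
      keq (kcoef g h k) (kcoef g (k -q h) (qopp h) *! ksg (qopp h) (g +q h) *!
        ksg (qopp h) (g +q k) *! ksg (qopp h) (g +q h +q k)),
      keq (kcoef g h k) (kcoef (g +q h) h k *! ksg h g *! ksg h (g +q k)) &
      keq (kcoef g h k) (kcoef (g +q k) h k *! ksg k g *! ksg k (g +q h))]))).
Definition check9 := qall (fun g => qall (fun a => qall (fun b => qall (fun x => qall (fun y =>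
  keq (ksum (fun l => kcoef g (x +q y) l *! kcoef (g -q a +q x) (qopp x) (l +q a) *!
         kcoef (g -q b +q x +q y) (qopp y) (l +q b)))
    (lin 2 0 *! (kcoef g (a +q x) (b +q x +q y) *! kcoef (g -q a) (b +q y) (a +q x +q y) *!
       ksg a (g -q a +q x) *! ksg (a +q x) (g -q a +q b +q y) *!
       ksg b (g -q b +q x +q y) *! ksg (b +q y) (g -q b +q x)) +!
     -! (lin 8 0 *! (kron4 x Q0 *! (kron4 y Q0 *! lin (-3) 2))))))))).

Definition check_solution :=
  [&& check3, check4, check5, check678 & check9].

End Check.

Definition ki2 (a b : int) : Ki :=
  (((Z_of_int a, Z_of_int b), k0 fi_ops), k0 v_ops).
Definition kcoef (s p t q Y : Ki) (a b c : q4) : Ki :=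
  gcoef (kopp i_ops) i_conj s p t q Y (qnat a) (qnat b) (qnat c).

Section Z4Solutions.
Variable R : realType.
Local Notation C := R[i].
Local Notation d := (gdim R 'Z_4).

Definition golden_datum (s p t q Y : C) : datum R 'Z_4 :=
  Datum (@eps4 R) (fun=> 1) (fun g h k => gcoef -%R (fun x => x^*) s p t q Y g h k).

Lemma ki2E a b : i_ev R (ki2 a b) = a%:~R + b%:~R * (phi R)%:C.
Proof.
rewrite /i_ev /ext_ev /ki2 /= (km0 (v_morph R)) mul0r addr0 /v_ev /ext_ev /=.
by rewrite (km0 (fi_morph R)) mul0r addr0 /fi_ev /ext_ev /= /zev !Z_of_intK.
Qed.

Lemma gdim4C : (d%:C : C)^-1 = 2 * (phi R)%:C - 3.
Proof. by rewrite -fmorphV /= gdim4V rmorphB rmorphM !rmorph_nat. Qed.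

Section Evaluation.
Variables (K : Type) (O : kops K) (cj : K -> K) (lin : int -> int -> K) (f : K -> C).
Hypothesis hf : kmorph O f.
Hypothesis f_conj : forall x, (f x)^* = f (cj x).
Hypothesis f_lin : forall a b, f (lin a b) = a%:~R + b%:~R * (phi R)%:C.

Lemma ksgE h g : eps4 R (zq h) (zq g) = f (ksg O h g).
Proof.
by rewrite /ksg (fun_if f) (kmN hf) (km1 hf); case: h; case: g.
Qed.

Lemma kron4E a b : f (kron4 O a b) = (qeq a b)%:R.
Proof. by rewrite /kron4; case: ifP => _; [exact: km1 hf|exact: km0 hf]. Qed.

Lemma keqP x y : keq O x y -> f x = f y.
Proof.
by move/(km_isz hf); rewrite (kmD hf) (kmN hf) => /eqP; rewrite subr_eq0 => /eqP.
Qed.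

Variables (kcf : q4 -> q4 -> q4 -> K) (D : datum R 'Z_4).
Hypothesis hc : check_solution O cj lin kcf.
Hypothesis coefE : forall a b c, coef D (zq a) (zq b) (zq c) = f (kcf a b c) / 2.
Hypothesis epsE : forall h g, eps D (zq h) (zq g) = f (ksg O h g).
Hypothesis etaE : forall g, eta D g = 1.

Let conj2 (x : C) : (x / 2)^* = x^* / 2.
Proof. by rewrite fmorph_div /= rmorph_nat. Qed.

Let evM := kmM hf.
Let evD := kmD hf.
Let evN := kmN hf.
Let evE := (evM, evD, evN, f_lin, kron4E, =^~ f_conj).

Lemma check_solutionP : is_solution D.
Proof.
case/and5P: hc => h3 h4 h5 h678 h9.
split.
- move=> h g; have [a ->] := zq_surj h; have [b ->] := zq_surj g; rewrite epsE /ksg.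
  rewrite (fun_if f) evN (km1 hf).
  by case: ifP => _; [right|left].
- by move=> g; rewrite etaE normr1.
- split=> [h k g|h]; last first.
    have [a ->] := zq_surj h; rewrite zq0 epsE /ksg.
    by case: a; exact: (km1 hf).
  have [a ->] := zq_surj h; have [b ->] := zq_surj k; have [c ->] := zq_surj g.
  rewrite !zqE !epsE -evM /ksg; case: a; case: b; case: c; rewrite /= ?evM ?evN (km1 hf); ring.
- by move=> g h; rewrite !etaE expr1n.
- move=> g; have [a ->] := zq_surj g; rewrite etaE zq0 sum_zq !coefE conjC1 mulN1r gdim4C.
  have := keqP (qallP h3 a); rewrite /ksum !evE => e.
  by rewrite -!mulrDl e; field.
- move=> g g' k; have [a ->] := zq_surj g; have [b ->] := zq_surj g'; have [c ->] := zq_surj k.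
  rewrite !etaE zq0 sum_zq /kron !zqE !coefE conjC1 mulr1 mul1r gdim4C.
  have := keqP (qallP (qallP (qallP h4 a) b) c); rewrite /ksum !evE => e.
  rewrite !conj2.
  by match type of e with ?l = _ => transitivity (l / 4) end; [field|rewrite e; field].
- move=> g h x y; have [a ->] := zq_surj g; have [b ->] := zq_surj h.
  have [a' ->] := zq_surj x; have [b' ->] := zq_surj y.
  rewrite !zqE !coefE !epsE.
  have := keqP (qallP (qallP (qallP (qallP h5 a) b) a') b'); rewrite !evE => ->.
  by rewrite !mulrA.
- move=> g h k; have [a ->] := zq_surj g; have [b ->] := zq_surj h; have [c ->] := zq_surj k.
  rewrite !coefE conj2.
  by have /and5P[/keqP -> _ _ _ _] := qallP (qallP (qallP h678 a) b) c; rewrite f_conj.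
- move=> g h k; have [a ->] := zq_surj g; have [b ->] := zq_surj h; have [c ->] := zq_surj k.
  rewrite !zqE !coefE !epsE !etaE conjC1 !mulr1.
  have /and5P[_ /keqP e1 /keqP e2 _ _] := qallP (qallP (qallP h678 a) b) c.
  by split; [rewrite e1|rewrite e2]; rewrite !evE; ring.
- move=> g h k; have [a ->] := zq_surj g; have [b ->] := zq_surj h; have [c ->] := zq_surj k.
  rewrite !zqE !coefE !epsE !etaE !mulr1 conjC1 !mulr1.
  have /and5P[_ _ _ /keqP e1 /keqP e2] := qallP (qallP (qallP h678 a) b) c.
  by split; [rewrite e1|rewrite e2]; rewrite !evE; ring.
move=> g p' q' x y; have [a ->] := zq_surj g; have [b ->] := zq_surj p'.
have [c ->] := zq_surj q'; have [x' ->] := zq_surj x; have [y' ->] := zq_surj y.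
rewrite zq0 sum_zq /kron !zqE !coefE !epsE !etaE !mulr1 conjC1 !mulr1 gdim4C.
have := keqP (qallP (qallP (qallP (qallP (qallP h9 a) b) c) x') y').
rewrite /ksum !evE => e.
by match type of e with ?l = _ => transitivity (l / 8) end; [field|rewrite e; field].
Qed.

End Evaluation.
End Z4Solutions.

Section Tables.

Definition kpsi (b : bool) : Ki :=
  ((k0 fi_ops, k0 fi_ops), (k0 fi_ops, if b then kopp fi_ops (k1 fi_ops) else k1 fi_ops)).
Definition kv (a b c : int) : Ki :=
  (((Z_of_int a, Z_of_int b), (Z_of_int c, Z.zero)), k0 v_ops).

(* Twice the entries, which makes them integral. *)
Definition ktab1 (b : bool) := kcoef (ki2 3 (-1)) (ki2 1 (-1)) (ki2 1 (-1)) (ki2 1 (-1))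
  (kadd i_ops (ki2 (-1) 0) (kpsi b)).
Definition ktab2 (b : bool) := kcoef (ki2 3 (-2)) (kv 1 (-1) (if b then -1 else 1)) (ki2 1 0)
  (kv 1 (-1) (if b then 1 else -1)) (ki2 (-1) 0).

Lemma check_ktab1 b : check_solution i_ops i_conj ki2 (ktab1 b).
Proof. by case: b; vm_compute. Qed.

Lemma check_ktab2 : check_solution i_ops i_conj ki2 (ktab2 false).
Proof. by vm_compute. Qed.

Variable R : realType.
Local Notation C := R[i].
Local Notation d := (gdim R 'Z_4).
Local Notation fi := (phi R).
Local Notation ps := (psi R).

Definition par1 (b : bool) : datum R 'Z_4 :=
  golden_datum (((3 - fi) / 2)%:C) (((1 - fi) / 2)%:C) (((1 - fi) / 2)%:C) (((1 - fi) / 2)%:C)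
    ((- (1 / 2)) +i* ((-1) ^+ b * ps / 2)).
Definition par2 (b : bool) : datum R 'Z_4 :=
  golden_datum (((3 - 2 * fi) / 2)%:C) (((1 - fi + (-1) ^+ b * ps) / 2)%:C) ((1 / 2)%:C)
    (((1 - fi - (-1) ^+ b * ps) / 2)%:C) ((- (1 / 2))%:C).

Lemma kpsiE b : i_ev R (kpsi b) = 0 +i* ((-1) ^+ b * ps).
Proof.
have [f0 f1 _ _ fN _] := fi_morph R.
have e : fi_ev R (if b then kopp fi_ops (k1 fi_ops) else k1 fi_ops) = (-1) ^+ b.
  by case: b; rewrite ?fN f1.
have -> : i_ev R (kpsi b) = fi_ev R (k0 fi_ops) + fi_ev R (k0 fi_ops) * ps%:C +
  (fi_ev R (k0 fi_ops) + fi_ev R (if b then kopp fi_ops (k1 fi_ops) else k1 fi_ops) * ps%:C) * 'i%C.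
  by [].
rewrite f0 mul0r !add0r e; move: ps => v.
by case: b {e}; apply/eqP; rewrite eq_complex /=; apply/andP; split; apply/eqP; ring.
Qed.

Lemma kvE a b c : i_ev R (kv a b c) = a%:~R + b%:~R * fi%:C + c%:~R * ps%:C.
Proof.
rewrite /i_ev /ext_ev /kv /= (km0 (v_morph R)) mul0r addr0 /v_ev /ext_ev /=.
by rewrite /fi_ev /ext_ev /= /zev !Z_of_intK mul0r addr0.
Qed.

Lemma golden_coefE (s p t q Y : Ki) (s' p' t' q' Y' : C) a b c :
  i_ev R s / 2 = s' -> i_ev R p / 2 = p' -> i_ev R t / 2 = t' -> i_ev R q / 2 = q' ->
  i_ev R Y / 2 = Y' ->
  coef (golden_datum s' p' t' q' Y') (zq a) (zq b) (zq c) =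
  i_ev R (kcoef s p t q Y a b c) / 2.
Proof.
move=> <- <- <- <- <-; rewrite /kcoef.
rewrite (gcoef_map (f := fun x => i_ev R x / 2) (N' := -%R) (cj' := fun x => x^*)).
- by case: a; case: b; case: c.
- by move=> x; rewrite (kmN (i_morph R)) mulNr.
- by move=> x; rewrite -i_ev_conj fmorph_div /= rmorph_nat.
Qed.

Lemma par1_coefE b x y z : coef (par1 b) (zq x) (zq y) (zq z) = i_ev R (ktab1 b x y z) / 2.
Proof.
apply: golden_coefE; rewrite ?(kmD (i_morph R)) ?ki2E ?kpsiE.
all: move: fi ps => f v.
1-4: by rewrite rmorphM rmorphB fmorphV /= !rmorph_nat; ring.
by apply/eqP; rewrite eq_complex /=; apply/andP; split; apply/eqP; field.
Qed.

Lemma par2_coefE b x y z : coef (par2 b) (zq x) (zq y) (zq z) = i_ev R (ktab2 b x y z) / 2.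
Proof.
apply: golden_coefE; rewrite ?kvE ?ki2E.
all: move: fi ps => f v.
all: by case: b; rewrite ?(rmorphM, rmorphB, rmorphN, rmorphD, fmorphV) /= ?rmorph_nat ?rmorph1; field.
Qed.

Lemma par1_solution b : is_solution (par1 b).
Proof.
by apply: (check_solutionP (i_morph R) (@i_ev_conj R) (@ki2E R) (check_ktab1 b)) => // [x y z|h g];
  [exact: par1_coefE|exact: ksgE (i_morph R) _ _].
Qed.

Lemma par2_solution : is_solution (par2 false).
Proof.
by apply: (check_solutionP (i_morph R) (@i_ev_conj R) (@ki2E R) check_ktab2) => // [x y z|h g];
  [exact: par2_coefE|exact: ksgE (i_morph R) _ _].
Qed.

(** [d - 1] is [2 phi], and [phi - 1] is the inverse of [phi]. *)
Lemma gdim4B1 : (d - 1)^-1 = (fi - 1) / 2.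
Proof.
have [p1 p2] := phi_bounds R; apply: (mulfI (_ : d - 1 != 0)).
  by rewrite gdim4_phi; apply/eqP; lra.
rewrite mulfV; last by rewrite gdim4_phi; apply/eqP; lra.
by rewrite gdim4_phi; have := phi_sq R; lra.
Qed.

Lemma z4E b : z4 R b = (- fi) +i* ((-1) ^+ b * Num.sqrt fi).
Proof. by rewrite /z4 gdim4_phi; congr (- _ +i* (_ * Num.sqrt _)); field. Qed.

(** [phi^2 (phi - 1) = phi], so the imaginary part of [z] lies in the field generated by [psi] and
    no further square root is adjoined. *)
Lemma sqrt_phi : Num.sqrt fi = fi * ps.
Proof.
have [p1 p2] := phi_bounds R.
have e : fi = (fi * ps) ^+ 2.
  by have := phi_sq R; have := psi_sq R; move: fi ps => f v vv ff; ring: vv ff.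
by rewrite {1}e sqrtr_sqr ger0_norm // mulr_ge0 ?(ltW (psi_gt0 R)) //; lra.
Qed.

Lemma coef4E b g h k : coef4 R b g h k = coef (par1 b) g h k.
Proof.
have [x ->] := zq_surj g; have [y ->] := zq_surj h; have [z ->] := zq_surj k.
have e1 : ((d - 1)^-1)%:C * (-1) = ((1 - fi) / 2)%:C :> C.
  by rewrite gdim4B1; move: fi => f; rewrite mulrN1 -rmorphN /=; congr _%:C; field.
have e2 : ((d - 1)^-1)%:C * (d - 2)%:C = ((3 - fi) / 2)%:C :> C.
  rewrite -rmorphM gdim4B1 gdim4_phi; congr _%:C; have := phi_sq R.
  by move: fi => f ff; field: ff.
have e3 : ((d - 1)^-1)%:C * z4 R b = (- (1 / 2)) +i* ((-1) ^+ b * ps / 2).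
  rewrite z4E gdim4B1 sqrt_phi; have := phi_sq R; move: fi ps => f v ff.
  apply/eqP; rewrite eq_complex /= !mul0r subr0 addr0.
  by apply/andP; split; apply/eqP; field: ff.
have e4 : ((d - 1)^-1)%:C * (z4 R b)^* = ((- (1 / 2)) +i* ((-1) ^+ b * ps / 2))^*.
  by rewrite -e3 rmorphM; congr (_ * _); symmetry; exact: conjC_real.
rewrite /coef4 /par1 /golden_datum /= /table4 /gcoef /gtable -e4 -e3 -e2 -e1.
move: (d - 1)^-1 (d - 2) (z4 R b) => c c' Z.
by case: x; case: y; case: z => /=; rewrite ?mulrN ?mulrN1 ?opprK ?mulr1.
Qed.

End Tables.

(** * The accompanying solution *)

Definition r2emb (x : Ki) : Kr := (x, k0 i_ops).
Definition ki : Ki := (k0 v_ops, k1 v_ops).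

Definition kchi4 (k g : q4) : Kr := r2emb (iter (qnat k * qnat g) (kmul i_ops ki) (k1 i_ops)).

(* Twice the coefficients of [T'_k] in the isometries [T_g lambda_g]. *)
Definition kmix4 (k g : q4) : Kr :=
  let r := k1 i_ops in
  match k, g with
  | Q0, Q0 | Q0, Q2 | Q2, Q0 => (k0 i_ops, r)
  | Q2, Q2 => (k0 i_ops, kopp i_ops r)
  | Q1, Q1 | Q3, Q3 => r2emb (kadd i_ops r ki)
  | Q1, Q3 | Q3, Q1 => r2emb (kadd i_ops (kopp i_ops r) ki)
  | _, _ => k0 r2_ops
  end.

Section AccompanyingCheck.
Variables (K : Type) (O : kops K) (cj : K -> K) (four : K) (kchi kmix : q4 -> q4 -> K).

Local Notation "x *! y" := (kmul O x y) (at level 40, left associativity).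
Local Notation sg := (ksg O).
Local Notation keq := (keq O).
Local Notation ksum := (ksum O).
Local Infix "+q" := qadd (at level 50, left associativity).
Local Infix "-q" := qsub (at level 50, left associativity).
Definition check_mix := qall (fun k => qall (fun g => qall (fun h =>
  [&& keq (ksum (fun x => cj (kmix k x) *! kmix g x)) (four *! kron4 O k g),
      keq (ksum (fun x => kmix x g *! cj (kmix x h))) (four *! kron4 O g h),
      keq (kmix k g *! sg h g) (kchi k (qopp h) *! kmix k (g +q (h +q h))),
      keq (kchi h g *! kmix k g) (sg h k *! kmix (k +q (h +q h)) g),
      keq (ksum (fun x => kmix x g *! kmix x h)) (four *! (kron4 O h (qopp g) *! sg g (qopp g))),
      keq (kchi k g *! kmix k (qopp g) *! sg g (qopp g)) (kmix k g) &
      keq (kchi k (qopp g) *! kmix k g) (cj (kmix k g))]))).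

(** Entries and mixing coefficients are both doubled: the left side has two such factors and the
    right side four, hence the factor 4 on the left. *)
Definition check_mix_coef (A A' : q4 -> q4 -> q4 -> K) :=
  qall (fun k => qall (fun x => qall (fun y => qall (fun z =>
    let g := z -q x -q y in let h := z -q y in let l := x +q y in
    keq (four *! (kchi k (qopp g) *! kmix k g *! (A g h l) *! sg (qopp g) (g +q h) *!
           sg (qopp h) (g +q h +q l)))
      (ksum (fun h' => ksum (fun l' => (A' k h' l') *! kmix (k +q h') x *!
         kmix (k +q h' +q l') y *! cj (kmix (k +q l') z)))))))).

Definition check_chi := qall (fun k => qall (fun g => qall (fun h =>
  [&& keq (kchi k (g +q h)) (kchi k g *! kchi k h),
      keq (kchi (g +q h) k) (kchi g k *! kchi h k) &
      keq (cj (kchi k (qopp g))) (kchi k g)]))).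

End AccompanyingCheck.

Definition rtab (t : q4 -> q4 -> q4 -> Ki) a b c : Kr := r2emb (t a b c).
Local Notation four := (r2emb (ki2 4 0)).

Lemma check_chi4 : check_chi r2_ops r2_conj kchi4. Proof. by vm_compute. Qed.
Lemma check_mix4 : check_mix r2_ops r2_conj four kchi4 kmix4. Proof. by vm_compute. Qed.
Lemma check_mix_coef12 : check_mix_coef r2_ops r2_conj four kchi4 kmix4
  (rtab (ktab1 false)) (rtab (ktab2 false)).
Proof. by vm_compute. Qed.
Lemma check_mix_coef21 : check_mix_coef r2_ops r2_conj four kchi4 kmix4
  (rtab (ktab2 false)) (rtab (ktab1 false)).
Proof. by vm_compute. Qed.

Definition qz (g : 'Z_4) : q4 := nth Q0 [:: Q0; Q1; Q2; Q3] g.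

Lemma zqK : cancel zq qz.
Proof. by case. Qed.

Section Accompanying4.
Variable R : realType.
Local Notation C := R[i].

Variables (K : Type) (O : kops K) (cj : K -> K) (four : K) (f : K -> C).
Hypothesis hf : kmorph O f.
Hypothesis f_conj : forall x, (f x)^* = f (cj x).
Hypothesis f_four : f four = 4.
Variables kchi kmix : q4 -> q4 -> K.
Hypotheses (check_chiT : check_chi O cj kchi) (check_mixT : check_mix O cj four kchi kmix).
Hypothesis kchi0 : forall k, f (kchi k Q0) = 1.
Hypothesis kchi_faithful : forall k, f (kchi k Q1) = 1 -> k = Q0.

Definition chi4 (k g : 'Z_4) : C := f (kchi (qz k) (qz g)).
Definition mix4 (k g : 'Z_4) : C := f (kmix (qz k) (qz g)) / 2.

Let chiE k g : chi4 (zq k) (zq g) = f (kchi k g). Proof. by rewrite /chi4 !zqK. Qed.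
Let mixE k g : mix4 (zq k) (zq g) = f (kmix k g) / 2. Proof. by rewrite /mix4 !zqK. Qed.

Let evM := kmM hf.
Let evE := (kmM hf, kmD hf, f_four, kron4E hf, =^~ f_conj).
Let conj2 (x : C) : (x / 2)^* = x^* / 2.
Proof. by rewrite fmorph_div /= rmorph_nat. Qed.

Lemma chi4_pairing : dual_pairing chi4.
Proof.
have h := check_chiT.
split=> [k|k g l|k l g|k hk].
- have [a ->] := zq_surj k; rewrite zq0 chiE.
  exact: kchi0.
- have [a ->] := zq_surj k; have [b ->] := zq_surj g; have [c ->] := zq_surj l.
  rewrite zqE !chiE -evM; apply: (keqP hf).
  by have /and3P[] := qallP (qallP (qallP h a) b) c.
- have [a ->] := zq_surj g; have [b ->] := zq_surj k; have [c ->] := zq_surj l.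
  rewrite zqE !chiE -evM; apply: (keqP hf).
  by have /and3P[] := qallP (qallP (qallP h a) b) c.
have [a ka] := zq_surj k; have := hk (zq Q1).
by rewrite ka chiE => /kchi_faithful ->; rewrite zq0.
Qed.

Lemma chi4_conj k g : (chi4 k (- g))^* = chi4 k g.
Proof.
have [a ->] := zq_surj k; have [b ->] := zq_surj g; rewrite zqE !chiE f_conj.
by apply: (keqP hf); have /and3P[] := qallP (qallP (qallP check_chiT a) b) b.
Qed.

Variables (A A' : q4 -> q4 -> q4 -> K) (D D' : datum R 'Z_4).
Hypothesis hc : check_mix_coef O cj four kchi kmix A A'.
Hypothesis DA : forall a b c, coef D (zq a) (zq b) (zq c) = f (A a b c) / 2.
Hypothesis DA' : forall a b c, coef D' (zq a) (zq b) (zq c) = f (A' a b c) / 2.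
Hypothesis De : forall h g, eps D (zq h) (zq g) = f (ksg O h g).
Hypothesis De' : forall h g, eps D' (zq h) (zq g) = f (ksg O h g).
Hypothesis Dt : forall g, eta D g = 1.
Hypothesis Dt' : forall g, eta D' g = 1.
Hypothesis hD : is_solution D.

Lemma accompanying4 : accompanying D D'.
Proof.
move=> M W al rho S T [[Mfac _] _ hr].
exists chi4; eexists; eexists; split; first exact: chi4_pairing.
have sg := sol_sign hD.
have hm := check_mixT.
have n4 : (4 : C) != 0 by rewrite pnatr_eq0.
apply: (@accompanying_realizes _ _ _ W al rho S T D D' Mfac hr sg chi4 mix4).
- exact: chi4_pairing.
- exact: chi4_conj.
- move=> k l; have [a ->] := zq_surj k; have [b ->] := zq_surj l.
  rewrite sum_zq !mixE !conj2.
  have /andP[/(keqP hf) e _] := qallP (qallP (qallP hm a) b) b.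
  rewrite /ksum !evE in e.
  apply: (mulfI n4).
  by match type of e with _ = ?r => transitivity r end; [rewrite -e; field|by rewrite ?zqE ?mulrA].
- move=> g h; have [a ->] := zq_surj g; have [b ->] := zq_surj h.
  rewrite sum_zq !mixE !conj2.
  have /and3P[_ /(keqP hf) e _] := qallP (qallP (qallP hm a) a) b.
  rewrite /ksum !evE in e.
  apply: (mulfI n4).
  by match type of e with _ = ?r => transitivity r end; [rewrite -e; field|by rewrite ?zqE ?mulrA].
- move=> k g h; have [a ->] := zq_surj k; have [b ->] := zq_surj g; have [c ->] := zq_surj h.
  rewrite !zqE !mixE !chiE De.
  have /and4P[_ _ /(keqP hf) e _] := qallP (qallP (qallP hm a) b) c.
  move: e; rewrite !evE => e; rewrite mulrAC e; ring.
- move=> k g h; have [a ->] := zq_surj k; have [b ->] := zq_surj g; have [c ->] := zq_surj h.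
  rewrite !zqE !mixE !chiE De'.
  have /and5P[_ _ _ /(keqP hf) e _] := qallP (qallP (qallP hm a) b) c.
  by move: e; rewrite !evE => e; rewrite !mulrA e.
- move=> g h; have [a ->] := zq_surj g; have [b ->] := zq_surj h.
  rewrite sum_zq !zqE !mixE De.
  have /and5P[_ _ _ _ /andP[/(keqP hf) e _]] := qallP (qallP (qallP hm a) a) b.
  rewrite /ksum !evE in e.
  apply: (mulfI n4).
  by match type of e with _ = ?r => transitivity r end; [rewrite -e; field|by rewrite ?zqE ?mulrA].
- move=> k g; have [a ->] := zq_surj k; have [b ->] := zq_surj g.
  rewrite !zqE !mixE !chiE De Dt Dt' mulr1 mul1r.
  have /and5P[_ _ _ _ /and3P[_ /(keqP hf) e _]] := qallP (qallP (qallP hm a) b) b.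
  by move: e; rewrite !evE => <-; ring.
- move=> k g; have [a ->] := zq_surj k; have [b ->] := zq_surj g.
  rewrite !zqE !mixE !chiE Dt Dt' conjC1 mulr1 mul1r conj2.
  have /and5P[_ _ _ _ /and3P[_ _ /(keqP hf) e]] := qallP (qallP (qallP hm a) b) b.
  by move: e; rewrite !evE => <-; ring.
move=> k x y z; cbv zeta; have [a ->] := zq_surj k; have [b ->] := zq_surj x.
have [c ->] := zq_surj y; have [u ->] := zq_surj z.
rewrite !zqE sum_zq.
rewrite !sum_zq !zqE !mixE !DA !DA' !De !chiE !conj2.
have := keqP hf (qallP (qallP (qallP (qallP hc a) b) c) u).
rewrite /ksum !evE => e.
by match type of e with _ = ?l => transitivity (l / 16) end; [rewrite -e; field|field].
Qed.

End Accompanying4.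

Section Pairing.
Variable R : realType.
Local Notation C := R[i].

Lemma r2embE x : r2_ev R (r2emb x) = i_ev R x.
Proof. by rewrite /r2_ev /ext_ev /r2emb /= (km0 (i_morph R)) mul0r addr0. Qed.

Let kchi4E k g : r2_ev R (kchi4 k g) = 'i%C ^+ (qnat k * qnat g).
Proof.
rewrite /kchi4 r2embE; elim: (qnat k * qnat g)%N => [|n IH]; first exact: km1 (i_morph R).
rewrite iterS (kmM (i_morph R)) IH exprS /i_ev /ext_ev /ki.
by rewrite [fst _]/= [snd _]/= (km0 (v_morph R)) (km1 (v_morph R)) mul1r add0r.
Qed.

Lemma kchi4_0 k : r2_ev R (kchi4 k Q0) = 1.
Proof. by rewrite kchi4E muln0. Qed.

Lemma kchi4_faithful k : r2_ev R (kchi4 k Q1) = 1 -> k = Q0.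
Proof.
have n11 : (-1 : C) <> 1 by move/eqP; rewrite eq_sym -addr_eq0 -mulr2n pnatr_eq0.
have ii : 'i%C ^+ 2 = -1 :> C by exact: sqr_i.
rewrite kchi4E muln1; case: k => //= h; case: n11; rewrite -ii.
- by move: h; rewrite expr1 => ->; rewrite expr1n.
- by [].
by rewrite -[RHS](expr1n _ 2) -h -exprM (exprM _ 2 3) ii; ring.
Qed.

Lemma accompanying_tables (A A' : q4 -> q4 -> q4 -> Ki) (D D' : datum R 'Z_4) :
  check_mix_coef r2_ops r2_conj (r2emb (ki2 4 0)) kchi4 kmix4 (rtab A) (rtab A') ->
  (forall a b c, coef D (zq a) (zq b) (zq c) = i_ev R (A a b c) / 2) ->
  (forall a b c, coef D' (zq a) (zq b) (zq c) = i_ev R (A' a b c) / 2) ->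
  (forall h g, eps D (zq h) (zq g) = i_ev R (ksg i_ops h g)) ->
  (forall h g, eps D' (zq h) (zq g) = i_ev R (ksg i_ops h g)) ->
  (forall g, eta D g = 1) -> (forall g, eta D' g = 1) ->
  is_solution D -> accompanying D D'.
Proof.
move=> hA DA DA' De De' Dt Dt' hD.
have sgE h g : i_ev R (ksg i_ops h g) = r2_ev R (ksg r2_ops h g).
  by rewrite -(ksgE (i_morph R)) (ksgE (r2_morph R)).
apply: (accompanying4 (r2_morph R) (@r2_ev_conj R) _ check_chi4 check_mix4 kchi4_0
  kchi4_faithful hA) => //.
- by rewrite r2embE ki2E mul0r addr0.
- by move=> a b c; rewrite /rtab r2embE.
- by move=> a b c; rewrite /rtab r2embE.
- by move=> h g; rewrite -sgE.
- by move=> h g; rewrite -sgE.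
Qed.

End Pairing.

(** * Classification *)

(** The numbers [s + t] and [p + q] have sum [3 - 2 f] and sum of squares [7 - 4 f], so they are the
    roots [2 - f] and [1 - f] of one quadratic equation. *)
Lemma golden_sum_product (R : realFieldType) (f s p t q : R) :
  f * f = 1 + f -> 3 / 2 < f -> f < 2 -> s + p + t + q = 3 - 2 * f ->
  s ^+ 2 + p ^+ 2 + t ^+ 2 + q ^+ 2 = 4 - 2 * f -> 2 * (s * t + p * q) = 3 - 2 * f ->
  (s + t = 2 - f /\ p + q = 1 - f) \/ (s + t = 1 - f /\ p + q = 2 - f).
Proof.
move=> ff f1 f2 e1 e2 e3.
have : (s + t - (2 - f)) * (s + t - (1 - f)) = 0.
  have e4 : p + q = 3 - 2 * f - (s + t) by rewrite -e1; ring.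
  have e5 : (s + t) ^+ 2 + (p + q) ^+ 2 = 7 - 4 * f.
    by rewrite (_ : 7 - 4 * f = 4 - 2 * f + (3 - 2 * f)); [rewrite -e2 -e3|]; ring.
  rewrite e4 in e5; lra.
by move=> /eqP; rewrite mulf_eq0 => /orP[] /eqP h; [left|right]; split; lra.
Qed.

(** Eliminating [N] gives [p^2 + q^2 = 2 t^2], hence [s^2 + 3 t^2 = 4 - 2 f]; with the known [s + t]
    this is a quadratic in [t] that splits over the golden field. That [s] is nonzero is what later
    forces [eta = 1]. *)
Lemma golden_first (R : realFieldType) (f s p t q N : R) :
  f * f = 1 + f -> 3 / 2 < f -> f < 2 -> s + p + t + q = 3 - 2 * f ->
  s ^+ 2 + p ^+ 2 + t ^+ 2 + q ^+ 2 = 4 - 2 * f -> 2 * (s * t + p * q) = 3 - 2 * f ->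
  p ^+ 2 + q ^+ 2 + 2 * N = 1 -> 2 * t ^+ 2 + 2 * N = 1 ->
  s != 0 /\
  ((s + t = 2 - f /\ p + q = 1 - f) /\ (t = 1 / 2 \/ t = (1 - f) / 2) \/
   (s + t = 1 - f /\ p + q = 2 - f) /\ (t = - (1 / 2) \/ t = (2 - f) / 2)).
Proof.
move=> ff f1 f2 e1 e2 e3 e4 e5.
have e6 : s ^+ 2 + 3 * t ^+ 2 = 4 - 2 * f by lra.
have [[u w]|[u w]] := golden_sum_product ff f1 f2 e1 e2 e3.
- have {}e6 : (2 * t - 1) * (2 * t - (1 - f)) = 0.
    by rewrite (_ : s = 2 - f - t) in e6; lra.
  have h : t = 1 / 2 \/ t = (1 - f) / 2.
    by move/eqP: e6; rewrite mulf_eq0 => /orP[] /eqP h; [left|right]; lra.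
  split; last by left.
  by apply/eqP => s0; case: h => h; lra.
have {}e6 : (2 * t + 1) * (2 * t - (2 - f)) = 0.
  by rewrite (_ : s = 1 - f - t) in e6; lra.
have h : t = - (1 / 2) \/ t = (2 - f) / 2.
  by move/eqP: e6; rewrite mulf_eq0 => /orP[] /eqP h; [left|right]; lra.
split; last by right.
by apply/eqP => s0; case: h => h; lra.
Qed.

(** Compares two rows sharing [p] and [q]. They satisfy [t1^2 = t^2] and [s1 + t1 = s + t]; the sign
    [t1 = - t] would give [t (s + t) = 0], so [t = 0] and the rows coincide anyway. *)
Lemma golden_same (R : realFieldType) (f s p t q N s1 t1 N1 : R) :
  f * f = 1 + f -> 3 / 2 < f -> f < 2 -> s + p + t + q = 3 - 2 * f ->
  s ^+ 2 + p ^+ 2 + t ^+ 2 + q ^+ 2 = 4 - 2 * f -> 2 * (s * t + p * q) = 3 - 2 * f ->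
  p ^+ 2 + q ^+ 2 + 2 * N = 1 -> 2 * t ^+ 2 + 2 * N = 1 ->
  s1 + p + t1 + q = 3 - 2 * f ->
  p ^+ 2 + q ^+ 2 + 2 * N1 = 1 -> 2 * t1 ^+ 2 + 2 * N1 = 1 ->
  2 * (s1 * t1 + p * q) = 3 - 2 * f ->
  t1 = t /\ s1 = s.
Proof.
move=> ff f1 f2 e1 e2 e3 e4 e5 e6 e7 e8 e9.
have u : s + t != 0 by apply/eqP; have [[]|[]] := golden_sum_product ff f1 f2 e1 e2 e3; lra.
suff h : t1 = t by split=> //; lra.
have : (t1 - t) * (t1 + t) = 0 by lra.
move/eqP; rewrite mulf_eq0 => /orP[] /eqP h; first by lra.
have : t * (s + t) = 0 by rewrite (_ : s1 = s + 2 * t) in e9; [rewrite (_ : t1 = - t) in e9|]; lra.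
by move/eqP; rewrite mulf_eq0 (negPf u) orbF => /eqP t0; lra.
Qed.

(* The two signs are [a = epsilon_1(1)] and [sg = epsilon_2(1)], and
   [x + i y = A_0(1, 2)]. *)
Lemma golden_second (R : realFieldType) (f s p t q x y a sg v : R) :
  f * f = 1 + f -> 3 / 2 < f -> f < 2 -> v * v = f - 1 ->
  s + p + t + q = 3 - 2 * f ->
  s ^+ 2 + p ^+ 2 + t ^+ 2 + q ^+ 2 = 4 - 2 * f -> 2 * (s * t + p * q) = 3 - 2 * f ->
  p ^+ 2 + q ^+ 2 + 2 * (x ^+ 2 + y ^+ 2) = 1 ->
  2 * t ^+ 2 + 2 * (x ^+ 2 + y ^+ 2) = 1 ->
  a = 1 \/ a = -1 -> sg = 1 \/ sg = -1 ->
  (1 + sg) * (p + q) * x = 0 -> (1 - sg) * (q - p) * y = 0 ->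
  t ^+ 2 + sg * (x ^+ 2 - y ^+ 2) = 0 ->
  a * (p + q) * x + p * q + sg * (x ^+ 2 + y ^+ 2) = 0 ->
  a * (p - q) * y = 0 ->
  sg = -1 /\ x = - a / 2 /\ exists b : bool, let e := (-1) ^+ b in
    ([/\ s = (3 - f) / 2, p = (1 - f) / 2, t = (1 - f) / 2, q = (1 - f) / 2 & a * y = e * v / 2] \/
     [/\ s = (3 - 2 * f) / 2, p = (1 - f + e * v) / 2, t = 1 / 2,
         q = (1 - f - e * v) / 2 & y = 0]).
Proof.
move=> ff f1 f2 vv e1 e2 e3 e4 e5 ha hsg e6 e7 e8 e9 e10.
have [s0 cas] := golden_first ff f1 f2 e1 e2 e3 e4 e5.
have aa : a * a = 1 by case: ha => ->; ring.
have w0 : p + q != 0 by apply/eqP; case: cas => [[[_ ->] _]|[[_ ->] _]]; lra.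
clear e1 e2 e3 s0.
(* For [sg = 1] the real part [x] vanishes, so [y^2 = 1 / 4] and [p = q]; then [e9] reads
   [q^2 + 1 / 4 = 0]. *)
have sgE : sg = -1.
  case: hsg => // sg1; move: e6 e8 e9; rewrite sg1 => /eqP.
  rewrite !mulf_eq0 (negPf w0) orbF => /orP[/eqP|/eqP x0]; first lra.
  rewrite x0 in e5 * => e8 e9; have y0 : y ^+ 2 = 1 / 4 by lra.
  have yn : y != 0 by apply/eqP => h; rewrite h in y0; lra.
  have pq : p = q.
    have : a * y * (p - q) = 0 by rewrite -e10; ring.
    move/eqP; rewrite !mulf_eq0 (negPf yn) orbF => /orP[/eqP a0|/eqP]; last lra.
    by rewrite a0 in aa; lra.
  by rewrite pq in e9; have := sqr_ge0 q; lra.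
split=> //; move: e6 e7 e8 e9; rewrite sgE => e6 e7 e8 e9 {hsg sgE}.
have xx : x ^+ 2 = 1 / 4 by lra.
have xa : (2 * (a * x) - 1) * (2 * (a * x) + 1) = 0.
  by rewrite (_ : _ * _ = 4 * (a * a) * x ^+ 2 - 1); [rewrite aa xx; lra|ring].
have xE : 2 * (a * x) + 1 = 0 -> x = - a / 2.
  move=> h; have : a * (2 * (a * x) + 1) = 0 by rewrite h mulr0.
  by rewrite (_ : a * _ = 2 * (a * a) * x + a); [rewrite aa; lra|ring].
(* The branch [q = p] leads to the first family, the branch [y = 0] to the second; within each
   branch the surplus values of [t] contradict the bounds on [f]. *)
have : (q - p) * y = 0 by lra.
move/eqP; rewrite mulf_eq0 => /orP[] /eqP h.
- have pq : q = p by lra.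
  have tp : t ^+ 2 = p ^+ 2 by rewrite pq in e4; lra.
  have [[[u w] [tE|tE]]|[[u w] [tE|tE]]] := cas.
  + by exfalso; rewrite tE (_ : p = (1 - f) / 2) in tp; lra.
  + have pE : p = (1 - f) / 2 by lra.
    have yy : y ^+ 2 = (f - 1) / 4 by rewrite tE in e5; lra.
    have ax : 2 * (a * x) + 1 = 0.
      rewrite pq pE (_ : a * _ * x = (1 - f) * (a * x)) in e9; last by field.
      have : (1 - f) * (2 * (a * x) + 1) = 0 by lra.
      by move/eqP; rewrite mulf_eq0 => /orP[] /eqP //; lra.
    split; first exact: xE.
    have : (a * y - v / 2) * (a * y + v / 2) = 0.
      rewrite (_ : _ * _ = (a * a) * y ^+ 2 - (v * v) / 4); last by field.
      by rewrite aa yy vv; field.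
    move/eqP; rewrite mulf_eq0 => /orP[] /eqP hy; [exists false|exists true];
    by left; split; rewrite /= ?expr0 ?expr1; move: u tE pE pq hy; clear; move=> *; lra.
  + by exfalso; rewrite tE (_ : p = (2 - f) / 2) in tp; lra.
  have pE : p = (2 - f) / 2 by lra.
  exfalso; rewrite pq pE (_ : a * _ * x = (2 - f) * (a * x)) in e9; last by field.
  have yy : y ^+ 2 = (3 * f - 4) / 4 by rewrite tE in e5; lra.
  move: xa => /eqP; rewrite mulf_eq0 => /orP[] /eqP hx.
    by rewrite (_ : a * x = 1 / 2) in e9; lra.
  by rewrite (_ : a * x = - (1 / 2)) in e9; lra.
have tt : t ^+ 2 = 1 / 4 by rewrite h in e5; lra.
rewrite h in e4 e5 e9.
have [[[u w] [tE|tE]]|[[u w] [tE|tE]]] := cas.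
- have pq : p * q = (3 - 2 * f) / 4.
    have : (p + q) ^+ 2 = (1 - f) ^+ 2 by rewrite w.
    by rewrite sqrrD; lra.
  have ax : 2 * (a * x) + 1 = 0.
    rewrite w (_ : a * _ * x = (1 - f) * (a * x)) in e9; last by ring.
    have : (1 - f) * (2 * (a * x) + 1) = 0 by lra.
    by move/eqP; rewrite mulf_eq0 => /orP[] /eqP //; lra.
  split; first exact: xE.
  have : (p - q - v) * (p - q + v) = 0.
    rewrite (_ : _ * _ = (p + q) ^+ 2 - 4 * (p * q) - v * v); last by ring.
    by rewrite w pq vv; lra.
  move/eqP; rewrite mulf_eq0 => /orP[] /eqP hy; [exists false|exists true];
  by right; split; rewrite /= ?expr0 ?expr1; move: u w tE hy h; clear; move=> *; lra.
- by exfalso; rewrite tE in tt; lra.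
- have pq : p * q = (9 - 6 * f) / 4.
    have : (p + q) ^+ 2 = (2 - f) ^+ 2 by rewrite w.
    by rewrite sqrrD; lra.
  exfalso; rewrite w (_ : a * _ * x = (2 - f) * (a * x)) in e9; last by ring.
  move: xa => /eqP; rewrite mulf_eq0 => /orP[] /eqP hx.
    by rewrite (_ : a * x = 1 / 2) in e9; lra.
  by rewrite (_ : a * x = - (1 / 2)) in e9; lra.
by exfalso; rewrite tE in tt; lra.
Qed.

Section Classification.
Variables (R : realType) (s : datum R 'Z_4).
Hypothesis hs : is_solution s.
Local Notation C := R[i].
Local Notation fi := (phi R).
Implicit Types (g h k : q4) (z w : C).

Definition sqmod z : R := complex.Re z ^+ 2 + complex.Im z ^+ 2.

Lemma sqmodE z : z * z^* = (sqmod z)%:C.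
Proof.
by case: z => x y; apply/eqP; rewrite eq_complex /=; apply/andP; split; apply/eqP; rewrite /sqmod /=; ring.
Qed.

Lemma sqmodM z w : sqmod (z * w) = sqmod z * sqmod w.
Proof. by case: z w => [x y] [x' y']; rewrite /sqmod /=; ring. Qed.

Lemma sqmod_conj z : sqmod z^* = sqmod z.
Proof. by case: z => x y; rewrite /sqmod /= sqrrN. Qed.

Lemma sqmod_real (x : R) : sqmod x%:C = x ^+ 2.
Proof. by rewrite /sqmod /= expr0n addr0. Qed.

Lemma conj_fixed z : z^* = z -> z = (complex.Re z)%:C.
Proof. by case: z => x y [/= /eqP]; rewrite eqNr => /eqP ->. Qed.

Let e h g : C := eps s (zq h) (zq g).
Let A g h k : C := coef s (zq g) (zq h) (zq k).
Let et g : C := eta s (zq g).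

Let P1 h k g : e (qadd h k) g = e h g * e k (qadd g (qadd h h)).
Proof. by rewrite /e -(zqD h k) -(zqD g) -(zq_double h); case: (sol_P1 hs) => ->. Qed.
Let e0 h : e h Q0 = 1.
Proof. by rewrite /e -zq0; case: (sol_P1 hs). Qed.
Let esq h g : e h g * e h g = 1.
Proof. by rewrite /e; case: (sol_sign hs (zq h) (zq g)) => ->; rewrite ?mulrNN mulr1. Qed.
Let eQ0 g : e Q0 g = 1.
Proof. by have := P1 Q0 Q0 g; rewrite (_ : qadd g _ = g) ?esq //; case: g. Qed.
Let eQ2 h : e h Q2 = 1.
Proof. by have := P1 Q1 h Q0; rewrite !e0 mul1r => <-. Qed.

Let a : C := e Q1 Q1.
Let sg : C := e Q2 Q1.
Let e13 : e Q1 Q3 = a * sg.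
Proof. by rewrite /sg (P1 Q1 Q1 Q1) mulrA esq mul1r. Qed.
Let e33 : e Q3 Q3 = a.
Proof. by have := P1 Q1 Q3 Q1; rewrite eQ0 => h; rewrite -[LHS]mul1r -(esq Q1 Q1) -mulrA -h mulr1. Qed.
Let e31 : e Q3 Q1 = a * sg.
Proof.
have := P1 Q1 Q3 Q3; rewrite eQ0 => h; rewrite -e13 -[LHS]mul1r -(esq Q1 Q3) -mulrA.
by rewrite -[e Q3 Q1]/(e Q3 (qadd Q3 (qadd Q1 Q1))) -h mulr1.
Qed.
Let e23 : e Q2 Q3 = sg.
Proof. by rewrite (P1 Q1 Q1 Q3) e13 mulrAC esq mul1r. Qed.

Let P2 g : et (qadd g Q2) = et g.
Proof. by rewrite /et -(zqD g) -[zq Q2](zq_double Q1); case: (sol_P2 hs (zq g) (zq Q1)). Qed.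
Let et3 g : et g ^+ 3 = 1.
Proof. by case: (sol_P2 hs (zq g) 0). Qed.
Let et_conj g : (et g)^* = et g ^+ 2.
Proof.
have n : et g * (et g)^* = 1 by rewrite -normCK sol_circle ?expr1n.
by rewrite -[LHS]mul1r -(et3 g) exprSr -mulrA n mulr1.
Qed.
Let sqmod_et g : sqmod (et g) = 1.
Proof.
apply: (fmorph_inj (real_complex R)); rewrite /= -sqmodE et_conj -exprS et3.
by rewrite rmorph1.
Qed.
Let sqmod_e h g : sqmod (e h g) = 1.
Proof.
rewrite /e; case: (sol_sign hs (zq h) (zq g)) => ->; rewrite /sqmod /=; ring.
Qed.

Let P6 g h k : A g k h = (A g h k)^*. Proof. exact: sol_P6 hs _ _ _. Qed.
Let P7a g h k : A g h k = A g (qopp k) (qsub h k) * et g * e (qopp k) (qadd g h) *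
  e (qopp k) (qadd g k) * e (qopp k) (qadd (qadd g h) k).
Proof. by rewrite /A /e /qsub -!zqD -!zqN; case: (sol_P7 hs (zq g) (zq h) (zq k)). Qed.
Let P7b g h k : A g h k = A g (qsub k h) (qopp h) * (et g)^* * e (qopp h) (qadd g h) *
  e (qopp h) (qadd g k) * e (qopp h) (qadd (qadd g h) k).
Proof. by rewrite /A /e /qsub -!zqD -!zqN; case: (sol_P7 hs (zq g) (zq h) (zq k)). Qed.
Let P8 g h k : A g h k = A (qadd g h) h k * et g * et (qadd g k) *
  (et (qadd g h) * et (qadd (qadd g h) k))^* * e h g * e h (qadd g k).
Proof. by rewrite /A /e /et -!zqD; case: (sol_P8 hs (zq g) (zq h) (zq k)). Qed.
Let P5 g p q : A (qadd g Q2) p q =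
  e Q1 g * e Q1 (qadd g p) * e Q1 (qadd g q) * e Q1 (qadd (qadd g p) q) * A g p q.
Proof. by rewrite /A /e -!zqD -[zq Q2](zq_double Q1); exact: sol_P5 hs _ _ _ _. Qed.
Let P3 g : A g Q0 Q0 + A g Q1 Q0 + A g Q2 Q0 + A g Q3 Q0 = - (et g)^* * (2 * fi%:C - 3).
Proof. by have := sol_P3 hs (zq g); rewrite sum_zq zq0 gdim4C. Qed.
Let P4 g g' k : A g (qopp g) k * (A g' (qopp g') k)^* +
    A g (qsub Q1 g) k * (A g' (qsub Q1 g') k)^* +
    A g (qsub Q2 g) k * (A g' (qsub Q2 g') k)^* +
    A g (qsub Q3 g) k * (A g' (qsub Q3 g') k)^* =
  (qeq g g')%:R - (et g)^* * et g' * (2 * fi%:C - 3) * (qeq k Q0)%:R.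
Proof.
have := sol_P4 hs (zq g) (zq g') (zq k).
by rewrite sum_zq !zqE /kron zq0 !zqE gdim4C.
Qed.

Let r g h : C := et g * A g h Q0.
Let rr g h : R := complex.Re (r g h).
Let rE g h : r g h = (rr g h)%:C.
Proof.
apply: conj_fixed; rewrite /r rmorphM /= -P6 et_conj.
rewrite (P7a g h Q0) /qsub (_ : qadd h (qopp Q0) = h); last by case: h.
rewrite !eQ0 !mulr1; ring.
Qed.
Let A_r g h : A g h Q0 = (et g)^* * (rr g h)%:C.
Proof. by rewrite -rE /r mulrA et_conj -exprSr et3 mul1r. Qed.

Let F1 g : rr g Q0 + rr g Q1 + rr g Q2 + rr g Q3 = 3 - 2 * fi.
Proof.
apply: (fmorph_inj (real_complex R)); rewrite !rmorphD rmorphN rmorphM /= -!rE /r.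
rewrite -!mulrDr P3 et_conj !rmorph_nat mulNr mulrN mulrA -exprS et3.
by move: fi => f; ring.
Qed.

Let P5r g h : A (qadd g Q2) h Q0 = A g h Q0.
Proof.
rewrite P5 (_ : qadd g Q0 = g); last by case: g.
rewrite (_ : qadd (qadd g h) Q0 = qadd g h); last by case: g; case: h.
by rewrite -!mulrA (mulrCA (e Q1 (qadd g h))) !mulrA esq mul1r esq mul1r.
Qed.
Let rr2 g h : rr (qadd g Q2) h = rr g h.
Proof. by rewrite /rr /r P5r P2. Qed.

(** Absolute values forget signs and phases, so the order-three symmetry of (P7) moves every
    diagonal entry into column 0 and identifies the moduli at (1, 2), (1, 3) and (2, 3). *)
Let nnP7a g h k : sqmod (A g h k) = sqmod (A g (qopp k) (qsub h k)).
Proof. by rewrite P7a !sqmodM !sqmod_e sqmod_et !mulr1. Qed.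
Let nnP7b g h k : sqmod (A g h k) = sqmod (A g (qsub k h) (qopp h)).
Proof. by rewrite P7b !sqmodM !sqmod_e sqmod_conj sqmod_et !mulr1. Qed.
Let nnP6 g h k : sqmod (A g h k) = sqmod (A g k h).
Proof. by rewrite P6 sqmod_conj. Qed.
Let nn_r g h : sqmod (A g h Q0) = rr g h ^+ 2.
Proof. by rewrite A_r sqmodM sqmod_conj sqmod_et mul1r sqmod_real. Qed.
Let nn_diag g h : sqmod (A g h h) = rr g (qopp h) ^+ 2.
Proof.
by rewrite nnP7b /qsub (_ : qadd h (qopp h) = Q0); [rewrite nnP6 nn_r|case: h].
Qed.
Let nn13 g : sqmod (A g Q1 Q3) = sqmod (A g Q1 Q2). Proof. by rewrite nnP7a. Qed.
Let nn23 g : sqmod (A g Q2 Q3) = sqmod (A g Q1 Q2). Proof. by rewrite nnP7a nn13. Qed.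

Let nnP4 g k : sqmod (A g Q0 k) + sqmod (A g Q1 k) + sqmod (A g Q2 k) + sqmod (A g Q3 k) =
  1 - (2 * fi - 3) * (qeq k Q0)%:R.
Proof.
apply: (fmorph_inj (real_complex R)); rewrite 3!rmorphD /= -!sqmodE.
rewrite [RHS](_ : _ = 1 - (2 * fi%:C - 3) * (qeq k Q0)%:R); last first.
  by rewrite rmorphB rmorphM rmorphB rmorphM /= !rmorph_nat rmorph1.
have := P4 g g k; rewrite et_conj -exprSr et3 mul1r (_ : qeq g g = true); last by case: g.
by move=> <-; case: g; rewrite /qsub /=; ring.
Qed.

Let F2 g : rr g Q0 ^+ 2 + rr g Q1 ^+ 2 + rr g Q2 ^+ 2 + rr g Q3 ^+ 2 = 4 - 2 * fi.
Proof. by have := nnP4 g Q0; rewrite !nn_r => ->; rewrite mulr1; move: fi => f; ring. Qed.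
Let F4 g : rr g Q1 ^+ 2 + rr g Q3 ^+ 2 + 2 * sqmod (A g Q1 Q2) = 1.
Proof.
have := nnP4 g Q1; rewrite mulr0 subr0 => h; rewrite -[RHS]h {h}.
rewrite (nnP6 g Q0) (nnP6 g Q2) (nnP6 g Q3) nn13 nn_diag nn_r /=; ring.
Qed.
Let F5 g : 2 * rr g Q2 ^+ 2 + 2 * sqmod (A g Q1 Q2) = 1.
Proof.
have := nnP4 g Q2; rewrite mulr0 subr0 => h; rewrite -[RHS]h {h}.
rewrite (nnP6 g Q0) (nnP6 g Q3) nn23 nn_diag nn_r /=; ring.
Qed.
(** (P4) for the distinct indices [g] and [g + 2], whose columns at 0 agree: the sum pairs each
    entry with the entry shifted by 2. *)
Let F3 g : 2 * (rr g Q0 * rr g Q2 + rr g Q1 * rr g Q3) = 3 - 2 * fi.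
Proof.
apply: (fmorph_inj (real_complex R)).
have := P4 g (qadd g Q2) Q0; rewrite !P5r P2 mulr1 !A_r.
rewrite (_ : qeq g _ = false); last by case: g.
have n : (et g)^* * et g = 1 by rewrite et_conj -exprSr et3.
have re (x : R) : (x%:C : C)^* = x%:C by exact: conjC_real.
rewrite n !rmorphM /= !conjCK !re => h.
rewrite [RHS](_ : _ = 0 - 1 * (2 * fi%:C - 3)); last first.
  by rewrite rmorphB rmorphM /= !rmorph_nat; ring.
rewrite -h rmorph_nat rmorphD 2!rmorphM /=; case: g n {h} => n; rewrite /qsub /=; ring: n.
Qed.

(** The first relation of (P8) moves [g] by [h], so it joins the rows 0 and 1 only at odd [h]; the
    even entries are compared by [golden_same]. *)
Let F6 : rr Q1 Q1 = rr Q0 Q1 /\ rr Q1 Q3 = rr Q0 Q3.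
Proof.
split; apply: (fmorph_inj (real_complex R)); rewrite /= -!rE /r.
- rewrite (P8 Q0 Q1 Q0) /= !rmorphM /= !et_conj !e0.
  by ring: (et3 Q0) (et3 Q1).
- rewrite (P8 Q1 Q3 Q0) /= !rmorphM /= !et_conj.
  by ring: (et3 Q0) (et3 Q1) (esq Q3 Q1).
Qed.

Let ff : fi * fi = 1 + fi := phi_sq R.
Let f1 : 3 / 2 < fi. Proof. by case: (phi_bounds R). Qed.
Let f2 : fi < 2. Proof. by case: (phi_bounds R). Qed.

(** (P7) at [h = k = 0] reads [A_g(0, 0) = A_g(0, 0) eta_g], and [golden_first] shows that this
    entry is nonzero. *)
Let etE g : et g = 1.
Proof.
have nz g' : rr g' Q0 != 0.
  have e1 := F1 g'; have e2 := F2 g'; have e3 := F3 g'.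
  by have [] := golden_first ff f1 f2 e1 e2 e3 (F4 g') (F5 g').
have nA : A g Q0 Q0 != 0.
  apply: contraNneq (nz g) => h; by rewrite /rr /r h mulr0.
apply: (mulfI nA); rewrite mulr1; have := P7a g Q0 Q0.
by rewrite /qsub /= !eQ0 !mulr1 => <-.
Qed.

Let p_ h := rr Q0 h.
Let rrE g h : rr g h = p_ h.
Proof.
have [F6a F6b] := F6.
have [h2 h0] : rr Q1 Q2 = rr Q0 Q2 /\ rr Q1 Q0 = rr Q0 Q0.
  have := F1 Q1; have := F4 Q1; have := F3 Q1; rewrite F6a F6b => g3 g4 g1.
  exact: (golden_same ff f1 f2 (F1 Q0) (F2 Q0) (F3 Q0) (F4 Q0) (F5 Q0) g1 g4 (F5 Q1) g3).
have h1 h' : rr Q1 h' = rr Q0 h' by case: h'.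
case: g => //; first exact: (rr2 Q0).
by rewrite (rr2 Q1).
Qed.
Let A0 g h : A g h Q0 = (p_ h)%:C.
Proof. by rewrite A_r etE conjC1 mul1r rrE. Qed.

Definition sign4 (a sg : C) h g : C :=
  match h, g with
  | Q1, Q1 | Q3, Q3 => a | Q1, Q3 | Q3, Q1 => a * sg | Q2, Q1 | Q2, Q3 => sg
  | _, _ => 1
  end.

Let eE h g : e h g = sign4 a sg h g.
Proof. by case: h; case: g; rewrite /= ?eQ0 ?e0 ?eQ2. Qed.

(** Under (P6) and (P7) every index pair reaches column 0 or the pair (1, 2), which leaves the real
    row [p] and, by (P8), the single number [Y]. *)
Definition entry4 (a sg : C) (p : q4 -> R) (Y : C) g h k : C :=
  let Z := match g with Q0 | Q1 => Y | _ => sg * Y end in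
  let u13 := Z * (sign4 a sg Q1 (qadd g Q1) * sign4 a sg Q1 (qadd g Q3) * sign4 a sg Q1 g) in
  let u23 := u13 * (sign4 a sg Q1 (qadd g Q2) * sign4 a sg Q1 (qadd g Q3) *
               sign4 a sg Q1 (qadd g Q1)) in
  match h, k with
  | Q0, _ => (p k)%:C | _, Q0 => (p h)%:C
  | Q1, Q1 => sign4 a sg h g * (p Q3)%:C
  | Q2, Q2 => sign4 a sg h g * (p Q2)%:C
  | Q3, Q3 => sign4 a sg h g * (p Q1)%:C
  | Q1, Q2 => Z | Q2, Q1 => Z^*
  | Q1, Q3 => u13 | Q3, Q1 => u13^*
  | Q2, Q3 => u23 | Q3, Q2 => u23^*
  end.

Let Y := A Q0 Q1 Q2.
Let Z12 g : A g Q1 Q2 = match g with Q0 | Q1 => Y | _ => sg * Y end.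
Proof.
have [aa ss] := (esq Q1 Q1 : a * a = 1, esq Q2 Q1 : sg * sg = 1).
have s1 : A Q0 Q1 Q2 = A Q1 Q1 Q2.
  by rewrite (P8 Q0) !etE /= e0 eQ2 !mulr1 conjC1 !mulr1.
have s2 : A Q2 Q1 Q2 = sg * A Q1 Q1 Q2.
  by rewrite (P8 Q1) !etE /= e13 -/a !mulr1 conjC1; ring: aa ss.
have s3 : A Q2 Q1 Q2 = A Q3 Q1 Q2.
  by rewrite (P8 Q2) !etE /= e0 eQ2 !mulr1 conjC1 !mulr1.
by case: g; rewrite // -?s1 -?s3 // s2 -s1.
Qed.

Let AE g h k : A g h k = entry4 a sg p_ Y g h k.
Proof.
have u13 x : A x Q1 Q3 = entry4 a sg p_ Y x Q1 Q3.
  by rewrite P7a etE /qsub /= Z12 !eE; case: x => /=; ring.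
have u23 x : A x Q2 Q3 = entry4 a sg p_ Y x Q2 Q3.
  by rewrite P7a etE /qsub /= u13 !eE; case: x => /=; ring.
have dg x y : A x y y = sign4 a sg y x * (p_ (qopp y))%:C.
  rewrite P7b etE conjC1 mulr1 /qsub (_ : qadd y (qopp y) = Q0); last by case: y.
  rewrite P6 A0 conjC_real -(mulrA (p_ _)%:C) esq mulr1 mulrC -eE.
  congr (_ * _); have := P1 y (qopp y) x.
  rewrite (_ : qadd y (qopp y) = Q0); last by case: y.
  rewrite eQ0 (_ : qadd (qadd x y) y = qadd x (qadd y y)); last by case: x; case: y.
  by move=> h'; rewrite -[LHS]mul1r -(esq y x) -mulrA -h' mulr1.
case: h; case: k => /=; rewrite ?A0 ?dg ?Z12 ?u13 ?u23 //=.
all: by rewrite P6 ?A0 ?Z12 ?u13 ?u23 ?conjC_real.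
Qed.

Let ar := complex.Re a.
Let sr := complex.Re sg.
Let aE : a = ar%:C /\ (ar = 1 \/ ar = -1).
Proof.
rewrite /ar /a /e; case: (sol_sign hs (zq Q1) (zq Q1)) => -> /=.
  by split; [|left].
by split; [rewrite rmorphN|right].
Qed.
Let sgE : sg = sr%:C /\ (sr = 1 \/ sr = -1).
Proof.
rewrite /sr /sg /e; case: (sol_sign hs (zq Q2) (zq Q1)) => -> /=.
  by split; [|left].
by split; [rewrite rmorphN|right].
Qed.

Let y1 := complex.Re Y.
Let y2 := complex.Im Y.
Let YE : Y = y1 +i* y2. Proof. by rewrite /y1 /y2; case: Y. Qed.

(** Three further instances of (P4), at the triples (0, 2, 1), (0, 2, 2) and (0, 1, 1), supply the
    remaining hypotheses of [golden_second] through their real and imaginary parts. *)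
Lemma classification_reals :
  sr = -1 /\ y1 = - ar / 2 /\ exists b : bool, let u := (-1) ^+ b in
    ([/\ p_ Q0 = (3 - fi) / 2, p_ Q1 = (1 - fi) / 2, p_ Q2 = (1 - fi) / 2,
         p_ Q3 = (1 - fi) / 2 & ar * y2 = u * psi R / 2] \/
     [/\ p_ Q0 = (3 - 2 * fi) / 2, p_ Q1 = (1 - fi + u * psi R) / 2, p_ Q2 = 1 / 2,
         p_ Q3 = (1 - fi - u * psi R) / 2 & y2 = 0]).
Proof.
have [ea ha] := aE; have [es hsg] := sgE.
have n1 := F4 Q0; have n2 := F5 Q0; rewrite /sqmod -/Y -/y1 -/y2 in n1 n2.
have k1 := P4 Q0 Q2 Q1; rewrite !AE /= ea es YE mulr0 subr0 !conjcE in k1.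
have k2 := P4 Q0 Q2 Q2; rewrite !AE /= ea es YE mulr0 subr0 !conjcE in k2.
have k3 := P4 Q0 Q1 Q1; rewrite !AE /= ea es YE mulr0 subr0 !conjcE in k3.
have aa : ar * ar = 1 by case: ha => ->; ring.
have ss : sr * sr = 1 by case: hsg => ->; ring.
have k1a := congr1 (@complex.Re R) k1; have k1b := congr1 (@complex.Im R) k1.
have k2a := congr1 (@complex.Re R) k2.
have k3a := congr1 (@complex.Re R) k3; have k3b := congr1 (@complex.Im R) k3.
rewrite /= in k1a k1b k2a k3a k3b.
have n2' : 2 * (p_ Q2 ^+ 2 + sr * (y1 ^+ 2 - y2 ^+ 2)) = 0.
  rewrite -[RHS]k2a; move: aa ss; move: (p_ Q2) y1 y2 ar sr => ? ? ? ? ? aa ss.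
  ring: aa ss.
apply: (golden_second ff f1 f2 (psi_sq R) (F1 Q0) (F2 Q0) (F3 Q0) n1 n2 ha hsg).
- rewrite -[RHS]k1a -/(p_ Q1) -/(p_ Q3); move: aa ss.
  move: (p_ Q1) (p_ Q3) y1 y2 ar sr => ? ? ? ? ? ? aa ss; ring: aa ss.
- rewrite -[RHS]k1b -/(p_ Q1) -/(p_ Q3); move: aa ss.
  move: (p_ Q1) (p_ Q3) y1 y2 ar sr => ? ? ? ? ? ? aa ss; ring: aa ss.
- by move/eqP: n2'; rewrite mulf_eq0 pnatr_eq0 => /eqP.
- rewrite -[RHS]k3a -/(p_ Q1) -/(p_ Q3); move: aa ss.
  move: (p_ Q1) (p_ Q3) y1 y2 ar sr => ? ? ? ? ? ? aa ss; ring: aa ss.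
- rewrite -[RHS]k3b -/(p_ Q1) -/(p_ Q3); move: aa ss.
  move: (p_ Q1) (p_ Q3) y1 y2 ar sr => ? ? ? ? ? ? aa ss; ring: aa ss.
Qed.

Let sgN : sg = -1.
Proof. by have [-> _] := sgE; have [-> _] := classification_reals; rewrite rmorphN rmorph1. Qed.

Let gauge_golden : gauge_equiv s
  (golden_datum (p_ Q0)%:C (p_ Q1)%:C (p_ Q2)%:C (p_ Q3)%:C (a * Y)).
Proof.
(* The sign [epsilon_1(1)] joins the points 1 and 3, so changing the gauge at 3 alone normalizes it
   to 1. The entry [A_0(1, 2)] involves all four points and is multiplied by [a]. *)
pose dl x := if x is Q3 then a else 1.
have a1 : a = 1 \/ a = -1 by exact: sol_sign hs _ _.
exists (fun g : 'Z_4 => dl (qz g)); split.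
- by move=> g; case: (qz g); rewrite /dl; by [left|].
- move=> h g; have [x ->] := zq_surj h; have [y ->] := zq_surj g.
  rewrite !zqE !zqK -/(e x y) eE sgN.
  rewrite (_ : eps _ _ _ = if qeps x y then -1 else 1); last by case: x; case: y.
  by case: a1 => a1; case: x; case: y; rewrite /= /dl /= ?a1; ring.
- by move=> g; have [x ->] := zq_surj g; rewrite -/(et x) etE.
move=> g h k; have [x ->] := zq_surj g; have [y ->] := zq_surj h; have [z ->] := zq_surj k.
rewrite !zqE !zqK -/(A x y z) AE sgN.
rewrite (_ : coef _ _ _ _ = gcoef -%R (fun x => x^*) (p_ Q0)%:C (p_ Q1)%:C (p_ Q2)%:C
  (p_ Q3)%:C (a * Y) (qnat x) (qnat y) (qnat z)); last by case: x; case: y; case: z.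
have cM (u w : C) : (u * w)^* = u^* * w^* := rmorphM _ u w.
have cN (u : C) : (- u)^* = - u^* := rmorphN _ u.
move: Y p_ => Y' p; rewrite /dl.
by case: a1 => ->; case: x; case: y; case: z; rewrite /gcoef /= ?(cM, cN, conjC1) ?(mulr1, mul1r, mulrN1, mulN1r, opprK).
Qed.

Lemma classification : [/\ forall g : 'Z_4, eta s g = 1, eps s 2 1 = -1 &
  exists b, gauge_equiv s (par1 R b) \/ gauge_equiv s (par2 R b)].
Proof.
split.
- by move=> g; have [x ->] := zq_surj g; exact: etE.
- have := sgN; rewrite /sg /e; congr (eps s _ _ = _); exact: val_inj.
have [ea ha] := aE; have aa : ar * ar = 1 by case: ha => ->; ring.
have [_ [hy1 [b hb]]] := classification_reals; exists b.
have := gauge_golden; rewrite ea YE hy1.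
have -> : ar%:C * ((- ar / 2) +i* y2) = (- (1 / 2)) +i* (ar * y2).
  by apply/eqP; rewrite eq_complex /=; apply/andP; split; apply/eqP; [field: aa|ring].
case: hb => -[-> -> -> -> e2] hg; [left|right]; first by rewrite e2 in hg.
by rewrite e2 mulr0 in hg.
Qed.

End Classification.

(** * Equivalence of solutions *)

Section Equivalence.
Variables (R : realType) (G : finZmodType).
Implicit Types s D : datum R G.

Lemma gauge_refl s : gauge_equiv s s.
Proof.
exists (fun=> 1); split=> [g|h g|//|g h k]; first by left.
  by rewrite !mul1r.
by rewrite !mul1r.
Qed.

Lemma gauge_equivalent s D : gauge_equiv s D -> equivalent s D.
Proof. by move=> hg; exists id, s; split=> //; exists id. Qed.

(** In [equivalent] the automorphism precedes the gauge transformation; passing it to the front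
    replaces [delta] by its composite with negation. *)
Lemma gauge_reflect s D D' :
  aut_image -%R D D' -> gauge_equiv s D -> equivalent s D'.
Proof.
move=> [he ht hA] [dl [dl1 de dt dA]].
exists -%R, (Datum (fun h g => eps s (- h) (- g)) (fun g => eta s (- g))
  (fun g h k => coef s (- g) (- h) (- k))); split.
- by exists -%R; exact: opprK.
- exact: opprD.
- by split=> /=; move=> *; rewrite ?opprK.
exists (fun g => dl (- g)); split=> /=.
- by move=> g.
- by move=> h g; rewrite -[h in LHS]opprK -[g in LHS]opprK he de opprD mulNrn.
- by move=> g; rewrite -[g in LHS]opprK ht dt.
- move=> g h k; rewrite -[g in LHS]opprK -[h in LHS]opprK -[k in LHS]opprK hA dA.
  by rewrite !opprD.
Qed.

End Equivalence.

(** * Comparison of the normal forms with the stated tables *)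

Section Summary.
Variable R : realType.
Local Notation C := R[i].
Local Notation d := (gdim R 'Z_4).

Let eps_reflect (h g : 'Z_4) : eps4 R (- h) (- g) = eps4 R h g.
Proof.
have [x ->] := zq_surj h; have [y ->] := zq_surj g; rewrite !zqN !(ksgE (i_morph R)).
by case: x; case: y.
Qed.

(** Negation exchanges the two conjugate choices of [z], which is why they represent one class. *)
Lemma par1_reflect b : aut_image -%R (par1 R b) (par1 R (~~ b)).
Proof.
split=> [h g|//|g h k]; first exact: eps_reflect.
have [x ->] := zq_surj g; have [y ->] := zq_surj h; have [z ->] := zq_surj k.
rewrite !zqN !par1_coefE; congr (i_ev R _ / 2).
by case: b; case: x; case: y; case: z.
Qed.

Lemma par2_reflect b : aut_image -%R (par2 R b) (par2 R (~~ b)).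
Proof.
split=> [h g|//|g h k]; first exact: eps_reflect.
have [x ->] := zq_surj g; have [y ->] := zq_surj h; have [z ->] := zq_surj k.
rewrite !zqN !par2_coefE; congr (i_ev R _ / 2).
by case: b; case: x; case: y; case: z.
Qed.

Lemma solution_equivalent (s : datum R 'Z_4) : is_solution s ->
  equivalent s (par1 R false) \/ equivalent s (par2 R false).
Proof.
move=> /classification[_ _ [[] [] hg]].
- by left; exact: gauge_reflect (par1_reflect true) hg.
- by right; exact: gauge_reflect (par2_reflect true) hg.
- by left; exact: gauge_equivalent.
- by right; exact: gauge_equivalent.
Qed.

Lemma special_par1 b : special4 (par1 R b).
Proof.
move=> h; have [x ->] := zq_surj h; rewrite /kron zq0 zq_eq gdim4B1.
by case: x; rewrite /= /gcoef /=; apply/eqP; rewrite eq_complex /=;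
  apply/andP; split; apply/eqP; move: (phi R) => f; field.
Qed.

Lemma not_special_par2 b : ~ special4 (par2 R b).
Proof.
(* At [h = 2] the entry is [1 / 2], whereas the special condition asks for the negative number
   [(1 - phi) / 2]. *)
move=> /(_ (zq Q2)); rewrite /kron zq0 zq_eq gdim4B1 /= /gcoef /=.
move=> /(congr1 (@complex.Re R)) /=; have [] := phi_bounds R; lra.
Qed.

(** In column 0 each gauge sign occurs twice, so this column is gauge invariant; the property
    separates the two classes. *)
Lemma special_equivalent (s s' : datum R 'Z_4) : equivalent s s' -> special4 s -> special4 s'.
Proof.
move=> [th [t [bij thD [_ _ hA] [dl [dl1 _ _ dA]]]]] sp h.
have th0 : th 0 = 0 by apply: (addrI (th 0)); rewrite -thD !addr0.
have [th' _ thK] := bij; have hh : h = th (th' h) by rewrite thK.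
move: (th' h) hh => h' -> {th' thK}.
have -> : coef s' 0 (th h') 0 = coef s 0 h' 0.
  rewrite dA !addr0 add0r -[in coef t _ _ _]th0 hA.
  by case: (dl1 0) => ->; case: (dl1 (th h')) => ->; ring.
by rewrite sp /kron -[in RHS]th0 (inj_eq (bij_inj bij)).
Qed.

Lemma datum4_solution b : is_solution (datum4 R b).
Proof.
apply: (check_solutionP (i_morph R) (@i_ev_conj R) (@ki2E R) (check_ktab1 b)) => // [x y z|h g].
  by rewrite -par1_coefE -coef4E.
exact: ksgE (i_morph R) _ _.
Qed.

Lemma par1_datum4 b : gauge_equiv (par1 R b) (datum4 R b).
Proof.
have [dl [dl1 de dt dA]] := gauge_refl (par1 R b).
by exists dl; split=> // g h k; rewrite -dA -coef4E.
Qed.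

Lemma par1_equiv_datum4 b : equivalent (par1 R false) (datum4 R b).
Proof.
case: b; last exact: gauge_equivalent (par1_datum4 false).
apply: (gauge_reflect _ (gauge_refl _)).
have [he ht hA] := par1_reflect false; split=> // g h k.
by rewrite [coef _ _ _ _]coef4E hA.
Qed.

(** With [epsilon] fixed, the remaining gauge signs satisfy [delta_(g+2) = delta_g]. They depend
    only on parity, and among [g], [g + h], [g + k], [g + h + k] each parity occurs an even number
    of times, so [A] is unchanged. *)
Lemma special_unique (s : datum R 'Z_4) : is_solution s -> special4 s ->
  (forall h g, eps s h g = eps4 R h g) ->
  exists b, forall g h k, coef s g h k = coef4 R b g h k.
Proof.
move=> hs sp he; have [_ _ [b hb]] := classification hs; exists b.
case: hb => [[dl [dl1 de _ dA]]|hg]; last first.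
  by case: (@not_special_par2 b); exact: special_equivalent (gauge_equivalent hg) sp.
have sq g : dl g * dl g = 1 by case: (dl1 g) => ->; rewrite ?mulrNN mulr1.
have dl2 x : dl (zq (qadd x Q2)) = dl (zq x).
  have := de (zq Q1) (zq x); rewrite he !zqE /=.
  have e0 : eps4 R (zq Q1) (zq x) != 0.
    by rewrite /eps4; case: ifP; rewrite ?oppr_eq0 oner_eq0.
  rewrite -[LHS]mul1r => /(mulIf e0) e1.
  by rewrite -[LHS]mul1r -(sq (zq x)) -mulrA -e1 mulr1.
have [h2 h3] : dl (zq Q2) = dl (zq Q0) /\ dl (zq Q3) = dl (zq Q1).
  by split; [exact: (dl2 Q0)|exact: (dl2 Q1)].
have [q0 q1] := (sq (zq Q0), sq (zq Q1)).
move=> g h k; rewrite coef4E dA.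
have [x ->] := zq_surj g; have [y ->] := zq_surj h; have [z ->] := zq_surj k.
rewrite !zqE; set c := coef _ _ _ _.
by case: x @c; case: y; case: z => c /=; rewrite ?h2 ?h3; ring: q0 q1.
Qed.

End Summary.

Theorem theorem9p2 (R : realType) :
  gdim R 'Z_4 = 2 + Num.sqrt 5 /\
  (forall b : bool, z4 R b =
     (- ((1 + Num.sqrt 5) / 2)) +i*
     ((-1) ^+ b * Num.sqrt ((1 + Num.sqrt 5) / 2))) /\
  (forall s : datum R 'Z_4, is_solution s ->
     (forall g, eta s g = 1) /\ eps s 2 1 = -1) /\
  exists s1 s2 : datum R 'Z_4,
    (is_solution s1 /\ is_solution s2) /\
    ~ equivalent s1 s2 /\
    (forall s : datum R 'Z_4, is_solution s ->
       equivalent s s1 \/ equivalent s s2) /\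
    (accompanying s1 s2 /\ accompanying s2 s1) /\
    (special4 s1 /\ ~ special4 s2) /\
    (forall b : bool,
       is_solution (datum4 R b) /\ equivalent s1 (datum4 R b)) /\
    (forall s : datum R 'Z_4, is_solution s -> special4 s ->
       (forall h g, eps s h g = eps4 R h g) ->
       exists b : bool, forall g h k, coef s g h k = coef4 R b g h k) /\
    (forall (M : starAlgType R) (W : von_neumann M) (al : 'Z_4 -> M -> M)
            (rho : M -> M) (S : M) (T : 'Z_4 -> M),
       type_III_realization al rho S T s1 ->
       exists (N : set M) (ib : M -> M),
         [/\ subfactor W N,
             has_index N (3 + Num.sqrt 5),
             conjugate_inclusion N ib &
             direct_sum_endo ib id rho]).
Proof.
split; first exact: gdim4.
split; first by move=> b; rewrite z4E /phi -lock.
split; first by move=> s hs; have [] := classification hs.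
have e1 b h g := ksgE (i_morph R) h g.
exists (par1 R false), (par2 R false).
split; first by split; [exact: par1_solution|exact: par2_solution].
split; first by move=> /special_equivalent/(_ (special_par1 R false)); exact: not_special_par2.
split; first exact: solution_equivalent.
split.
  split.
    apply: (accompanying_tables check_mix_coef12) => //; by
      [exact: par1_coefE|exact: par2_coefE|exact: ksgE (i_morph R)|exact: par1_solution].
  apply: (accompanying_tables check_mix_coef21) => //; by
    [exact: par1_coefE|exact: par2_coefE|exact: ksgE (i_morph R)|exact: par2_solution].
split; first by split; [exact: special_par1|exact: not_special_par2].
split; first by move=> b; split; [exact: datum4_solution|exact: par1_equiv_datum4].
split; first exact: special_unique.
move=> M W al rho S T [[Mfac _] [_ nrho] hr].
have -> : 3 + Num.sqrt 5 = 1 + gdim R 'Z_4 by rewrite gdim4; ring.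
apply: (special_subfactor W Mfac hr) => //.
- by rewrite gdim4; have [] := sqrt5_bounds R; lra.
- exact: par1_solution.
- exact: special_par1.
Qed.
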